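(* Let $\mathbf{F}$ be a field of characteristic zero and let $\varphi\in\mathcal{A}=\mathbf{F}[x,y,z]$ be a weight homogeneous polynomial with an isolated singularity, with associated Poisson structure $$\{\cdot,\cdot\}_\varphi=\frac{\partial\varphi}{\partial x}\frac{\partial}{\partial y}\wedge\frac{\partial}{\partial z}+\frac{\partial\varphi}{\partial y}\frac{\partial}{\partial z}\wedge\frac{\partial}{\partial x}+\frac{\partial\varphi}{\partial z}\frac{\partial}{\partial x}\wedge\frac{\partial}{\partial y}.$$ Let $(\mathfrak{g}_\varphi,\partial_\varphi,[\cdot,\cdot]_S)$ be the dg Lie algebra of all skew-symmetric multiderivations of $\mathcal{A}$, with the Schouten bracket and differential $\partial_\varphi=[\{\cdot,\cdot\}_\varphi,\cdot]_S$. Let $\mathfrak{C}$ be the set of all pairs $(\mathbf{c},\bar{\mathbf{c}})$ of families of constants in $\mathbf{F}$, $\mathbf{c}=(c^k_{l,i})_{(l,i)\in\mathbf{N}\times\mathcal{E}_\varphi,\,k\in\mathbf{N}^*}$ and $\bar{\mathbf{c}}=(\bar c^{\,k}_r)_{1\le r\le\mu-1,\,k\in\mathbf{N}^*}$, such that for every $k_0\in\mathbf{N}^*$ the sequences $(c^{k_0}_{l,i})_{(l,i)}$ and $(\bar c^{\,k_0}_r)_r$ have finite support. For $(\mathbf{c},\bar{\mathbf{c}})\in\mathfrak{C}$ put $\gamma^{\mathbf{c},\bar{\mathbf{c}}}=\sum_{n\in\mathbf{N}^*}\gamma_n^{\mathbf{c},\bar{\mathbf{c}}}\nu^n\in\nu\mathfrak{g}^1_\varphi[[\nu]]$,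 where for all $n\in\mathbf{N}^*$ $$\gamma_n^{\mathbf{c},\bar{\mathbf{c}}}=\sum_{\substack{(l,i)\in\mathbf{N}\times\mathcal{E}_\varphi\\ 1\le r\le\mu-1}}\ \sum_{\substack{a+b=n\\ a,b\in\mathbf{N}^*}}c^a_{l,i}\bar c^{\,b}_r\,\varphi^lu_i\{\cdot,\cdot\}_{u_r}+\sum_{(m,j)\in\mathbf{N}\times\mathcal{E}_\varphi}c^n_{m,j}\,\varphi^mu_j\{\cdot,\cdot\}_\varphi+\sum_{1\le s\le\mu-1}\bar c^{\,n}_s\{\cdot,\cdot\}_{u_s}.$$ Then: (1) The set of all gauge equivalence classes of the formal solutions of the Maurer–Cartan equation associated to $(\mathfrak{g}_\varphi,\partial_\varphi,[\cdot,\cdot]_S)$ is $$\mathcal{D}ef^\nu(\mathfrak{g}_\varphi)=\{\gamma^{\mathbf{c},\bar{\mathbf{c}}}\mid(\mathbf{c},\bar{\mathbf{c}})\in\mathfrak{C}\}/\sim,$$ where $\sim$ is the gauge equivalence (that is, each $\gamma^{\mathbf{c},\bar{\mathbf{c}}}$ lies in $\mathcal{MC}^\nu(\mathfrak{g}_\varphi)$ and every element of $\mathcal{MC}^\nu(\mathfrak{g}_\varphi)$ is gauge equivalent to some $\gamma^{\mathbf{c},\bar{\mathbf{c}}}$). (2) If $\varpi(\varphi)\ne|\varpi|$, then this set is exactly $$\mathcal{D}ef^\nu(\mathfrak{g}_\varphi)=\{\gamma^{\mathbf{c},\bar{\mathbf{c}}}\mid(\mathbf{c},\bar{\mathbf{c}})\in\mathfrak{C}\}$$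 (that is, sending an element to its class is a bijection from $\{\gamma^{\mathbf{c},\bar{\mathbf{c}}}\mid(\mathbf{c},\bar{\mathbf{c}})\in\mathfrak{C}\}$ onto $\mathcal{D}ef^\nu(\mathfrak{g}_\varphi)$).
   Context: **Weights.** $\varphi\in\mathbf{F}[x,y,z]$ is weight homogeneous of weighted degree $\varpi(\varphi)\in\mathbf{N}$ if there are positive integers $\varpi_1,\varpi_2,\varpi_3$ (weights of $x,y,z$) without common divisor with $\varpi_1x\frac{\partial\varphi}{\partial x}+\varpi_2y\frac{\partial\varphi}{\partial y}+\varpi_3z\frac{\partial\varphi}{\partial z}=\varpi(\varphi)\varphi$. The weights are fixed once $\varphi$ is chosen; weight homogeneity of other polynomials refers to them; $|\varpi|=\varpi_1+\varpi_2+\varpi_3$. $\varphi$ has an isolated singularity if $\mathcal{A}_{sing}(\varphi)=\mathbf{F}[x,y,z]/\langle\frac{\partial\varphi}{\partial x},\frac{\partial\varphi}{\partial y},\frac{\partial\varphi}{\partial z}\rangle$ is finite-dimensional, of dimension $\mu$. Fix weight homogeneous $u_0=1,u_1,\dots,u_{\mu-1}\in\mathcal{A}$ whose images form an $\mathbf{F}$-basis of $\mathcal{A}_{sing}(\varphi)$ (so $\mu\ge1$). For $u\in\mathcal{A}$, $\{\cdot,\cdot\}_u$ is obtained by replacing $\varphi$ by $u$ in the formula for $\{\cdot,\cdot\}_\varphi$. $\mathcal{E}_\varphi=\{1,\dots,\mu-1\}$ if $\varpi(\varphi)\ne|\varpi|$ and $\mathcal{E}_\varphi=\{0,\dots,\mu-1\}$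 if $\varpi(\varphi)=|\varpi|$. $\mathbf{N}=\{0,1,2,\dots\}$, $\mathbf{N}^*=\mathbf{N}\setminus\{0\}$. **The dg Lie algebra.** $\mathfrak{X}^k(\mathcal{A})$ is the space of skew-symmetric $k$-derivations of $\mathcal{A}$ ($\mathfrak{X}^0(\mathcal{A})=\mathcal{A}$). $\mathfrak{g}_\varphi$ is graded by $\mathfrak{g}_\varphi^n=\mathfrak{X}^{n+1}(\mathcal{A})$, $n\ge-1$. The Schouten bracket is, for $P\in\mathfrak{X}^p(\mathcal{A})$, $Q\in\mathfrak{X}^q(\mathcal{A})$, $$[P,Q]_S[F_1,\dots,F_{p+q-1}]=\sum_{\sigma\in S_{q,p-1}}\mathrm{sign}(\sigma)P\big[Q[F_{\sigma(1)},\dots,F_{\sigma(q)}],F_{\sigma(q+1)},\dots\big]-(-1)^{(p-1)(q-1)}\sum_{\sigma\in S_{p,q-1}}\mathrm{sign}(\sigma)Q\big[P[F_{\sigma(1)},\dots,F_{\sigma(p)}],F_{\sigma(p+1)},\dots\big],$$ with $S_{i,j}$ the set of permutations $\sigma$ of $\{1,\dots,i+j\}$ with $\sigma(1)<\dots<\sigma(i)$ and $\sigma(i+1)<\dots<\sigma(i+j)$, and empty sums when an index is negative. **Maurer–Cartan and gauge equivalence.** $\nu$ is a formal parameter; brackets are extended multilinearly in $\nu$. $\mathcal{MC}^\nu(\mathfrak{g}_\varphi)=\{\gamma\in\nu\mathfrak{g}^1_\varphi[[\nu]]\mid\partial_\varphi(\gamma)+\frac12[\gamma,\gamma]_S=0\}$;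 equivalently $\{\cdot,\cdot\}_\varphi+\gamma$ is a formal deformation of the Poisson structure $\{\cdot,\cdot\}_\varphi$. The gauge equivalence $\sim$ on this set is generated by the infinitesimal transformations $\gamma\mapsto\gamma+[\xi,\{\cdot,\cdot\}_\varphi+\gamma]_S$, $\xi\in\nu\mathfrak{g}^0_\varphi[[\nu]]$; i.e. $\gamma\sim\gamma'$ if and only if there is $\xi\in\nu\mathfrak{X}^1(\mathcal{A})[[\nu]]$ with $\{\cdot,\cdot\}_\varphi+\gamma'=e^{\mathrm{ad}_\xi}(\{\cdot,\cdot\}_\varphi+\gamma)$, where $\mathrm{ad}_\xi=[\xi,\cdot]_S$ (equivalently, the formal deformations $\{\cdot,\cdot\}_\varphi+\gamma$ and $\{\cdot,\cdot\}_\varphi+\gamma'$ are equivalent). $\mathcal{D}ef^\nu(\mathfrak{g}_\varphi)=\mathcal{MC}^\nu(\mathfrak{g}_\varphi)/\sim$. *)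

(* Defs.v *)
From HB Require Import structures.
From mathcomp Require Import all_boot all_algebra fingroup perm finmap mpoly.
Set Implicit Arguments. Unset Strict Implicit. Unset Printing Implicit Defensive.
Import GRing.Theory.
Local Open Scope ring_scope.

Notation poly3 K := {mpoly K[3]}.

Definition ix : 'I_3 := @Ordinal 3 0 isT.
Definition iy : 'I_3 := @Ordinal 3 1 isT.
Definition iz : 'I_3 := @Ordinal 3 2 isT.

Definition weight_system (w : 'I_3 -> nat) : Prop :=
  (forall i, 0 < w i)%N /\ gcdn (gcdn (w ix) (w iy)) (w iz) = 1%N.

Definition total_weight (w : 'I_3 -> nat) : nat := (w ix + w iy + w iz)%N.

Definition whomog (K : fieldType) (w : 'I_3 -> nat) (d : nat) (p : poly3 K) : Prop :=
  \sum_(i < 3) (w i)%:R *: ('X_i * p^`M(i)) = d%:R *: p.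

Definition in_jacobian (K : fieldType) (phi p : poly3 K) : Prop :=
  exists a : 'I_3 -> poly3 K, p = \sum_(i < 3) a i * phi^`M(i).

Definition spans_Asing (K : fieldType) (phi : poly3 K) (m : nat) (u : 'I_m -> poly3 K) : Prop :=
  forall p : poly3 K, exists a : 'I_m -> K, in_jacobian phi (p - \sum_(i < m) a i *: u i).

Definition free_Asing (K : fieldType) (phi : poly3 K) (m : nat) (u : 'I_m -> poly3 K) : Prop :=
  forall a : 'I_m -> K, in_jacobian phi (\sum_(i < m) a i *: u i) -> forall i, a i = 0.

Definition isolated_singularity (K : fieldType) (phi : poly3 K) : Prop :=
  exists (m : nat) (v : 'I_m -> poly3 K), spans_Asing phi v.

(* [u] represents a basis of A_sing(phi), so that [mu] is its dimension. *)
Definition basis_Asing (K : fieldType) (phi : poly3 K) (mu : nat) (u : 'I_mu -> poly3 K) : Prop :=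
  spans_Asing phi u /\ free_Asing phi u.

Definition multimap (K : fieldType) (k : nat) := {ffun 'I_k -> poly3 K} -> poly3 K.

Definition is_derivation (K : fieldType) (D : poly3 K -> poly3 K) : Prop :=
  (forall (a : K) (p q : poly3 K), D (a *: p + q) = a *: D p + D q) /\
  (forall p q : poly3 K, D (p * q) = D p * q + p * D q).

(* The space X^k(A) of skew-symmetric k-derivations, as a predicate. *)
Definition multider (K : fieldType) (k : nat) (P : multimap K k) : Prop :=
  (forall (f : {ffun 'I_k -> poly3 K}) (i : 'I_k),
     is_derivation (fun p => P [ffun j => if j == i then p else f j])) /\
  (forall (f : {ffun 'I_k -> poly3 K}) (s : 'S_k),
     P [ffun j => f (s j)] = (-1) ^+ s * P f).

(* The (i, n - i)-shuffles. *)
Definition shuffle (n i : nat) (s : 'S_n) : bool :=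
  [forall a : 'I_n, forall b : 'I_n,
     ((a < b < i) || (i <= a < b))%N ==> (s a < s b)%N].

Definition perm_arg (K : fieldType) (n : nat) (f : {ffun 'I_n -> poly3 K}) (s : 'S_n)
    (k : nat) : poly3 K :=
  if insub k is Some i then f (s i) else 0.

(* The sum over S_{q,p-1} of sign(s) P[Q[f_s(1),...,f_s(q)], f_s(q+1),...],
   used with n = p + q - 1 and p > 0.  Indices are shifted to start from 0, so
   that slot i > 0 of P receives the argument of index q + i - 1. *)
Definition insertion (K : fieldType) (n p q : nat) (P : multimap K p) (Q : multimap K q)
    (f : {ffun 'I_n -> poly3 K}) : poly3 K :=
  \sum_(s : 'S_n | shuffle q s)
    (-1) ^+ s * P [ffun i : 'I_p =>
                     if i == 0 :> nat then Q [ffun j : 'I_q => perm_arg f s j]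
                     else perm_arg f s (q + i).-1].

(* Both tests handle the empty sums attached to a negative index; the exponent
   p.+1 * q.+1 has the parity of (p - 1)(q - 1), also when p or q is 0. *)
Definition schouten (K : fieldType) (p q : nat) (P : multimap K p) (Q : multimap K q) :
    multimap K (p + q).-1 :=
  fun f => (if (0 < p)%N then insertion P Q f else 0)
           - (-1) ^+ (p.+1 * q.+1) * (if (0 < q)%N then insertion Q P f else 0).

Definition wedge (K : fieldType) (D E : poly3 K -> poly3 K) : multimap K 2 :=
  fun f => D (f ord0) * E (f ord_max) - D (f ord_max) * E (f ord0).

Definition poisson (K : fieldType) (u : poly3 K) : multimap K 2 :=
  fun f => u^`M(ix) * wedge (mderiv iy) (mderiv iz) f
         + u^`M(iy) * wedge (mderiv iz) (mderiv ix) f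
         + u^`M(iz) * wedge (mderiv ix) (mderiv iy) f.

Definition dphi (K : fieldType) (phi : poly3 K) (q : nat) (Q : multimap K q) :
    multimap K (2 + q).-1 :=
  schouten (poisson phi) Q.

(* A formal power series in nu is the sequence of its coefficients. *)
Definition series (K : fieldType) (k : nat) := nat -> multimap K k.

Definition nu_series (K : fieldType) (k : nat) (g : series K k) : Prop :=
  g 0%N = (fun=> 0) /\ forall n, multider (g n).

Definition sbracket (K : fieldType) (p q : nat) (P : series K p) (Q : series K q) :
    series K (p + q).-1 :=
  fun n f => \sum_(i < n.+1) schouten (P i) (Q (n - i)%N) f.

Definition MC (K : fieldType) (phi : poly3 K) (g : series K 2) : Prop :=
  nu_series g /\
  forall n f, dphi phi (g n) f + 2%:R^-1 *: sbracket g g n f = 0.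

Definition deformation (K : fieldType) (phi : poly3 K) (g : series K 2) : series K 2 :=
  fun n f => (if n == 0%N then poisson phi f else 0) + g n f.

(* The exponential of ad_xi = [xi, .], for xi without constant term in nu: the
   k-th iterate of ad_xi is then divisible by nu^k, so that only k <= n
   contributes to the coefficient of nu^n. *)
Definition exp_ad (K : fieldType) (xi : series K 1) (X : series K 2) : series K 2 :=
  fun n f => \sum_(k < n.+1) (k`!)%:R^-1 *:
    iter k (fun Y : series K 2 => sbracket xi Y : series K 2) X n f.

Definition gauge (K : fieldType) (phi : poly3 K) (g g' : series K 2) : Prop :=
  exists xi : series K 1,
    nu_series xi /\ deformation phi g' = exp_ad xi (deformation phi g).

Definition gauge_class (K : fieldType) (phi : poly3 K) (g : series K 2) : series K 2 -> Prop :=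
  fun g' => MC phi g' /\ gauge phi g g'.

(* The quotient MC / ~, as the set of gauge classes. *)
Definition Def_nu (K : fieldType) (phi : poly3 K) (C : series K 2 -> Prop) : Prop :=
  exists2 g, MC phi g & C = gauge_class phi g.

(* E_phi as a subset of {0, ..., mu-1}, where [d] is the weighted degree of phi. *)
Definition Ephi (w : 'I_3 -> nat) (d mu : nat) (i : 'I_mu) : bool :=
  (0 < i)%N || (d == total_weight w).

(* In [c k : {fsfun nat * 'I_mu -> K with 0}] and [cb k : 'I_mu -> K], only the
   values for k > 0, at (l, i) with i in E_phi and at r > 0 respectively, are
   used. *)
Definition gamma (K : fieldType) (w : 'I_3 -> nat) (d : nat) (phi : poly3 K)
    (mu : nat) (u : 'I_mu -> poly3 K)
    (c : nat -> {fsfun nat * 'I_mu -> K with 0}) (cb : nat -> 'I_mu -> K) : series K 2 :=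
  fun n f => if n == 0%N then 0 else
    \sum_(1 <= a < n) \sum_(li <- finsupp (c a) | Ephi w d li.2) \sum_(r < mu | (0 < r)%N)
      (c a li * cb (n - a)%N r) *: (phi ^+ li.1 * u li.2 * poisson (u r) f)
    + \sum_(mj <- finsupp (c n) | Ephi w d mj.2)
      c n mj *: (phi ^+ mj.1 * u mj.2 * poisson phi f)
    + \sum_(s < mu | (0 < s)%N) cb n s *: poisson (u s) f.

Definition normal_form (K : fieldType) (w : 'I_3 -> nat) (d : nat) (phi : poly3 K)
    (mu : nat) (u : 'I_mu -> poly3 K) (g : series K 2) : Prop :=
  exists (c : nat -> {fsfun nat * 'I_mu -> K with 0}) (cb : nat -> 'I_mu -> K),
    g = gamma w d phi u c cb.

(* Main.v *)
(** The volume form identifies a bivector with a vector field B on affine space,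
    which is Poisson iff B . curl B = 0; {.,.}_phi becomes grad phi, and the
    normal form gamma^(c, cb) becomes (1 + f) grad (phi + chi) - grad phi, with
    f = sum c phi^l u_i and chi = sum cb u_s.

    Cohomology: some power of each variable lies in the Jacobian ideal, so the
    Koszul complex of grad phi is exact.  With the Poincare lemma (inverting
    c + Euler field) this gives, by induction on the weighted degree, that
    grad phi . curl B = 0 implies B = grad h + f grad phi, and that every
    polynomial is a combination of the phi^l u_i modulo the grad phi . curl m.
    Hence the infinitesimal normal forms represent all 2-cocycles.  When the
    weighted degree differs from |w| they are independent modulo coboundaries,
    and every 1-cocycle is hamiltonian.

    Existence: the coefficient of nu^n in exp(ad x) B depends on x_n only through
    [x_n, grad phi], so x, f and chi are chosen order by order within a single
    exponential, with no Baker-Campbell-Hausdorff formula.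

    Equivalence: exp(x) is an automorphism of A[[nu]], it intertwines B and
    exp(ad x) B, and every automorphism congruent to 1 mod nu is such an
    exponential (two automorphisms that agree below order n differ there by a
    derivation of A).  So gauge equivalence is conjugation by automorphisms.

    Uniqueness: if an automorphism congruent to 1 mod nu^n intertwines two normal
    forms, their difference at order n is a coboundary, hence 0, and the
    automorphism starts with a hamiltonian field of grad phi; composing with the
    exponential of a hamiltonian field of the normal form makes it congruent to 1
    mod nu^(n+1). *)
Require Import Defs.
From HB Require Import structures.
From mathcomp Require Import all_boot all_algebra fingroup perm finmap mpoly.
From mathcomp Require Import ring zify.
From mathcomp Require boolp.
Set Implicit Arguments. Unset Strict Implicit. Unset Printing Implicit Defensive.
Import GRing.Theory.
Local Open Scope ring_scope.

(** * Vector calculus over a ring with three commuting derivations *)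

Record diff3 (R : comNzRingType) := Diff3 {
  dd : 'I_3 -> R -> R;
  ddD : forall i f g, dd i (f + g) = dd i f + dd i g;
  ddM : forall i f g, dd i (f * g) = dd i f * g + f * dd i g;
  ddC : forall i j f, dd i (dd j f) = dd j (dd i f) }.

Arguments dd : simpl never.

Definition vec (R : Type) := (R * R * R)%type.
HB.instance Definition _ (R : zmodType) := GRing.Zmodule.copy (vec R) (R * R * R)%type.

Section VectorCalculus.
Variables (R : comNzRingType) (D : diff3 R).
Implicit Types (a b f g h : R) (u v x y B : vec R).

Definition vx v := v.1.1.
Definition vy v := v.1.2.
Definition vz v := v.2.
Definition smul a v : vec R := (a * vx v, a * vy v, a * vz v).
Definition dot u v := vx u * vx v + vy u * vy v + vz u * vz v.
Definition cross u v : vec R :=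
  (vy u * vz v - vz u * vy v, vz u * vx v - vx u * vz v, vx u * vy v - vy u * vx v).
Definition grad f : vec R := (dd D ix f, dd D iy f, dd D iz f).
Definition curl v : vec R :=
  (dd D iy (vz v) - dd D iz (vy v), dd D iz (vx v) - dd D ix (vz v),
   dd D ix (vy v) - dd D iy (vx v)).
Definition div v := dd D ix (vx v) + dd D iy (vy v) + dd D iz (vz v).

Definition vfield v f := dot v (grad f).
Definition bivec B f g := dot B (cross (grad f) (grad g)).
(* [x, B]_S in coordinates.  The volume form turns B into a 1-form, on which the
   bracket is the Lie derivative along x minus multiplication by div x. *)
Definition lieb x B := grad (dot x B) - cross x (curl B) - smul (div x) B.
Definition jacb B := dot B (curl B).

Lemma dd0 i : dd D i 0 = 0.
Proof. by apply: (addrI (dd D i 0)); rewrite -ddD !addr0. Qed.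

Lemma ddN i f : dd D i (- f) = - dd D i f.
Proof. by apply: (addrI (dd D i f)); rewrite -ddD !subrr dd0. Qed.

Lemma dd1 i : dd D i 1 = 0.
Proof. by apply: (addrI (dd D i 1)); rewrite addr0 -{3}[1]mulr1 ddM mulr1 mul1r. Qed.

Lemma dd_natr i n : dd D i n%:R = 0.
Proof. by elim: n => [|n IH]; rewrite ?dd0 // -addn1 natrD ddD IH dd1 addr0. Qed.

Lemma dd_sum i (I : Type) (r : seq I) (P : pred I) (F : I -> R) :
  dd D i (\sum_(j <- r | P j) F j) = \sum_(j <- r | P j) dd D i (F j).
Proof. by apply: (big_morph _ (ddD D i) (dd0 i)). Qed.

Lemma ddyx f : dd D iy (dd D ix f) = dd D ix (dd D iy f). Proof. exact: ddC. Qed.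
Lemma ddzx f : dd D iz (dd D ix f) = dd D ix (dd D iz f). Proof. exact: ddC. Qed.
Lemma ddzy f : dd D iz (dd D iy f) = dd D iy (dd D iz f). Proof. exact: ddC. Qed.

Lemma vecE (u v : vec R) : vx u = vx v -> vy u = vy v -> vz u = vz v -> u = v.
Proof. by case: u => [[a b] c]; case: v => [[? ?] ?]; rewrite /vx /vy /vz /= => -> -> ->. Qed.

Lemma vxD u v : vx (u + v) = vx u + vx v. Proof. by []. Qed.
Lemma vyD u v : vy (u + v) = vy u + vy v. Proof. by []. Qed.
Lemma vzD u v : vz (u + v) = vz u + vz v. Proof. by []. Qed.
Lemma vxN u : vx (- u) = - vx u. Proof. by []. Qed.
Lemma vyN u : vy (- u) = - vy u. Proof. by []. Qed.
Lemma vzN u : vz (- u) = - vz u. Proof. by []. Qed.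
Lemma vx0 : vx 0 = 0 :> R. Proof. by []. Qed.
Lemma vy0 : vy 0 = 0 :> R. Proof. by []. Qed.
Lemma vz0 : vz 0 = 0 :> R. Proof. by []. Qed.

Lemma smulE a v : (vx (smul a v) = a * vx v) * (vy (smul a v) = a * vy v) *
  (vz (smul a v) = a * vz v).
Proof. by []. Qed.
Lemma crossE u v : (vx (cross u v) = vy u * vz v - vz u * vy v) *
  (vy (cross u v) = vz u * vx v - vx u * vz v) * (vz (cross u v) = vx u * vy v - vy u * vx v).
Proof. by []. Qed.
Lemma gradE f : (vx (grad f) = dd D ix f) * (vy (grad f) = dd D iy f) *
  (vz (grad f) = dd D iz f).
Proof. by []. Qed.
Lemma curlE v : (vx (curl v) = dd D iy (vz v) - dd D iz (vy v)) *
  (vy (curl v) = dd D iz (vx v) - dd D ix (vz v)) *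
  (vz (curl v) = dd D ix (vy v) - dd D iy (vx v)).
Proof. by []. Qed.
Lemma vpE a b c : (vx (a, b, c) = a) * (vy (a, b, c) = b) * (vz (a, b, c) = c).
Proof. by []. Qed.

Lemma vec_sumE n (F : 'I_n -> vec R) : (vx (\sum_i F i) = \sum_i vx (F i)) *
  (vy (\sum_i F i) = \sum_i vy (F i)) * (vz (\sum_i F i) = \sum_i vz (F i)).
Proof. by split; first split; apply: (big_morph _ _ (erefl _)). Qed.

Definition vcE := (smulE, crossE, vxD, vyD, vzD, vxN, vyN, vzN, vx0, vy0, vz0).
Definition gcE := (gradE, curlE, vcE).
Definition ddE := (ddM, ddD, ddN, dd0, ddyx, ddzx, ddzy).

Lemma curl_grad f : curl (grad f) = 0.
Proof. by apply: vecE; rewrite !gcE !ddE; ring. Qed.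

Lemma div_curl v : div (curl v) = 0.
Proof. by rewrite /div !gcE !ddE; ring. Qed.

Lemma gradD f g : grad (f + g) = grad f + grad g.
Proof. by apply: vecE; rewrite !gcE !ddE. Qed.

Lemma gradN f : grad (- f) = - grad f.
Proof. by apply: vecE; rewrite !gcE !ddE. Qed.

Lemma gradM f g : grad (f * g) = smul f (grad g) + smul g (grad f).
Proof. by apply: vecE; rewrite !gcE !ddE; ring. Qed.

Lemma lieb_grad x f : lieb x (grad f) = grad (dot x (grad f)) - smul (div x) (grad f).
Proof.
rewrite /lieb curl_grad; congr (_ - _); rewrite -[RHS]subr0; congr (_ - _).
by apply: vecE; rewrite !gcE; ring.
Qed.

(** This Leibniz rule for the Lie derivative of a bracket confirms the formula for [lieb], and makes
    the flow of [x] transport brackets. *)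
Lemma bivec_lieb x B f g :
  bivec (lieb x B) f g =
  vfield x (bivec B f g) - bivec B (vfield x f) g - bivec B f (vfield x g).
Proof.
rewrite /bivec /lieb /vfield /dot /div !gcE.
by rewrite !ddE; ring.
Qed.

(** A trivector in three variables is a function times the determinant of the gradients, so the
    cyclic sums collapse to one scalar. Two bivectors are needed for the mixed bracket in the
    Maurer-Cartan equation; [B = C] gives twice [jacb B]. *)
Lemma jacobiator B C f g h :
  bivec B (bivec C f g) h + bivec B (bivec C g h) f + bivec B (bivec C h f) g +
  (bivec C (bivec B f g) h + bivec C (bivec B g h) f + bivec C (bivec B h f) g) =
  (dot B (curl C) + dot C (curl B)) * dot (grad f) (cross (grad g) (grad h)).
Proof.
rewrite /bivec /dot !gcE.
by rewrite !ddE; ring.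
Qed.

(** The curl of f grad g is the cross product of grad f and grad g, hence orthogonal to grad g. This
    is why every normal form is Poisson. *)
Lemma jacb_smul_grad f g : jacb (smul f (grad g)) = 0.
Proof. by rewrite /jacb /dot !gcE !ddE; ring. Qed.

(** For a Poisson [B] the right-hand side is 0: hamiltonian fields preserve [B], which leaves room
    to correct automorphisms in the uniqueness proof. *)
Lemma lieb_hamiltonian B f : lieb (cross B (grad f)) B = smul (- jacb B) (grad f).
Proof.
apply: vecE; rewrite /lieb /jacb /dot /div !gcE.
- by rewrite !ddE; ring.
- by rewrite !ddE; ring.
- by rewrite !ddE; ring.
Qed.

Lemma div_cross_grad f v : div (cross (grad f) v) = - dot (grad f) (curl v).
Proof. by rewrite /div /dot !gcE !ddE; ring. Qed.

Lemma liebDl x y B : lieb (x + y) B = lieb x B + lieb y B.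
Proof. by apply: vecE; rewrite /lieb /dot /div !gcE !ddE; ring. Qed.

Lemma liebDr x B B' : lieb x (B + B') = lieb x B + lieb x B'.
Proof. by apply: vecE; rewrite /lieb /dot /div !gcE !ddE; ring. Qed.

Lemma vfieldM x f g : vfield x (f * g) = vfield x f * g + f * vfield x g.
Proof. by rewrite /vfield /dot !gcE !ddE; ring. Qed.

Lemma vfieldD x f g : vfield x (f + g) = vfield x f + vfield x g.
Proof. by rewrite /vfield /dot !gcE !ddE; ring. Qed.

Lemma vfieldN x f : vfield x (- f) = - vfield x f.
Proof. by rewrite /vfield /dot !gcE !ddE; ring. Qed.

Lemma vfieldDl x y f : vfield (x + y) f = vfield x f + vfield y f.
Proof. by rewrite /vfield /dot !gcE; ring. Qed.

Lemma vfieldNl x f : vfield (- x) f = - vfield x f.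
Proof. by rewrite /vfield /dot !gcE; ring. Qed.

Lemma vfield_const x a : (forall i, dd D i a = 0) -> vfield x a = 0.
Proof. by move=> h; rewrite /vfield /dot !gcE !h; ring. Qed.

Lemma lieb_smul x a B : (forall i, dd D i a = 0) -> lieb x (smul a B) = smul a (lieb x B).
Proof. by move=> h; apply: vecE; rewrite /lieb /dot /div !gcE !ddE !h; ring. Qed.

Lemma liebNl x B : lieb (- x) B = - lieb x B.
Proof. by apply: vecE; rewrite /lieb /dot /div !gcE !ddE; ring. Qed.

Lemma liebNr x B : lieb x (- B) = - lieb x B.
Proof. by apply: vecE; rewrite /lieb /dot /div !gcE !ddE; ring. Qed.

Lemma lieb0l B : lieb 0 B = 0.
Proof. by apply: (addrI (lieb 0 B)); rewrite -liebDl !addr0. Qed.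

Lemma lieb0r x : lieb x 0 = 0.
Proof. by apply: (addrI (lieb x 0)); rewrite -liebDr !addr0. Qed.

Lemma bivecC B f g : bivec B g f = - bivec B f g.
Proof. by rewrite /bivec /dot !gcE; ring. Qed.

Lemma bivecEl B f g : bivec B f g = vfield (cross (grad g) B) f.
Proof. by rewrite /bivec /vfield /dot !gcE; ring. Qed.

Lemma bivecNl B f g : bivec B (- f) g = - bivec B f g.
Proof. by rewrite !bivecEl vfieldN. Qed.

(** The derivation [t] stays abstract so that it can be the time derivative [tder]. *)
Lemma deriv_bivec (t : R -> R) (tD : forall f g, t (f + g) = t f + t g)
    (tN : forall f, t (- f) = - t f) (tM : forall f g, t (f * g) = t f * g + f * t g)
    (td : forall i f, t (dd D i f) = dd D i (t f)) B f g :
  t (bivec B f g) =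
  bivec (t (vx B), t (vy B), t (vz B)) f g + bivec B (t f) g + bivec B f (t g).
Proof. by rewrite /bivec /dot !gcE !vpE !(tN, tD, tM, td); ring. Qed.

End VectorCalculus.

(** * Exactness of the Koszul complex *)

Section MonomialIdeals.
Variables (n : nat) (K : fieldType).
Implicit Types (p q f g h : {mpoly K[n]}) (m : 'X_{1..n}) (s : 'X_{1..n} -> K).

(** One diagonal operator serves for truncation in one exponent, truncation by weight, and the
    inverse of c + Euler. *)
Definition coefscale s p : {mpoly K[n]} := \sum_(m <- msupp p) (s m * p@_m) *: 'X_[m].

Lemma mcoeff_scale s p m : (coefscale s p)@_m = s m * p@_m.
Proof.
rewrite /coefscale raddf_sum /=; case: (boolP (m \in msupp p)) => hm.
  rewrite (bigD1_seq m) ?msupp_uniq //= mcoeffZ mcoeffX eqxx mulr1 big1 ?addr0 //.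
  by move=> m' hm'; rewrite mcoeffZ mcoeffX (negbTE hm') mulr0.
rewrite (memN_msupp_eq0 hm) mulr0 big_seq big1 // => m' hm'; rewrite mcoeffZ mcoeffX.
by case: eqP => [e|_]; [rewrite -e hm' in hm | rewrite mulr0].
Qed.

Lemma coefscaleD s p q : coefscale s (p + q) = coefscale s p + coefscale s q.
Proof. by apply/mpolyP => m; rewrite mcoeffD !mcoeff_scale mcoeffD mulrDr. Qed.

Lemma coefscaleN s p : coefscale s (- p) = - coefscale s p.
Proof. by apply/mpolyP => m; rewrite mcoeffN !mcoeff_scale mcoeffN mulrN. Qed.

Lemma mcoeffM_neq0 f g m : (f * g)@_m != 0 ->
  exists m1 m2, [/\ m = (m1 + m2)%MM, f@_m1 != 0 & g@_m2 != 0].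
Proof.
rewrite -mcoeff_msupp => /msuppM_le /allpairsP [[m1 m2]] /= [h1 h2 ->].
by exists m1, m2; rewrite -!mcoeff_msupp.
Qed.

Lemma Xn_neq0 i N : 'X_i ^+ N != 0 :> {mpoly K[n]}.
Proof.
rewrite mpolyXn; apply/eqP => /(congr1 (mcoeff (U_(i) *+ N)%MM)).
by rewrite mcoeffX eqxx mcoeff0 => /eqP; rewrite oner_eq0.
Qed.

Lemma dvd_Xn i N f : (forall m, f@_m != 0 -> (N <= m i)%N) -> exists g, f = 'X_i ^+ N * g.
Proof.
move=> hf; exists (\sum_(m <- msupp f) f@_m *: 'X_[(m - U_(i) *+ N)%MM]).
rewrite mulr_sumr {1}[f]mpolyE big_seq [RHS]big_seq; apply: eq_bigr => m.
rewrite mcoeff_msupp => /hf hm; rewrite -scalerAr mpolyXn -mpolyXD addmC submK //.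
apply/mnm_lepP => j; rewrite mulmnE mnm1E; case: eqP => [<-|_]; last by rewrite mul0n.
by rewrite mul1n.
Qed.

Lemma mcoeff_Xn_lt i N g m : (m i < N)%N -> ('X_i ^+ N * g)@_m = 0.
Proof.
move=> hm; apply/eqP/negPn/negP => /mcoeffM_neq0 [m1 [m2 [e]]].
rewrite mpolyXn mcoeffX; case: (_ =P m1) => [e1 _ _|_]; last by rewrite eqxx.
move: hm; rewrite e -e1 mnmDE mulmnE mnm1E eqxx mul1n.
by rewrite ltnNge leq_addr.
Qed.

Lemma mcoeff_Xn_add i N g m : ('X_i ^+ N * g)@_(U_(i) *+ N + m) = g@_m.
Proof. by rewrite mpolyXn mulrC mcoeffMX. Qed.

Definition lowpart i N p := coefscale (fun m => (m i < N)%N%:R) p.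

Lemma lowpartP i N p : exists q, p = 'X_i ^+ N * q + lowpart i N p.
Proof.
have [|q e] := @dvd_Xn i N (p - lowpart i N p); last by exists q; rewrite -e subrK.
move=> m; rewrite mcoeffB mcoeff_scale; case: ltnP => // _.
by rewrite mul1r subrr eqxx.
Qed.

Lemma Xn_regular_mod1 i j N f h : i != j ->
  'X_j ^+ N * f = 'X_i ^+ N * h -> exists f', f = 'X_i ^+ N * f'.
Proof.
move=> hij e; apply: dvd_Xn => m; apply: contraR; rewrite -ltnNge => hm.
rewrite -(mcoeff_Xn_add j N) e mcoeff_Xn_lt //.
by rewrite mnmDE mulmnE mnm1E eq_sym (negbTE hij) mul0n.
Qed.

(** Reduce [f] to a remainder whose exponents in the variables i and j are both below [N].
    Multiplication by a power of the variable k does not change these exponents, and the right-hand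
    side has no such monomial, so the remainder is 0. *)
Lemma Xn_regular_mod2 i j k N f h l : i != k -> j != k ->
  'X_k ^+ N * f = 'X_i ^+ N * h + 'X_j ^+ N * l ->
  exists h' l', f = 'X_i ^+ N * h' + 'X_j ^+ N * l'.
Proof.
move=> hik hjk e; have [h' eh] := lowpartP i N f.
have [l' el] := lowpartP j N (lowpart i N f); exists h', l'.
set r := lowpart j N _ in el; suff r0 : r = 0 by rewrite {1}eh {1}el r0 addr0.
apply/mpolyP => m; rewrite mcoeff0 /r /lowpart !mcoeff_scale.
case: ltnP => [hj|_]; last by rewrite mul0r.
case: ltnP => [hi|_]; last by rewrite mul0r mulr0.
rewrite !mul1r -(mcoeff_Xn_add k N) e mcoeffD !mcoeff_Xn_lt ?addr0 //;
  by rewrite mnmDE mulmnE mnm1E eq_sym ?(negbTE hjk) ?(negbTE hik) mul0n.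
Qed.

End MonomialIdeals.

(** * Koszul exactness for a vector whose ideal contains powers of the variables *)

Section Koszul.
Variables (K : fieldType) (N : nat).
Local Notation A := (poly3 K).
Local Notation X := ('X_ix ^+ N : A).
Local Notation Y := ('X_iy ^+ N : A).
Variables (g p q r : vec A).
Hypothesis hp : dot p g = X.
Hypothesis hq : dot q g = Y.
Hypothesis hr : dot r g = 'X_iz ^+ N.
Implicit Types (f h : A) (v : vec A).

(** Dotting with [r] turns [g] into a power of z, which is regular modulo [X] and [Y]. Exactness
    then descends: injectivity of multiplication by [g] modulo [X] and [Y], exactness at the cross
    product modulo [X], exactness at the dot product over A. *)
Let H3_mod2 f v1 v2 : smul f g = smul X v1 + smul Y v2 ->
  exists h1 h2, f = X * h1 + Y * h2.
Proof.
move=> e; apply: (@Xn_regular_mod2 _ _ ix iy iz N f (dot r v1) (dot r v2)) => //.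
have -> : 'X_iz ^+ N * f = dot r (smul f g).
  by rewrite -hr /dot !vcE; ring.
by rewrite e /dot !vcE; ring.
Qed.

Let H3_mod1 f v1 : smul f g = smul X v1 -> exists h, f = X * h.
Proof.
move=> e; apply: (@Xn_regular_mod1 _ _ ix iy N f (dot q v1)) => //.
have -> : 'X_iy ^+ N * f = dot q (smul f g).
  by rewrite -hq /dot !vcE; ring.
by rewrite e /dot !vcE; ring.
Qed.

Let X_neq0 : X != 0. Proof. exact: Xn_neq0. Qed.

Let smul_inj f u v : f != 0 -> smul f u = smul f v -> u = v.
Proof.
move=> hf e; apply: vecE; apply: (mulfI hf).
- exact: (congr1 (@vx _) e).
- exact: (congr1 (@vy _) e).
- exact: (congr1 (@vz _) e).
Qed.

(** The contracting homotopy: for [u] equal to [p] or [q], [dot u g] is a power of a variable. *)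
Let triple u v : smul (dot u g) v - smul (dot u v) g = cross u (cross v g).
Proof. by apply: vecE; rewrite /dot !vcE; ring. Qed.

(** By [triple], [smul (dot q v) g] lies in the ideal of [X] and [Y], hence so does [dot q v] by
    [H3_mod2]. Removing its [Y] part times [g] from [v] leaves a vector whose product with [Y] is
    divisible by [X], and [Y] is regular modulo [X]. *)
Let H2_mod1 v v1 : cross v g = smul X v1 -> exists h v2, v = smul h g + smul X v2.
Proof.
move=> e; have := triple q v; rewrite hq e => e2.
have e2' : smul (dot q v) g = smul Y v - smul X (cross q v1).
  rewrite -[LHS](subKr (smul Y v)) e2; congr (_ - _).
  by apply: vecE; rewrite !vcE; ring.
have [h1 [h2 eh]] : exists h1 h2, dot q v = X * h1 + Y * h2.
  apply: (@H3_mod2 _ (- cross q v1) v); rewrite e2' addrC; congr (_ + _).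
  by apply: vecE; rewrite !vcE; ring.
have e3 : smul Y (v - smul h2 g) = smul X (cross q v1 + smul h1 g).
  move: e2'; rewrite eh => e2'; apply/eqP; rewrite -subr_eq0; apply/eqP.
  transitivity (smul Y v - smul X (cross q v1) - smul (X * h1 + Y * h2) g).
    by apply: vecE; rewrite !vcE; ring.
  by rewrite e2' subrr.
set u := v - _ in e3; set t := cross q v1 + _ in e3.
have [a ea] : exists a, vx u = X * a.
  by apply: (@Xn_regular_mod1 _ _ ix iy N _ (vx t)) => //; move: (congr1 (@vx _) e3); rewrite !smulE.
have [b eb] : exists a, vy u = X * a.
  by apply: (@Xn_regular_mod1 _ _ ix iy N _ (vy t)) => //; move: (congr1 (@vy _) e3); rewrite !smulE.
have [c ec] : exists a, vz u = X * a.
  by apply: (@Xn_regular_mod1 _ _ ix iy N _ (vz t)) => //; move: (congr1 (@vz _) e3); rewrite !smulE.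
exists h2, (a, b, c); rewrite -{1}[v](subrK (smul h2 g)) addrC; congr (_ + _).
by apply: vecE; rewrite smulE.
Qed.

Lemma koszul_cross v : cross v g = 0 -> exists h, v = smul h g.
Proof.
move=> e; have e1 := triple p v; rewrite hp e in e1.
have e2 : smul (dot p v) g = smul X v.
  apply/eqP; rewrite eq_sym -subr_eq0 e1; apply/eqP.
  by apply: vecE; rewrite !vcE; ring.
have [h eh] := H3_mod1 e2; exists h; apply: (smul_inj X_neq0); rewrite -e2 eh.
by apply: vecE; rewrite !vcE; ring.
Qed.

(** The vector [X v] is the cross product of [g] with [cross v p]; the latter is known modulo [X] up
    to a multiple of [g] by [H2_mod1], and a factor [X] cancels. *)
Lemma koszul_dot v : dot v g = 0 -> exists m, v = cross g m.
Proof.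
move=> e; have e1 : smul X v = cross g (cross v p).
  apply/eqP; rewrite -subr_eq0 -hp; apply/eqP.
  transitivity (smul (dot v g) p); last by rewrite e; apply: vecE; rewrite !vcE; ring.
  by apply: vecE; rewrite /dot !vcE; ring.
have [|h [m em]] := @H2_mod1 (cross v p) (- v).
  rewrite (_ : smul X (- v) = - smul X v); last by apply: vecE; rewrite !vcE; ring.
  by rewrite e1; apply: vecE; rewrite !vcE; ring.
exists m; apply: (smul_inj X_neq0); rewrite e1 em.
by apply: vecE; rewrite !vcE; ring.
Qed.

End Koszul.

(** * Weights and the Poincare lemma *)

Definition pder (K : fieldType) :=
  @Diff3 _ (@mderiv 3 K) (@mderivD 3 K) (@mderivM 3 K) (fun i j f => mderiv_comm j i f).

Section Weights.
Variables (K : fieldType) (w : 'I_3 -> nat).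
Hypothesis charK : [pchar K] =i pred0.
Hypothesis w_gt0 : forall i, (0 < w i)%N.
Local Notation A := (poly3 K).
Local Notation D := (pder K).
Implicit Types (f g h p q : A) (v : vec A) (m : 'X_{1..3}) (c e k s : nat).

Lemma natr_neq0 n : (n.+1%:R : K) != 0.
Proof. by have /pcharf0P -> := charK. Qed.

Lemma natr_inj n n' : n%:R = n'%:R :> K -> n = n'.
Proof.
wlog le : n n' / (n <= n')%N.
  by move=> H e; case/orP: (leq_total n n') => h; [apply: H | apply/esym/H].
move=> /eqP; rewrite eq_sym -subr_eq0 -natrB //; have /pcharf0P -> := charK.
by rewrite subn_eq0 => h; apply/eqP; rewrite eqn_leq le.
Qed.

Definition wdeg m : nat := (\sum_(i < 3) w i * m i)%N.

Lemma sum3 (V : nmodType) (F : 'I_3 -> V) : \sum_(i < 3) F i = F ix + F iy + F iz.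
Proof.
rewrite !big_ord_recr big_ord0 /= add0r.
by congr (F _ + F _ + F _); apply: val_inj.
Qed.

Lemma ord3P (i : 'I_3) : [\/ i = ix, i = iy | i = iz].
Proof.
by case: i => [[|[|[|//]]]] lt; [constructor 1 | constructor 2 | constructor 3]; apply: val_inj.
Qed.

Lemma wdegD m1 m2 : wdeg (m1 + m2) = (wdeg m1 + wdeg m2)%N.
Proof. by rewrite /wdeg -big_split; apply: eq_bigr => i _; rewrite mnmDE mulnDr. Qed.

Lemma wdegU i : wdeg U_(i) = w i.
Proof.
rewrite /wdeg (bigD1 i) //= mnm1E eqxx muln1 big1 ?addn0 // => j hj.
by rewrite mnm1E eq_sym (negbTE hj) muln0.
Qed.

Definition eulerv : vec A := ((w ix)%:R * 'X_ix, (w iy)%:R * 'X_iy, (w iz)%:R * 'X_iz).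
Definition euler f : A := dot eulerv (grad D f).

Lemma mcoeff_Xderiv i f m : ('X_i * f^`M(i))@_m = (m i)%:R * f@_m.
Proof.
case: (posnP (m i)) => [h|h].
  by rewrite h mul0r -['X_i]expr1 mcoeff_Xn_lt ?h.
have e : (U_(i) *+ 1 + (m - U_(i)))%MM = m.
  by rewrite mulm1n addmC submK // lep1mP -lt0n.
rewrite -{1}e -['X_i]expr1 mcoeff_Xn_add mcoeff_deriv addmC.
rewrite mulm1n in e; rewrite e mnmBE mnm1E eqxx subn1 prednK //.
by rewrite mulr_natl.
Qed.

Lemma mcoeff_euler f m : (euler f)@_m = (wdeg m)%:R * f@_m.
Proof.
rewrite /euler /eulerv /dot !gradE /vx /vy /vz /= -!mulrA !mulr_natl !mcoeffD !mcoeffMn.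
rewrite !mcoeff_Xderiv -[RHS]mulr_natl /wdeg natr_sum sum3 !mulrDl !natrM -!mulrA.
by rewrite !mulr_natl.
Qed.

Definition wpure e f := forall m, f@_m != 0 -> wdeg m = e.
Definition wlt k f := forall m, f@_m != 0 -> (wdeg m < k)%N.

Lemma mcoeff_natM n f m : (n%:R * f)@_m = n%:R * f@_m.
Proof. by rewrite mulr_natl mcoeffMn mulr_natl. Qed.

Lemma whomogE e f : whomog w e f -> euler f = e%:R * f.
Proof.
rewrite /whomog sum3 !scaler_nat mulr_natl => <-.
by rewrite /euler /eulerv /dot !gradE /vx /vy /vz /= -!mulrA !mulr_natl.
Qed.

Lemma whomog_wpure e f : whomog w e f -> wpure e f.
Proof.
move=> /whomogE h m hm; have := congr1 (mcoeff m) h.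
rewrite mcoeff_euler mcoeff_natM => h1.
by apply: natr_inj; apply: (mulIf hm).
Qed.

Lemma wpure_deriv e f i : wpure e f -> wpure (e - w i) f^`M(i).
Proof.
move=> h m; rewrite mcoeff_deriv -mulr_natl mulf_eq0 negb_or => /andP [_ /h].
by rewrite wdegD wdegU => <-; rewrite addnK.
Qed.

Lemma wpure_deriv0 e f i : wpure e f -> (e < w i)%N -> f^`M(i) = 0.
Proof.
move=> h he; apply/mpolyP => m; rewrite mcoeff0; apply/eqP/negPn/negP.
rewrite mcoeff_deriv -mulr_natl mulf_eq0 negb_or => /andP [_ /h].
by rewrite wdegD wdegU => e1; move: he; rewrite -e1 ltnNge leq_addl.
Qed.

Lemma wlt_deriv k f i : wlt k f -> wlt (k - w i) f^`M(i).
Proof.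
move=> h m; rewrite mcoeff_deriv -mulr_natl mulf_eq0 negb_or => /andP [_ /h].
by rewrite wdegD wdegU ltn_subRL addnC.
Qed.

Lemma wlt0 f : wlt 0 f -> f = 0.
Proof.
by move=> h; apply/mpolyP => m; rewrite mcoeff0; apply/eqP/negPn/negP => /h.
Qed.

Lemma wlt_ex f : exists k, wlt k f.
Proof.
exists (\sum_(m <- msupp f) wdeg m)%N.+1 => m; rewrite -mcoeff_msupp => hm.
by rewrite ltnS (big_rem m) //= leq_addr.
Qed.

Lemma wlt_le k k' f : (k <= k')%N -> wlt k f -> wlt k' f.
Proof. by move=> le h m /h hm; apply: leq_trans hm le. Qed.

Lemma wltB k f g : wlt k f -> wlt k g -> wlt k (f - g).
Proof.
move=> hf hg m; rewrite mcoeffB; case: (boolP (f@_m == 0)) => [/eqP ->|/hf //].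
by rewrite sub0r oppr_eq0; apply: hg.
Qed.

Lemma wltD k f g : wlt k f -> wlt k g -> wlt k (f + g).
Proof.
move=> hf hg m; rewrite mcoeffD; case: (boolP (f@_m == 0)) => [/eqP ->|/hf //].
by rewrite add0r; apply: hg.
Qed.

Definition trunc k f := coefscale (fun m => (wdeg m < k)%N%:R) f.

Lemma truncB k f g : trunc k (f - g) = trunc k f - trunc k g.
Proof. by rewrite /trunc coefscaleD coefscaleN. Qed.

Lemma truncD k f g : trunc k (f + g) = trunc k f + trunc k g.
Proof. exact: coefscaleD. Qed.

Lemma trunc_wlt k f : wlt k (trunc k f).
Proof.
by move=> m; rewrite mcoeff_scale; case: ltnP => // _; rewrite mul0r eqxx.
Qed.

Lemma trunc_id k f : wlt k f -> trunc k f = f.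
Proof.
move=> h; apply/mpolyP => m; rewrite mcoeff_scale.
case: (boolP (f@_m == 0)) => [/eqP ->|/h ->]; by rewrite ?mulr0 ?mul1r.
Qed.

(** For [k < s] the truncated subtraction gives 0 and both sides vanish. *)
Lemma truncM s k f g : wpure s f -> trunc k (f * g) = f * trunc (k - s) g.
Proof.
move=> hf; apply/mpolyP => m; rewrite mcoeff_scale; case: ltnP => hm.
  rewrite mul1r -{1}(subrK (trunc (k - s) g) g) mulrDr mcoeffD -[RHS]add0r.
  congr (_ + _); apply/eqP/negPn/negP => /mcoeffM_neq0 [m1 [m2 [e /hf h1]]].
  rewrite mcoeffB mcoeff_scale; case: ltnP => h2; rewrite ?mul1r ?subrr ?eqxx // => _.
  by move: hm h2; rewrite e wdegD h1; lia.
rewrite mul0r; apply/esym/eqP/negPn/negP => /mcoeffM_neq0 [m1 [m2 [e /hf h1]]].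
by move/trunc_wlt; move: hm; rewrite e wdegD h1; lia.
Qed.

(** The inverse of c + Euler on monomials. For [c = 0] it kills the constant term, because 0 has
    inverse 0. *)
Definition inve c f := coefscale (fun m => ((wdeg m + c)%N%:R)^-1) f.

Lemma inve_euler c f : (0 < c)%N -> inve c (c%:R * f + euler f) = f.
Proof.
case: c => // c _; apply/mpolyP => m; rewrite mcoeff_scale mcoeffD mcoeff_euler mcoeff_natM.
rewrite -mulrDl mulrA -natrD [(c.+1 + _)%N]addnC.
by rewrite mulVf ?mul1r // addnS natr_neq0.
Qed.

Lemma euler_inve c f : (0 < c)%N -> c%:R * inve c f + euler (inve c f) = f.
Proof.
case: c => // c _; apply/mpolyP => m; rewrite mcoeffD mcoeff_euler mcoeff_natM.
rewrite mcoeff_scale -mulrDl mulrA -natrD [(c.+1 + _)%N]addnC.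
by rewrite mulfV ?mul1r // addnS natr_neq0.
Qed.

Lemma deriv_inve c i f : (inve c f)^`M(i) = inve (c + w i) f^`M(i).
Proof.
apply/mpolyP => m; rewrite mcoeff_deriv !mcoeff_scale mcoeff_deriv -mulrnAr wdegD wdegU.
by rewrite -addnA [(w i + c)%N]addnC.
Qed.

Lemma wlt_inve c k f : wlt k f -> wlt k (inve c f).
Proof.
move=> h m; rewrite mcoeff_scale mulf_eq0 negb_or => /andP [_]; exact: h.
Qed.

Lemma inveB c f g : inve c (f - g) = inve c f - inve c g.
Proof. by rewrite /inve coefscaleD coefscaleN. Qed.

Lemma ddpE i f : dd D i f = f^`M(i). Proof. by []. Qed.

Lemma ddX i j : dd D i ('X_j : A) = (i == j)%:R.
Proof.
rewrite ddpE mderivX mnm1E eq_sym; case: eqP => [->|_]; last by rewrite scale0r.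
by rewrite (_ : _ - _ = 0)%MM ?mpolyX0 ?scale1r //; apply/mnmP => k; rewrite mnmBE mnm0E subnn.
Qed.

Lemma eulervE : (vx eulerv = (w ix)%:R * 'X_ix) * (vy eulerv = (w iy)%:R * 'X_iy) *
  (vz eulerv = (w iz)%:R * 'X_iz).
Proof. by []. Qed.

(** For a closed v, the derivative of [dot eulerv v] in direction i is w_i + Euler applied to the
    component v_i. Differentiating [inve 0] gives [inve (w i)], a true inverse, so the constant term
    lost by [inve 0] is harmless. *)
Lemma curl0_grad v : curl D v = 0 -> v = grad D (inve 0 (dot eulerv v)).
Proof.
move=> h.
have hx : dd D iy (vz v) = dd D iz (vy v) by apply/eqP; rewrite -subr_eq0; apply/eqP/(congr1 (@vx _) h).
have hy : dd D iz (vx v) = dd D ix (vz v) by apply/eqP; rewrite -subr_eq0; apply/eqP/(congr1 (@vy _) h).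
have hz : dd D ix (vy v) = dd D iy (vx v) by apply/eqP; rewrite -subr_eq0; apply/eqP/(congr1 (@vz _) h).
have E i f : (dd D i (dot eulerv v) = (w i)%:R * f + euler f) -> f = dd D i (inve 0 (dot eulerv v)).
  by move=> e; rewrite ddpE deriv_inve add0n -ddpE e inve_euler.
apply: vecE; rewrite gradE; apply: E;
  rewrite /euler /dot !gradE !eulervE !ddD !ddM !dd_natr !ddX /=.
- by rewrite hz -hy; ring.
- by rewrite -hz hx; ring.
- by rewrite hy -hx; ring.
Qed.

(** The same homotopy one degree higher: when div v = 0, the curl of the product of v with the Euler
    field has components (w_j + w_k + Euler) v_i, with j, k the other two indices. *)
Lemma div0_curl v : div D v = 0 ->
  v = curl D (inve (w ix) (vx (cross v eulerv)), inve (w iy) (vy (cross v eulerv)),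
              inve (w iz) (vz (cross v eulerv))).
Proof.
move=> h.
have E (j k : 'I_3) (f p q : A) : (dd D j q - dd D k p = (w j + w k)%:R * f + euler f) ->
    f = dd D j (inve (w k) q) - dd D k (inve (w j) p).
  move=> e; rewrite !ddpE !deriv_inve [(w k + _)%N]addnC -inveB -!ddpE e inve_euler //.
  by rewrite addn_gt0 w_gt0.
have hx : dd D ix (vx v) = - dd D iy (vy v) - dd D iz (vz v).
  by rewrite -[LHS]subr0 -h /div; ring.
apply: vecE; rewrite curlE; apply: E.
- rewrite /euler /dot !crossE !gradE !eulervE !(ddD, ddN) !ddM !dd_natr !ddX /= !natrD hx; ring.
- rewrite /euler /dot !crossE !gradE !eulervE !(ddD, ddN) !ddM !dd_natr !ddX /= !natrD hx; ring.
- rewrite /euler /dot !crossE !gradE !eulervE !(ddD, ddN) !ddM !dd_natr !ddX /= !natrD hx; ring.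
Qed.

End Weights.

(** * Poisson cohomology *)

Section Cohomology.
Variables (K : fieldType) (charK : [pchar K] =i pred0) (phi : poly3 K).
Variables (w : 'I_3 -> nat) (d : nat) (mu : nat) (u : 'I_mu -> poly3 K).
Hypothesis w_gt0 : forall i, (0 < w i)%N.
Hypothesis hphi : whomog w d phi.
Hypothesis mu_gt0 : (0 < mu)%N.
Hypothesis u0 : forall i : 'I_mu, i = 0%N :> nat -> u i = 1.
Hypothesis hu : forall i : 'I_mu, exists e : nat, whomog w e (u i).
Hypothesis hbasis : basis_Asing phi u.
Local Notation A := (poly3 K).
Local Notation D := (pder K).
Local Notation g := (grad D phi).
Local Notation e := (eulerv K w).
Local Notation W := (total_weight w).
Implicit Types (f h p q F : A) (v x m : vec A).

Lemma in_jacobianE p : in_jacobian phi p <-> exists x, p = dot x g.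
Proof.
split=> [[a ->]|[x ->]].
  by exists (a ix, a iy, a iz); rewrite sum3.
exists (fun i => if i == ix then vx x else if i == iy then vy x else vz x).
by rewrite sum3.
Qed.

(** If [d < w i] the derivative of [phi] is 0 and any [b] works, which is why the equation for [b]
    is conditional. *)
Lemma trunc_deriv i a b f : ((w i <= d)%N -> b = (a - (d - w i))%N) ->
  trunc w a (dd D i phi * f) = dd D i phi * trunc w b f.
Proof.
move=> hb; have hp := whomog_wpure charK hphi; rewrite ddpE.
case: (leqP (w i) d) => [le|lt]; last first.
  by rewrite (wpure_deriv0 hp lt) !mul0r /trunc /coefscale msupp0 big_nil.
by rewrite (truncM _ _ (wpure_deriv hp)) hb.
Qed.

Lemma trunc_dot k x : trunc w k (dot x g) =
  dot (trunc w (k + w ix - d) (vx x), trunc w (k + w iy - d) (vy x),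
       trunc w (k + w iz - d) (vz x)) g.
Proof.
rewrite /dot !gradE !truncD ![vx x * _]mulrC ![vy x * _]mulrC ![vz x * _]mulrC.
rewrite (@trunc_deriv ix k (k + w ix - d)); last lia.
rewrite (@trunc_deriv iy k (k + w iy - d)); last lia.
rewrite (@trunc_deriv iz k (k + w iz - d)); last lia.
by congr (_ + _ + _); rewrite mulrC.
Qed.

(** Take [N] above the weights of all the [u i]. The N-th power of a variable has weight at least
    [N], so truncating its decomposition below [N] isolates the combination of the [u i] and shows
    it to be in the Jacobian ideal. *)
Lemma Xn_jacobian : exists N, forall i, exists x, dot x g = 'X_i ^+ N.
Proof.
have /fin_all_exists [b hb] : forall i, exists k, wlt w k (u i) by move=> i; apply: wlt_ex.
pose N := (\sum_i b i)%N; exists N => i.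
have [a /in_jacobianE [x ex]] := hbasis.1 ('X_i ^+ N).
set x' := (trunc w (N + w ix - d) (vx x), trunc w (N + w iy - d) (vy x),
       trunc w (N + w iz - d) (vz x)); exists (x - x').
have -> : dot (x - x') g = dot x g - dot x' g by rewrite /dot !vcE; ring.
rewrite -trunc_dot -ex truncB.
have -> : trunc w N (\sum_(j < mu) a j *: u j) = \sum_(j < mu) a j *: u j.
  apply: trunc_id; apply: (big_ind (wlt w N)) => [|p q|j _].
  - by move=> m; rewrite mcoeff0 eqxx.
  - exact: wltD.
  - move=> m; rewrite mcoeffZ mulf_eq0 negb_or => /andP [_ /hb] hm.
    by apply: leq_trans hm _; rewrite /N (bigD1 j) //= leq_addr.
suff T0 : trunc w N ('X_i ^+ N : A) = 0 by rewrite T0; ring.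
apply/mpolyP => m; rewrite mcoeff_scale mcoeff0 mpolyXn mcoeffX.
case: eqP => [<-|_]; last by rewrite mulr0.
case: ltnP => //; last by rewrite mul0r.
suff -> : wdeg w (U_(i) *+ N)%MM = (w i * N)%N by rewrite ltnNge leq_pmull ?w_gt0.
elim: (N) => [|n IH]; first by rewrite muln0 /wdeg big1 // => j _; rewrite mulm0n mnm0E muln0.
by rewrite mulmS wdegD wdegU IH mulnS.
Qed.

Lemma cross_grad_eq0 v : cross v g = 0 -> exists h, v = smul h g.
Proof.
have [N hN] := Xn_jacobian; have [p hp] := hN ix; have [q hq] := hN iy.
exact: (koszul_cross hp hq).
Qed.

Lemma dot_grad_eq0 v : dot v g = 0 -> exists m, v = cross g m.
Proof.
have [N hN] := Xn_jacobian; have [p hp] := hN ix; have [q hq] := hN iy.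
by have [r hr] := hN iz; apply: (koszul_dot hp hq hr).
Qed.

Lemma grad_neq0 : g <> 0.
Proof.
move=> g0; have [N hN] := Xn_jacobian; have [p] := hN ix.
rewrite g0 /dot !vcE !mulr0 !addr0 => /esym/eqP; apply/negP; exact: Xn_neq0.
Qed.

Lemma smul_grad_inj f h : smul f g = smul h g -> f = h.
Proof.
move=> E; apply/eqP/negPn/negP => ne; apply: grad_neq0.
have Z (a : A) : f * a = h * a -> a = 0.
  move=> /eqP; rewrite -subr_eq0 -mulrBl mulf_eq0 subr_eq0 (negbTE ne) /=.
  by move/eqP.
by apply: vecE; apply: Z; [have := congr1 (@vx _) E | have := congr1 (@vy _) E
  | have := congr1 (@vz _) E]; rewrite !smulE.
Qed.

Lemma d_gt0 : (0 < d)%N.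
Proof.
rewrite lt0n; apply/negP => /eqP d0; apply: grad_neq0.
have Z i : dd D i phi = 0.
  by apply: (wpure_deriv0 (whomog_wpure charK hphi)); rewrite d0 w_gt0.
by apply: vecE; rewrite gradE Z.
Qed.

(** Koszul exactness writes curl v as grad phi times a vector m. As curl v has divergence 0, m is
    again a cocycle, of weight lower by [d], and the induction applies to it. *)
Lemma cocycle_wlt k v : wlt w (k - w ix) (vx v) -> wlt w (k - w iy) (vy v) ->
  wlt w (k - w iz) (vz v) -> dot g (curl D v) = 0 ->
  exists h f, v = grad D h + smul f g.
Proof.
elim/ltn_ind: k v => k IH v lx ly lz hv.
case: (posnP k) => [k0|k_gt0].
  exists 0, 0; move: lx ly lz; rewrite k0 !sub0n => /wlt0 lx /wlt0 ly /wlt0 lz.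
  by apply: vecE; rewrite !gcE !dd0 ?lx ?ly ?lz mul0r addr0.
have [|m em] := @dot_grad_eq0 (curl D v); first by rewrite -[RHS]hv /dot; ring.
(* Truncating [m] to the weights allowed by curl v keeps the equation and provides the bound for the
   induction. *)
pose t i p := trunc w (k - d - w i) p.
pose m' : vec A := (t ix (vx m), t iy (vy m), t iz (vz m)).
have em' : curl D v = cross g m'.
  have dw i j a : wlt w (k - w j) a -> wlt w (k - w i - w j) (dd D i a).
    by move=> h; rewrite subnAC; apply: wlt_deriv.
  have S i j (a b p q : A) : wlt w (k - w j) a -> wlt w (k - w i) b ->
      dd D i a - dd D j b = dd D i phi * p - dd D j phi * q ->
      dd D i a - dd D j b = dd D i phi * t j p - dd D j phi * t i q.
    move=> ha hb E; rewrite -[LHS](@trunc_id _ w (k - w i - w j)); last first.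
      by apply: wltB; [apply: dw | rewrite subnAC; apply: dw].
    rewrite E truncB (@trunc_deriv i _ (k - d - w j)); last lia.
    by rewrite (@trunc_deriv j _ (k - d - w i)) //; lia.
  apply: vecE; rewrite curlE crossE; apply: S => //.
  - exact: (congr1 (@vx _) em).
  - exact: (congr1 (@vy _) em).
  - exact: (congr1 (@vz _) em).
have [||||| h' [f' ef]] := IH (k - d)%N _ m'; try exact: trunc_wlt.
- by move: d_gt0; lia.
- by apply: oppr_inj; rewrite oppr0 -div_cross_grad -em' div_curl.
(* Only the gradient part of [m'] survives in the product with grad phi, and adding h' grad phi to v
   cancels it. *)
have : curl D (v + smul h' g) = 0.
  have -> : curl D (v + smul h' g) = curl D v + curl D (smul h' g).
    by apply: vecE; rewrite !gcE !ddE; ring.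
  by rewrite em' ef; apply: vecE; rewrite !gcE !ddE; ring.
move=> /(curl0_grad charK w_gt0); set H := inve _ _ _ => E.
exists H, (- h'); rewrite -E -addrA -[LHS]addr0; congr (_ + _).
by apply: vecE; rewrite !gcE; ring.
Qed.

Lemma cocycle_decomp v : dot g (curl D v) = 0 -> exists h f, v = grad D h + smul f g.
Proof.
have [kx hx] := wlt_ex w (vx v); have [ky hy] := wlt_ex w (vy v).
have [kz hz] := wlt_ex w (vz v).
by apply: (@cocycle_wlt (kx + ky + kz + W)); [apply: wlt_le hx | apply: wlt_le hy | apply: wlt_le hz];
  rewrite /total_weight; lia.
Qed.

Definition phisum (N : nat) (c : nat -> 'I_mu -> K) : A :=
  \sum_(l < N) \sum_i c l i *: (phi ^+ l * u i).

Lemma sum_widen (V : nmodType) N N' (F : nat -> V) : (N <= N')%N ->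
  \sum_(l < N) F l = \sum_(l < N') if (l < N)%N then F l else 0.
Proof. by move=> le; rewrite (big_ord_widen _ _ le) big_mkcond. Qed.

Lemma phisum_widen N N' c : (N <= N')%N ->
  phisum N c = phisum N' (fun l i => if (l < N)%N then c l i else 0).
Proof.
move=> le; rewrite /phisum (sum_widen (fun l => \sum_i c l i *: (phi ^+ l * u i)) le).
apply: eq_bigr => l _; case: ifP => // _; rewrite big1 // => i _; exact: scale0r.
Qed.

Lemma phisumD N c c' : phisum N c + phisum N c' = phisum N (fun l i => c l i + c' l i).
Proof.
rewrite -big_split; apply: eq_bigr => l _; rewrite -big_split; apply: eq_bigr => i _.
by rewrite /= -scalerDl.
Qed.

Lemma phisumZ N a c : a *: phisum N c = phisum N (fun l i => a * c l i).
Proof.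
rewrite /phisum scaler_sumr; apply: eq_bigr => l _; rewrite scaler_sumr.
by apply: eq_bigr => i _; rewrite scalerA.
Qed.

Lemma phisumS N c : phisum N.+1 c =
  \sum_i c 0%N i *: u i + phi * phisum N (fun l i => c l.+1 i).
Proof.
rewrite /phisum big_ord_recl; congr (_ + _).
  by apply: eq_bigr => i _; rewrite expr0 mul1r.
rewrite mulr_sumr; apply: eq_bigr => l _; rewrite mulr_sumr; apply: eq_bigr => i _.
by rewrite -scalerAr mulrA -exprS.
Qed.

Lemma euler_phi : dot e g = d%:R * phi.
Proof. exact: whomogE hphi. Qed.

Lemma natr_unit n : (0 < n)%N -> (n%:R : K) != 0.
Proof. by case: n => // n _; apply: natr_neq0. Qed.

Lemma scaleMP a p : a *: p = a%:MP * p.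
Proof. by rewrite mul_mpolyC. Qed.

Lemma div_smul_euler f : div D (smul f e) = W%:R * f + euler w f.
Proof.
rewrite /div /euler /dot /total_weight !gradE !smulE !eulervE !ddM !dd_natr !ddX /= !natrD.
ring.
Qed.

Lemma phi_expr l : grad D (phi ^+ l.+1) = smul (l.+1%:R * phi ^+ l) g.
Proof.
elim: l => [|l IH]; first by rewrite expr1 expr0; apply: vecE; rewrite smulE !mulr1 mul1r.
rewrite exprS gradM IH; apply: vecE; rewrite !gcE !exprS [in RHS]mulrS; ring.
Qed.

(** Modulo the [u i], F is x' . grad phi. Subtracting from x' a multiple G of the Euler field makes
    it divergence free, hence a curl. What remains is d phi G with G of lower weight, and
    multiplication by phi maps grad phi . curl m to grad phi . curl (phi m). *)
Lemma top_decomp F : exists m N c, F = dot g (curl D m) + phisum N c.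
Proof.
have [k hk] := wlt_ex w F; elim/ltn_ind: k F hk => k IH F hF.
have [a /in_jacobianE [x ex]] := hbasis.1 F.
case: (posnP k) => [k0|k_gt0].
  exists 0, 0%N, (fun _ _ => 0); move: hF; rewrite k0 => /wlt0 ->.
  by rewrite /phisum big_ord0 /dot !gcE !dd0; ring.
have /fin_all_exists [es hes] : forall i, exists n, whomog w n (u i) by exact: hu.
(* Each [u i] is weight homogeneous, so the truncation keeps it whole or kills it. *)
pose b i := if (es i < k)%N then a i else 0.
pose x' : vec A := (trunc w (k + w ix - d) (vx x), trunc w (k + w iy - d) (vy x),
       trunc w (k + w iz - d) (vz x)).
have eF : F = dot x' g + \sum_i b i *: u i.
  rewrite -trunc_dot -ex truncB trunc_id // -[LHS](subrK (\sum_i b i *: u i)).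
  congr (_ - _ + _); elim/big_rec2: _ => [|i p q _ ->].
    by apply/mpolyP => m; rewrite mcoeff_scale mcoeff0 mulr0.
  rewrite truncD; congr (_ + _); have hi := whomog_wpure charK (hes i).
  apply/mpolyP => m; rewrite mcoeff_scale !mcoeffZ /b.
  case: (boolP ((u i)@_m == 0)) => [/eqP ->|/hi ->]; first by rewrite !mulr0.
  by case: ifP; rewrite ?mul1r ?mul0r.
(* Chosen so that G times the Euler field has the same divergence as [x']. *)
set G := inve w W (div D x').
have wG : wlt w (k - d) G.
  have T i p : wlt w (k - d) (dd D i (trunc w (k + w i - d) p)).
    by apply: (wlt_le _ (wlt_deriv (@trunc_wlt _ _ _ _))); lia.
  by apply: wlt_inve; apply: wltD; first apply: wltD; apply: T.
have kd : (k - d < k)%N by move: d_gt0; lia.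
have W_gt0 : (0 < W)%N by rewrite /total_weight !addn_gt0 w_gt0.
have [m [N [c ec]]] := IH _ kd _ wG.
have dG : div D (x' - smul G e) = 0.
  rewrite (_ : div _ _ = div D x' - div D (smul G e)); last by rewrite /div !vcE !ddE; ring.
  by rewrite div_smul_euler euler_inve // subrr.
have [m' em'] : exists m', x' - smul G e = curl D m' by eexists; apply: (div0_curl charK w_gt0).
exists (m' + smul (d%:R * phi) m), N.+1.
exists (fun l i => if l is l'.+1 then d%:R * c l' i else b i).
rewrite phisumS -phisumZ {1}eF -[x'](subrK (smul G e)) em' scaleMP mpolyC_nat.
have -> : dot (curl D m' + smul G e) g = dot g (curl D m') + G * dot e g.
  by rewrite /dot !vcE; ring.
rewrite euler_phi ec /dot !gcE !ddE !dd_natr.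
ring.
Qed.

(** Since phi is in the Jacobian ideal, the terms with l = 0 vanish by freeness of the [u i]. To
    divide the rest by phi, compare with G times the Euler field and take a divergence: this gives
    the relation for (W + Euler) G, and that operator only rescales each phi^l u_i by a positive
    integer. *)
Lemma phisum_free N c m : phisum N c = dot g (curl D m) ->
  forall l, (l < N)%N -> forall i, c l i = 0.
Proof.
have /fin_all_exists [es hes] : forall i, exists n, whomog w n (u i) by exact: hu.
elim: N c m => // N IH c m E.
have dK : (d%:R : K) != 0 by apply: natr_unit; exact: d_gt0.
set G := phisum N (fun l i => c l.+1 i).
have ed : phi = dot (smul (d%:R^-1)%:MP e) g.
  transitivity ((d%:R^-1)%:MP * dot e g); last by rewrite /dot !vcE; ring.
  by rewrite euler_phi -mpolyC_nat mulrA -mpolyCM mulVf // mpolyC1 mul1r.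
have c0 i : c 0%N i = 0.
  apply: hbasis.2 i; apply/in_jacobianE.
  exists (curl D m - smul (G * (d%:R^-1)%:MP) e).
  move: E; rewrite phisumS -/G => /(canRL (addrK _)) ->.
  transitivity (dot g (curl D m) - dot (smul (d%:R^-1)%:MP e) g * G).
    by rewrite -ed.
  by rewrite /dot !vcE; ring.
have EG : phi * G = dot g (curl D m).
  by rewrite -E phisumS big1 ?add0r // => i _; rewrite c0 scale0r.
have [m' em'] : exists m', smul G e - smul d%:R (curl D m) = cross g m'.
  apply: dot_grad_eq0; transitivity (G * dot e g - d%:R * dot g (curl D m)).
    by rewrite /dot !vcE; ring.
  by rewrite euler_phi -EG; ring.
have eG : W%:R * G + euler w G = dot g (curl D (- m')).
  rewrite -div_smul_euler; transitivity (div D (cross g m')).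
    by rewrite -em' /div !gcE !ddE !dd_natr; ring.
  by rewrite div_cross_grad /dot !gcE !ddE; ring.
have eG' : W%:R * G + euler w G =
    phisum N (fun l i => (W + (l * d + es i))%:R * c l.+1 i).
  have eulM p q : euler w (p * q) = euler w p * q + p * euler w q.
    by rewrite /euler /dot !gradE !ddE; ring.
  have eulphi l : euler w (phi ^+ l) = (l * d)%:R * phi ^+ l.
    elim: l => [|l IHl]; first by rewrite expr0 /euler /dot !gradE !dd1; ring.
    rewrite exprS eulM IHl [euler w phi]euler_phi mulSn natrD; ring.
  have eulS n (F : 'I_n -> A) : euler w (\sum_l F l) = \sum_l euler w (F l).
    by apply: (big_morph (euler w)) => [p q|]; rewrite /euler /dot !gradE !ddE; ring.
  rewrite /G /phisum mulr_sumr eulS -big_split; apply: eq_bigr => l _ /=.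
  rewrite mulr_sumr eulS -big_split; apply: eq_bigr => i _ /=.
  rewrite !scaleMP !eulM eulphi [euler w (u i)](whomogE (hes i)) mpolyCM -mpolyC_nat.
  rewrite (_ : euler w _%:MP = 0); last by rewrite /euler /dot !gradE !ddpE !mderivC; ring.
  by rewrite !mpolyC_nat !natrD; ring.
have H := IH _ _ (etrans (esym eG') eG).
case=> [_ //|l] hl i; have /eqP := H l hl i; rewrite mulf_eq0 => /orP [|/eqP //].
by rewrite (negbTE (natr_unit _)) //; rewrite /total_weight !addn_gt0 w_gt0.
Qed.

(** The Euler field multiplies a monomial by its weight, which is nonzero in K unless the monomial
    is 1. *)
Lemma grad_eq0 h : grad D h = 0 -> exists a, h = a%:MP.
Proof.
move=> E; exists h@_0; apply/mpolyP => m; rewrite mcoeffC.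
case: eqP => [<-|/eqP ne]; rewrite ?mulr1 // mulr0.
have := mcoeff_euler w h m; rewrite /euler E /dot !vcE.
rewrite !mulr0 !addr0 mcoeff0 => /eqP; rewrite eq_sym mulf_eq0 => /orP [|/eqP //].
rewrite (negbTE (natr_unit _)) //; rewrite lt0n; apply: contra ne => /eqP; rewrite /wdeg => /eqP.
rewrite sum_nat_eq0 => /forallP Z; apply/eqP/mnmP => j; rewrite mnm0E.
have := Z j; rewrite /= muln_eq0 eq_sym => /orP [/eqP h0|/eqP -> //]; by have := w_gt0 j; rewrite -h0.
Qed.

(** Taking the curl of q grad phi shows that grad q is also a multiple of grad phi; q has lower
    weight, so by induction it is a polynomial in phi, and it can be integrated. The constant is
    kept apart because the rest is a multiple of phi, hence in the Jacobian ideal. *)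
Lemma casimirs h q : grad D h = smul q g ->
  exists a N (c : nat -> K), h = a%:MP + phi * \sum_(l < N) c l *: phi ^+ l.
Proof.
have [k hk] := wlt_ex w h; elim/ltn_ind: k h q hk => k IH h q hh E.
case: (posnP k) => [k0|k_gt0].
  exists 0, 0%N, (fun=> 0); move: hh; rewrite k0 => /wlt0 ->.
  by rewrite big_ord0 mulr0 mpolyC0 addr0.
pose q' := trunc w (k - d) q.
have {}E : grad D h = smul q' g.
  have T i : dd D i h = q * dd D i phi -> dd D i h = q' * dd D i phi.
    move=> Ei; rewrite -[LHS](@trunc_id _ w (k - w i)); last exact: wlt_deriv hh.
    rewrite Ei mulrC [RHS]mulrC.
    by apply: trunc_deriv; lia.
  apply: vecE; rewrite !gcE; apply: T.
  - exact: (congr1 (@vx _) E).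
  - exact: (congr1 (@vy _) E).
  - exact: (congr1 (@vz _) E).
have [r er] : exists r, grad D q' = smul r g.
  apply: cross_grad_eq0; transitivity (curl D (smul q' g)); last by rewrite -E curl_grad.
  by apply: vecE; rewrite !gcE !ddE; ring.
have kd : (k - d < k)%N by move: d_gt0; lia.
have [a [N [c eq']]] := IH _ kd q' r (@trunc_wlt _ _ _ _) er.
pose b l := if l is l'.+1 then c l' else a.
have eb : q' = \sum_(l < N.+1) b l *: phi ^+ l.
  rewrite big_ord_recl /= expr0 eq' alg_mpolyC; congr (_ + _).
  by rewrite mulr_sumr; apply: eq_bigr => l _; rewrite /b /= -scalerAr -exprS.
pose Q := phi * \sum_(l < N.+1) (l.+1%:R^-1 * b l) *: phi ^+ l.
have gQ : grad D Q = smul q' g.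
  have S i : dd D i Q = q' * dd D i phi.
    rewrite /Q eb mulr_sumr mulr_suml dd_sum; apply: eq_bigr => l _.
    rewrite -scalerAr -exprS scaleMP ddM [dd D i _%:MP]mderivC mul0r add0r.
    have -> : dd D i (phi ^+ l.+1) = l.+1%:R * phi ^+ l * dd D i phi.
      have E2 := phi_expr l; case: (ord3P i) => ->.
      - exact: (congr1 (@vx _) E2).
      - exact: (congr1 (@vy _) E2).
      - exact: (congr1 (@vz _) E2).
    have V : (l.+1%:R^-1)%:MP * l.+1%:R = 1 :> A.
      by rewrite -mpolyC_nat -mpolyCM mulVf ?mpolyC1 // natr_neq0.
    transitivity ((l.+1%:R^-1)%:MP * l.+1%:R * (b l *: phi ^+ l * dd D i phi)).
      by rewrite scaleMP mpolyCM; ring.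
    by rewrite V mul1r.
  by apply: vecE; rewrite !gcE.
have [|a' ea] := @grad_eq0 (h - Q).
  by rewrite gradD gradN E gQ subrr.
by exists a', N.+1, (fun l => l.+1%:R^-1 * b l); rewrite -/Q -ea subrK.
Qed.

(** This makes f grad phi a coboundary for every polynomial f in phi when d differs from W, and
    explains why [Ephi] then omits the index 0. *)
Lemma lieb_euler f q : grad D f = smul q g ->
  lieb D (smul f e) g = smul ((d%:R - W%:R) * f) g.
Proof.
move=> E; have eE : euler w f = q * (d%:R * phi).
  by rewrite -euler_phi /euler E /dot !vcE; ring.
have eD : dot (smul f e) g = d%:R * phi * f.
  by rewrite -euler_phi /dot !vcE; ring.
rewrite lieb_grad div_smul_euler eE eD gradM E.
by apply: vecE; rewrite !gcE !ddE dd_natr; ring.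
Qed.

(** The source of the coboundaries modulo which [top_decomp] works. *)
Lemma lieb_cross v : lieb D (cross g v) g = smul (dot g (curl D v)) g.
Proof.
rewrite lieb_grad div_cross_grad (_ : dot (cross g v) g = 0); last by rewrite /dot !vcE; ring.
by apply: vecE; rewrite !gcE !dd0; ring.
Qed.

Let i0 : 'I_mu := Ordinal mu_gt0.

Lemma Ephi0 i : (i == i0) = (i == 0%N :> nat). Proof. by []. Qed.

Lemma phisum_unit N (a : nat -> K) :
  \sum_(l < N) a l *: phi ^+ l = phisum N (fun l i => if i == i0 then a l else 0).
Proof.
apply: eq_bigr => l _; rewrite (bigD1 i0) //= ?eqxx u0 // mulr1 big1 ?addr0 // => i h.
by rewrite (negbTE h) scale0r.
Qed.

Lemma grad_phi_sum N (a : nat -> K) :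
  exists q, grad D (\sum_(l < N) a l *: phi ^+ l) = smul q g.
Proof.
elim: N => [|N [q E]].
  by exists 0; rewrite big_ord0; apply: vecE; rewrite !gcE dd0 mul0r.
rewrite big_ord_recr /= gradD E.
have [r er] : exists r, grad D (phi ^+ N) = smul r g.
  case: N {E} => [|N]; last by eexists; apply: phi_expr.
  by exists 0; apply: vecE; rewrite !gcE expr0 dd1 mul0r.
exists (q + (a N)%:MP * r); rewrite scaleMP gradM er.
by apply: vecE; rewrite !gcE !ddpE !mderivC; ring.
Qed.

Lemma natrB_unit : d <> W -> (d%:R - W%:R : K) != 0.
Proof. by move=> h; rewrite subr_eq0; apply/eqP => /(natr_inj charK). Qed.

Lemma natrB_MP : d%:R - W%:R = (d%:R - W%:R : K)%:MP :> A.
Proof. by rewrite mpolyCB !mpolyC_nat. Qed.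

(** A cocycle is grad h + f grad phi. The Jacobian part of h is traded for a coboundary, at the
    price of a divergence added to f; then f is reduced by [top_decomp] and [lieb_cross]. *)
Lemma cocycle_class v : dot g (curl D v) = 0 -> exists x N c cb,
  (forall l i, ~~ Ephi w d i -> c l i = 0) /\
  v = lieb D x g + smul (phisum N c) g + grad D (\sum_(s < mu | (0 < s)%N) cb s *: u s).
Proof.
move=> /cocycle_decomp [h [f ev]]; have [a /in_jacobianE [x ex]] := hbasis.1 h.
have [m [N [c ec]]] := top_decomp (f + div D x).
have eh : grad D h = grad D (dot x g) + grad D (\sum_(s < mu | (0 < s)%N) a s *: u s).
  rewrite -ex -gradD (bigD1 i0) //= (eq_bigl (fun s : 'I_mu => (0 < s)%N)); last first.
    by move=> i; rewrite Ephi0 lt0n.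
  set U := \sum_(_ < _ | _) _; rewrite u0 // scaleMP mulr1.
  by apply: vecE; rewrite !gcE !ddE !ddpE !mderivC; ring.
have e1 : v = lieb D (x + cross g m) g + smul (phisum N c) g +
    grad D (\sum_(s < mu | (0 < s)%N) a s *: u s).
  rewrite ev eh liebDl lieb_cross lieb_grad -[f](addrK (div D x)) ec.
  set U := grad D (\sum_(_ < _ | _) _); apply: vecE; rewrite !gcE; ring.
pose c' l i := if Ephi w d i then c l i else 0.
have c'0 l i : ~~ Ephi w d i -> c' l i = 0 by rewrite /c' => /negbTE ->.
case: (eqVneq d W) => [dW|/eqP dW].
  exists (x + cross g m), N, c', a; split; first exact: c'0.
  suff <- : phisum N c = phisum N c' by exact: e1.
  by apply: eq_bigr => l _; apply: eq_bigr => i _; rewrite /c' /Ephi dW eqxx orbT.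
(* For d different from W, the terms in phi^l u_0 are absorbed by a multiple of the Euler field. *)
have [q eq'] := grad_phi_sum N (fun l => (d%:R - W%:R)^-1 * c l i0).
exists (x + cross g m + smul (\sum_(l < N) ((d%:R - W%:R)^-1 * c l i0) *: phi ^+ l) e), N, c', a.
split; first exact: c'0.
rewrite liebDl (lieb_euler eq') -(addrA (lieb _ _ _)).
suff <- : smul (phisum N c) g = smul ((d%:R - W%:R) *
    \sum_(l < N) ((d%:R - W%:R)^-1 * c l i0) *: phi ^+ l) g + smul (phisum N c') g.
  exact: e1.
have -> : phisum N c = phisum N c' + phisum N (fun l i => if i == i0 then c l i0 else 0).
  rewrite phisumD; apply: eq_bigr => l _; apply: eq_bigr => i _; congr (_ *: _).
  rewrite /c' /Ephi; move/eqP: (dW) => /negbTE ->; rewrite orbF lt0n -Ephi0.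
  by case: eqP => [->|]; rewrite ?add0r ?addr0.
rewrite -phisum_unit natrB_MP -scaleMP scaler_sumr.
rewrite [\sum_(_ < _) (d%:R - W%:R) *: _](eq_bigr (fun l : 'I_N => c l i0 *: phi ^+ l)); last first.
  by move=> l _; rewrite scalerA mulrA mulfV ?natrB_unit // mul1r.
by apply: vecE; rewrite !vcE; ring.
Qed.

(** The equation says that x . grad phi - U has gradient proportional to grad phi, so it is a
    constant plus a multiple of phi. Modulo the Jacobian ideal this kills U and the constant. Then x
    is a multiple R of the Euler field plus grad phi times m, and independence of the phi^l u_i
    kills R and the sum. *)
Lemma cocycle_free x N c cb : d <> W -> (forall l i, ~~ Ephi w d i -> c l i = 0) ->
  lieb D x g = smul (phisum N c) g + grad D (\sum_(s < mu | (0 < s)%N) cb s *: u s) ->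
  [/\ phisum N c = 0, \sum_(s < mu | (0 < s)%N) cb s *: u s = 0 &
      exists h, x = cross g (grad D h)].
Proof.
move=> dW hc; set U := \sum_(_ < _ | _) _; rewrite lieb_grad => E.
have dK : (d%:R : K) != 0 by apply: natr_unit; exact: d_gt0.
have eG : grad D (dot x g - U) = smul (phisum N c + div D x) g.
  rewrite gradD gradN -[grad D (dot x g)](subrK (smul (div D x) g)) E.
  by apply: vecE; rewrite !vcE; ring.
have [a [N' [b eb]]] := casimirs eG; set Q := \sum_(l < N') _ in eb.
have ed : phi = dot (smul (d%:R^-1)%:MP e) g.
  transitivity ((d%:R^-1)%:MP * dot e g); last by rewrite /dot !vcE; ring.
  by rewrite euler_phi -mpolyC_nat mulrA -mpolyCM mulVf // mpolyC1 mul1r.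
(* The constant [a] becomes the coefficient of u_0 = 1, so that freeness of the basis kills it
   together with [cb]. *)
pose cb' i := if i == i0 then a else cb i.
have eU : \sum_i cb' i *: u i = a%:MP + U.
  rewrite (bigD1 i0) //= {1}/cb' eqxx u0 // scaleMP mulr1; congr (_ + _).
  apply: eq_big => [i|i h]; first by rewrite Ephi0 lt0n.
  by rewrite /cb' (negbTE h).
have cb0 : forall i, cb' i = 0.
  apply: hbasis.2; apply/in_jacobianE; exists (x - smul (Q * (d%:R^-1)%:MP) e).
  rewrite eU; transitivity (dot x g - phi * Q).
    by rewrite -[dot x g](subrK U) eb; ring.
  transitivity (dot x g - dot (smul (d%:R^-1)%:MP e) g * Q); first by rewrite -ed.
  by rewrite /dot !vcE; ring.
have U0 : U = 0.
  rewrite /U big1 // => s hs; have := cb0 s; rewrite /cb' Ephi0.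
  by case: eqP hs => [->|_ _ ->]; rewrite ?scale0r.
have a0 : a = 0 by have := cb0 i0; rewrite /cb' eqxx.
have ex : dot x g = phi * Q by have := eb; rewrite U0 a0 subr0 mpolyC0 add0r.
set R := \sum_(l < N') (d%:R^-1 * b l) *: phi ^+ l.
have eR : R = (d%:R^-1)%:MP * Q.
  rewrite /R /Q mulr_sumr; apply: eq_bigr => l _.
  by rewrite !scaleMP mpolyCM mulrA.
have [m em] : exists m, x - smul R e = cross g m.
  apply: dot_grad_eq0; transitivity (dot x g - dot (smul (d%:R^-1)%:MP e) g * Q).
    by rewrite eR /dot !vcE; ring.
  by rewrite ex -ed subrr.
have [q eq'] := grad_phi_sum N' (fun l => d%:R^-1 * b l).
have eF : phisum N c = dot g (curl D m) + (d%:R - W%:R) * R.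
  apply: smul_grad_inj; transitivity (lieb D x g).
    by rewrite lieb_grad E U0; apply: vecE; rewrite !gcE dd0 addr0.
  rewrite -[x](subrK (smul R e)) em liebDl lieb_cross (lieb_euler eq') -/R.
  by apply: vecE; rewrite !vcE; ring.
(* The relation [eF] as one family of common length. [R] only involves u_0, which the sum omits as d
   differs from W, so the two parts cannot cancel. *)
pose M := (N + N')%N; pose k := (d%:R - W%:R : K).
pose b' l i := if i == i0 then d%:R^-1 * b l else 0.
pose C l i := (if (l < N)%N then c l i else 0) +
  - k * (if (l < N')%N then b' l i else 0).
have eC : phisum M C = dot g (curl D m).
  rewrite /C -phisumD -phisumZ -!phisum_widen ?leq_addr ?leq_addl //.
  have eR' : R = phisum N' b' by exact: phisum_unit.
  by rewrite eF eR' natrB_MP -/k scaleMP mpolyCN; ring.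
have C0 := phisum_free eC.
have R0 : R = 0.
  rewrite /R big1 // => l _; have := C0 l (leq_trans (ltn_ord l) (leq_addl _ _)) i0.
  rewrite /C /b' eqxx ltn_ord hc ?if_same ?add0r; last first.
    by rewrite /Ephi /=; apply/eqP.
  move/eqP; rewrite mulf_eq0 oppr_eq0 (negbTE (natrB_unit dW)) /= => /eqP ->.
  by rewrite scale0r.
have F0 : phisum N c = 0.
  rewrite /phisum big1 // => l _; apply: big1 => i _.
  have := C0 l (leq_trans (ltn_ord l) (leq_addr _ _)) i; rewrite /C ltn_ord /b'.
  case: (eqVneq i i0) => [->|ne]; last by rewrite if_same mulr0 addr0 => ->; rewrite scale0r.
  by rewrite hc ?scale0r // /Ephi /=; apply/eqP.
split => //; have em0 : dot g (curl D m) = 0.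
  by have := eF; rewrite F0 R0 mulr0 addr0.
have [h [f eh]] := cocycle_decomp em0; exists h.
have -> : x = cross g m by rewrite -em R0; apply: vecE; rewrite !vcE; ring.
by rewrite eh; apply: vecE; rewrite !vcE; ring.
Qed.

End Cohomology.

(** * Formal power series *)

Record pser (R : Type) := Pser { pc : nat -> R }.

Lemma pserP (R : Type) (f g : pser R) : (forall n, pc f n = pc g n) -> f = g.
Proof. by case: f => f; case: g => g /= /boolp.funext ->. Qed.

HB.instance Definition _ (R : Type) := boolp.gen_eqMixin (pser R).
HB.instance Definition _ (R : Type) := boolp.gen_choiceMixin (pser R).

Section PserZmodule.
Variable R : zmodType.
Definition pser_add (f g : pser R) := Pser (fun n => pc f n + pc g n).
Definition pser_opp (f : pser R) := Pser (fun n => - pc f n).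
Lemma pser_addA : associative pser_add.
Proof. by move=> f g h; apply: pserP => n /=; rewrite addrA. Qed.
Lemma pser_addC : commutative pser_add.
Proof. by move=> f g; apply: pserP => n /=; rewrite addrC. Qed.
Lemma pser_add0 : left_id (Pser (fun _ => 0)) pser_add.
Proof. by move=> f; apply: pserP => n /=; rewrite add0r. Qed.
Lemma pser_addN : left_inverse (Pser (fun _ => 0)) pser_opp pser_add.
Proof. by move=> f; apply: pserP => n /=; rewrite addNr. Qed.
HB.instance Definition _ :=
  GRing.isZmodule.Build (pser R) pser_addA pser_addC pser_add0 pser_addN.
Lemma pcD f g n : pc (f + g) n = pc f n + pc g n. Proof. by []. Qed.
Lemma pcN f n : pc (- f) n = - pc f n. Proof. by []. Qed.
Lemma pcB f g n : pc (f - g) n = pc f n - pc g n. Proof. by []. Qed.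
Lemma pc0 n : pc (0 : pser R) n = 0. Proof. by []. Qed.
End PserZmodule.

Section PserRing.
Variable R : comNzRingType.
Implicit Types f g h : pser R.
Definition pser_mul f g := Pser (fun n => \sum_(i < n.+1) pc f i * pc g (n - i)).
Definition pser_one : pser R := Pser (fun n => (n == 0%N)%:R).

(* The coefficients below N of a product are those of a product of polynomials,
   which reduces the ring laws and the product rule to those of {poly R}. *)
Definition ptrunc N f : {poly R} := \poly_(i < N) pc f i.

Lemma pser_mul_coef N f g n : (n < N)%N -> pc (pser_mul f g) n = (ptrunc N f * ptrunc N g)`_n.
Proof.
move=> hn; rewrite coefM; apply: eq_bigr => i _; rewrite !coef_poly.
have hi := ltn_ord i; rewrite ltnS in hi.
by rewrite (leq_ltn_trans hi hn) (leq_ltn_trans (leq_subr _ _) hn).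
Qed.

Lemma pser_mulC : commutative pser_mul.
Proof.
by move=> f g; apply: pserP => n; rewrite !(@pser_mul_coef n.+1) // mulrC.
Qed.

Lemma pser_mulA : associative pser_mul.
Proof.
have T f g (p : {poly R}) n : (ptrunc n.+1 (pser_mul f g) * p)`_n =
    (ptrunc n.+1 f * ptrunc n.+1 g * p)`_n.
  rewrite !coefM; apply: eq_bigr => i _; congr (_ * _).
  by rewrite coef_poly ltn_ord (@pser_mul_coef n.+1).
move=> f g h; apply: pserP => n; rewrite [LHS](@pser_mul_coef n.+1) //.
by rewrite [RHS](@pser_mul_coef n.+1) // T mulrC T mulrC mulrA.
Qed.

Lemma pser_mul1 : left_id pser_one pser_mul.
Proof.
move=> f; apply: pserP => n /=; rewrite big_ord_recl /= mul1r subn0 big1 ?addr0 // => i _.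
by rewrite mul0r.
Qed.

Lemma pser_mulDl : left_distributive pser_mul +%R.
Proof.
move=> f g h; apply: pserP => n /=; rewrite -big_split; apply: eq_bigr => i _ /=.
by rewrite mulrDl.
Qed.

Lemma pser_one_neq0 : pser_one != 0.
Proof. by apply/eqP => /(congr1 (fun f => pc f 0%N)) /= /eqP; rewrite oner_eq0. Qed.

HB.instance Definition _ := GRing.Zmodule_isComNzRing.Build (pser R)
  pser_mulA pser_mulC pser_mul1 pser_mulDl pser_one_neq0.

Lemma pcM f g n : pc (f * g) n = \sum_(i < n.+1) pc f i * pc g (n - i). Proof. by []. Qed.
Lemma pc1 n : pc (1 : pser R) n = (n == 0%N)%:R. Proof. by []. Qed.

Lemma pc_natM k f n : pc (k%:R * f) n = k%:R * pc f n.
Proof.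
rewrite !mulr_natl; elim: k => [|k IH]; first by rewrite !mulr0n.
by rewrite !mulrS pcD IH.
Qed.

Lemma pcM0 f g : pc (f * g) 0%N = pc f 0%N * pc g 0%N.
Proof. by rewrite pcM big_ord_recl big_ord0 addr0. Qed.

Definition cst (a : R) : pser R := Pser (fun n => if n == 0%N then a else 0).
Definition nu : pser R := Pser (fun n => (n == 1%N)%:R).

Lemma pc_cstM a f n : pc (cst a * f) n = a * pc f n.
Proof.
rewrite pcM big_ord_recl /= subn0 big1 ?addr0 // => i _.
by rewrite mul0r.
Qed.

Lemma cstM a b : cst (a * b) = cst a * cst b.
Proof. by apply: pserP => n; rewrite pc_cstM /=; case: eqP => //; rewrite mulr0. Qed.

Lemma cstD a b : cst (a + b) = cst a + cst b.
Proof. by apply: pserP => n; rewrite pcD /=; case: eqP => //; rewrite addr0. Qed.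

Lemma pc_nuM f n : pc (nu * f) n.+1 = pc f n.
Proof.
rewrite pcM big_ord_recl /= mul0r add0r big_ord_recl /= mul1r subn1 /= big1 ?addr0 // => i _.
by rewrite mul0r.
Qed.

Lemma pser_cst_nu f : f = cst (pc f 0%N) + nu * Pser (fun n => pc f n.+1).
Proof.
apply: pserP => -[|n]; rewrite pcD ?pc_nuM /= ?add0r //.
by rewrite big_ord_recl big_ord0 mul0r !addr0.
Qed.

(** The filtration by powers of nu. *)
Definition vanish n f := forall k, (k < n)%N -> pc f k = 0.

Lemma vanishD n f g : vanish n f -> vanish n g -> vanish n (f + g).
Proof. by move=> hf hg k hk; rewrite pcD hf ?hg ?addr0. Qed.

Lemma vanishN n f : vanish n f -> vanish n (- f).
Proof. by move=> hf k hk; rewrite pcN hf ?oppr0. Qed.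

Lemma vanishM m n f g : vanish m f -> vanish n g -> vanish (m + n) (f * g).
Proof.
move=> hf hg k hk; rewrite pcM big1 // => i _; case: (ltnP i m) => h.
  by rewrite hf ?mul0r.
by rewrite [pc g _]hg ?mulr0 //; have := ltn_ord i; lia.
Qed.

Lemma vanishMl n f g : vanish n f -> vanish n (f * g).
Proof. by move=> h; rewrite -[n]addn0; apply: vanishM. Qed.

Lemma pcM_vanish n f g : vanish n f -> pc (f * g) n = pc f n * pc g 0%N.
Proof.
move=> hf; rewrite pcM big_ord_recr /= subnn big1 ?add0r // => i _.
by rewrite hf ?mul0r.
Qed.

Lemma vanishP f : (forall n, vanish n f -> pc f n = 0) -> f = 0.
Proof. by move=> h; apply: pserP; apply: ltn_ind => n IH; apply: h. Qed.

Lemma vanish_exp n : vanish n (nu ^+ n).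
Proof.
elim: n => [|n IH]; first by []; rewrite exprS.
by case=> [_|k hk]; rewrite ?pc_nuM ?IH // pcM0 mul0r.
Qed.

Lemma pc_nuX n : pc (nu ^+ n) n = 1.
Proof. by elim: n => [|n IH]; rewrite ?pc1 // exprS pc_nuM. Qed.

Lemma vanishE n f : vanish n f -> exists h, f = nu ^+ n * h /\ pc h 0%N = pc f n.
Proof.
elim: n f => [|n IH] f hf; first by exists f; rewrite expr0 mul1r.
have [h [eh e0]] : exists h, Pser (fun n => pc f n.+1) = nu ^+ n * h /\ pc h 0%N = pc f n.+1.
  by apply: IH => k hk /=; apply: hf.
exists h; split => //; rewrite exprS -mulrA -eh {1}[f]pser_cst_nu hf //.
by rewrite (_ : cst 0 = 0) ?add0r //; apply: pserP => k /=; case: eqP.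
Qed.

Definition tder f := Pser (fun n => n.+1%:R * pc f n.+1).

Lemma tderD f g : tder (f + g) = tder f + tder g.
Proof. by apply: pserP => n /=; rewrite mulrDr. Qed.

Lemma tderM f g : tder (f * g) = tder f * g + f * tder g.
Proof.
have E N k h : (k < N)%N -> (ptrunc N.+1 h)^`()`_k = pc (tder h) k.
  by move=> hk; rewrite coef_deriv coef_poly ltnS hk -mulr_natl.
have M N k (p q r s : {poly R}) : (k < N)%N -> (forall i, (i < N)%N -> p`_i = q`_i) ->
    (forall i, (i < N)%N -> r`_i = s`_i) -> (p * r)`_k = (q * s)`_k.
  move=> hk h1 h2; rewrite !coefM; apply: eq_bigr => i _.
  by rewrite h1 ?h2 //; have := ltn_ord i; lia.
have X k (p q : pser R) : pc (p * q) k = (ptrunc k.+1 p * ptrunc k.+1 q)`_k.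
  exact: pser_mul_coef.
apply: pserP => n; rewrite pcD -[LHS]/(n.+1%:R * pc (f * g) n.+1) !X.
rewrite mulr_natl -coef_deriv derivM coefD; congr (_ + _); apply: (M n.+1) => // i hi.
- by rewrite E // [RHS]coef_poly hi.
- by rewrite !coef_poly hi (ltn_trans hi).
- by rewrite !coef_poly hi (ltn_trans hi).
- by rewrite E // [RHS]coef_poly hi.
Qed.

End PserRing.

(** * Evaluation at t = 1 of series in t over power series in nu *)

Section Evaluation.
Variable R : comNzRingType.
Implicit Types F G : pser (pser R).

(* Series in t whose k-th coefficient is divisible by nu^k: they can be
   evaluated at t = 1. *)
Definition rees F := forall k, vanish k (pc F k).
Definition ev F : pser R := Pser (fun n => \sum_(k < n.+1) pc (pc F k) n).

Lemma evD F G : ev (F + G) = ev F + ev G.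
Proof. by apply: pserP => n; rewrite pcD /= -big_split. Qed.

Lemma evN F : ev (- F) = - ev F.
Proof. by apply: pserP => n; rewrite pcN /= sumrN. Qed.

Lemma reesD F G : rees F -> rees G -> rees (F + G).
Proof. by move=> hF hG k; apply: vanishD. Qed.

Lemma reesN F : rees F -> rees (- F).
Proof. by move=> hF k; apply: vanishN. Qed.

Lemma reesM F G : rees F -> rees G -> rees (F * G).
Proof.
move=> hF hG k; rewrite pcM; apply: (big_ind (vanish k)) => [//|f g|i _].
  exact: vanishD.
have hi : (i <= k)%N by rewrite -ltnS.
by have := vanishM (hF i) (hG (k - i)%N); rewrite subnKC.
Qed.

Lemma pc_sum (I : Type) (r : seq I) (P : pred I) (f : I -> pser R) n :
  pc (\sum_(i <- r | P i) f i) n = \sum_(i <- r | P i) pc (f i) n.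
Proof. by apply: (big_morph (fun f : pser R => pc f n)). Qed.

(** For each splitting of the nu-order as a + (n - a), the coefficients of nu^a in F and of nu^(n -
    a) in G are polynomials in t, so multiplicativity is that of evaluating polynomials at 1. *)
Lemma evM F G : rees F -> rees G -> ev (F * G) = ev F * ev G.
Proof.
move=> hF hG; apply: pserP => n; rewrite pcM /=.
have -> : \sum_(k < n.+1) pc (\sum_(i < k.+1) pc F i * pc G (k - i)) n =
    \sum_(a < n.+1) \sum_(k < n.+1) \sum_(i < k.+1) pc (pc F i) a * pc (pc G (k - i)) (n - a).
  rewrite exchange_big; apply: eq_bigr => k _.
  by rewrite pc_sum exchange_big.
apply: eq_bigr => a _; have ha : (a <= n)%N by rewrite -ltnS.
pose P := \poly_(i < a.+1) pc (pc F i) a; pose Q := \poly_(i < (n - a).+1) pc (pc G i) (n - a).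
have PE i : P`_i = pc (pc F i) a by rewrite coef_poly ltnS; case: leqP => // h; rewrite hF.
have QE i : Q`_i = pc (pc G i) (n - a) by rewrite coef_poly ltnS; case: leqP => // h; rewrite hG.
have sP : (size P <= a.+1)%N by apply: size_poly.
have sQ : (size Q <= (n - a).+1)%N by apply: size_poly.
transitivity (P.[1] * Q.[1]).
  rewrite -hornerM (@horner_coef_wide _ n.+1); last first.
    apply: leq_trans (size_polyMleq _ _) _; rewrite -subn1 leq_subLR.
    by apply: leq_trans (leq_add sP sQ) _; rewrite addSn addnS subnKC.
  apply: eq_bigr => k _; rewrite expr1n mulr1 coefM.
  by apply: eq_bigr => i _; rewrite PE QE.
rewrite (horner_coef_wide _ sP) (horner_coef_wide _ sQ); congr (_ * _).
  by apply: eq_bigr => i _; rewrite expr1n mulr1 PE.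
by apply: eq_bigr => i _; rewrite expr1n mulr1 QE.
Qed.

End Evaluation.

(** * Vector calculus on power series, coefficient by coefficient *)

Section Lift.
Variables (R : comNzRingType) (D : diff3 R).

Definition pmap (d : R -> R) (f : pser R) := Pser (fun n => d (pc f n)).

Lemma pmapD i f g : pmap (dd D i) (f + g) = pmap (dd D i) f + pmap (dd D i) g.
Proof. by apply: pserP => n; rewrite pcD /= ddD. Qed.

Lemma pmapM i f g : pmap (dd D i) (f * g) = pmap (dd D i) f * g + f * pmap (dd D i) g.
Proof.
apply: pserP => n; rewrite pcD /= dd_sum -big_split; apply: eq_bigr => j _ /=.
exact: ddM.
Qed.

Lemma pmapC i j f : pmap (dd D i) (pmap (dd D j) f) = pmap (dd D j) (pmap (dd D i) f).
Proof. by apply: pserP => n /=; apply: ddC. Qed.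

Definition lift3 := Diff3 pmapD pmapM pmapC.

Lemma pc_dd i f n : pc (dd lift3 i f) n = dd D i (pc f n). Proof. by []. Qed.

Definition vpc (v : vec (pser R)) n : vec R := (pc (vx v) n, pc (vy v) n, pc (vz v) n).
Definition vpser (v : nat -> vec R) : vec (pser R) :=
  (Pser (fun n => vx (v n)), Pser (fun n => vy (v n)), Pser (fun n => vz (v n))).

Lemma vpserK v n : vpc (vpser v) n = v n.
Proof. exact: vecE. Qed.

Lemma vpc_inj v v' : (forall n, vpc v n = vpc v' n) -> v = v'.
Proof.
move=> h; apply: vecE; apply: pserP => n.
- exact: (congr1 (@vx _) (h n)).
- exact: (congr1 (@vy _) (h n)).
- exact: (congr1 (@vz _) (h n)).
Qed.

Lemma vpcE v n : (vx (vpc v n) = pc (vx v) n) * (vy (vpc v n) = pc (vy v) n) *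
  (vz (vpc v n) = pc (vz v) n).
Proof. by []. Qed.

Lemma vpcD v v' n : vpc (v + v') n = vpc v n + vpc v' n. Proof. by []. Qed.
Lemma vpcN v n : vpc (- v) n = - vpc v n. Proof. by []. Qed.
Lemma pc_vfield x f n : pc (vfield lift3 x f) n =
  \sum_(i < n.+1) vfield D (vpc x i) (pc f (n - i)).
Proof.
rewrite /vfield /dot !pcD !pcM !gradE -!big_split; apply: eq_bigr => i _ /=.
by rewrite !gradE.
Qed.

Lemma vpc_lieb x B n : vpc (lieb lift3 x B) n =
  \sum_(i < n.+1) lieb D (vpc x i) (vpc B (n - i)).
Proof.
have cD (f g : pser R) (a b : 'I_n.+1 -> R) : pc f n = \sum_i a i -> pc g n = \sum_i b i ->
    pc (f + g) n = \sum_i (a i + b i) by rewrite pcD big_split => -> ->.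
have cN (f : pser R) (a : 'I_n.+1 -> R) : pc f n = \sum_i a i ->
    pc (- f) n = \sum_i - a i by rewrite pcN sumrN => ->.
have cd i (f : pser R) (a : 'I_n.+1 -> R) : pc f n = \sum_i a i ->
    pc (dd lift3 i f) n = \sum_j dd D i (a j) by rewrite pc_dd -dd_sum => ->.
have cM (f g : pser R) : pc (f * g) n = \sum_(i < n.+1) pc f i * pc g (n - i) by [].
(* Descending through the expression builds the convolution sum as an existential; its summands are
   then compared with those of the statement. *)
by apply: vecE; rewrite vpcE vec_sumE /lieb /dot /div !gcE; (apply: etrans;
  [ repeat lazymatch goal with
    | |- pc (_ * _) _ = _ => eapply cM
    | |- pc (_ + _) _ = _ => eapply cD
    | |- pc (- _) _ = _ => eapply cN
    | |- pc (dd _ _ _) _ = _ => eapply cd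
    end
  | apply: eq_bigr => i _; rewrite !gcE !vpcE ]).
Qed.

Lemma vpc_grad f n : vpc (grad lift3 f) n = grad D (pc f n). Proof. by []. Qed.

Definition vvanish n v := forall k, (k < n)%N -> vpc v k = 0.

Lemma pc_vfield_vanish n x f : vvanish n x ->
  pc (vfield lift3 x f) n = vfield D (vpc x n) (pc f 0%N).
Proof.
move=> hx; rewrite pc_vfield big_ord_recr /= subnn big1 ?add0r // => i _.
by rewrite hx // /vfield /dot !vcE; ring.
Qed.

Lemma vvanishE n v : vvanish n v <-> [/\ vanish n (vx v), vanish n (vy v) & vanish n (vz v)].
Proof.
split=> [h|[hx hy hz] k hk]; last by apply: vecE; rewrite vpcE ?hx ?hy ?hz.
split=> k hk.
- exact: (congr1 (@vx _) (h k hk)).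
- exact: (congr1 (@vy _) (h k hk)).
- exact: (congr1 (@vz _) (h k hk)).
Qed.

End Lift.

(** * Exponentials of vector fields *)

(** Common to functions and bivectors. Telescoping gives op y a - op x b = op y (a - b) + op (y - x)
    b. From the second iterate on, the difference has order above n, so only the linear term is felt
    at order n. *)
Lemma iter_perturb (X V : zmodType) (vanX : nat -> X -> Prop) (van : nat -> V -> Prop)
    (op : X -> V -> V)
    (opBl : forall x y v, op (x - y) v = op x v - op y v)
    (opBr : forall x v w, op x (v - w) = op x v - op x w)
    (vanD : forall n v w, van n v -> van n w -> van n (v + w))
    (van0 : forall v, van 0%N v)
    (vanM : forall m n x v, vanX m x -> van n v -> van (m + n)%N (op x v))
    n x y v (hx : vanX 1%N x) (hy : vanX 1%N y) (hxy : vanX n (y - x)) k :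
  van k (iter k (op x) v) /\ van (n + k)%N (iter k.+1 (op y) v - iter k.+1 (op x) v).
Proof.
elim: k => [|k [IH1 IH2]].
  by split => //=; rewrite -opBl; apply: vanM.
have h1 : van k.+1 (iter k.+1 (op x) v) by rewrite iterS -add1n; apply: vanM.
split => //; rewrite iterS [iter k.+2 (op x) v]iterS.
have -> : op y (iter k.+1 (op y) v) - op x (iter k.+1 (op x) v) =
    op y (iter k.+1 (op y) v - iter k.+1 (op x) v) + op (y - x) (iter k.+1 (op x) v).
  by rewrite opBl opBr addrA subrK.
apply: vanD; last exact: vanM.
by rewrite addnS -add1n; apply: vanM.
Qed.

Section Exponential.
Variables (A : comNzRingType) (D : diff3 A) (fi : nat -> A).
Hypothesis fiE : forall k, fi k * k`!%:R = 1.
Local Notation R := (pser A).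
Local Notation S := (pser R).
Local Notation DR := (lift3 D).
Local Notation DS := (lift3 DR).
Implicit Types (f g : R) (F G : S) (x y : vec R) (B : vec R).

Lemma fi0 : fi 0%N = 1. Proof. by have := fiE 0; rewrite mulr1. Qed.

Lemma fiS k : k.+1%:R * fi k.+1 = fi k.
Proof.
transitivity (fi k * k`!%:R * (k.+1%:R * fi k.+1)); first by rewrite fiE mul1r.
transitivity (fi k * (fi k.+1 * k.+1`!%:R)); last by rewrite fiE mulr1.
by rewrite factS natrM; ring.
Qed.

Lemma natr_cancel k (a b : A) : k.+1%:R * a = k.+1%:R * b -> a = b.
Proof.
move=> h; have e c : c = fi k.+1 * k`!%:R * (k.+1%:R * c).
  transitivity (fi k.+1 * k.+1`!%:R * c); first by rewrite fiE mul1r.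
  by rewrite factS natrM; ring.
by rewrite [a]e h -e.
Qed.

Lemma dd_fi i k : dd D i (fi k) = 0.
Proof.
have e c : c = fi k * (k`!%:R * c) by rewrite mulrA fiE mul1r.
rewrite [LHS]e; have <- : dd D i (fi k * k`!%:R) = k`!%:R * dd D i (fi k).
  by rewrite ddM dd_natr; ring.
by rewrite fiE dd1 mulr0.
Qed.

Lemma dd_cst (E : diff3 A) i a : dd (lift3 E) i (cst a) = cst (dd E i a).
Proof. by apply: pserP => n; rewrite pc_dd /=; case: eqP => // _; rewrite dd0. Qed.

Lemma cst0 (T : comNzRingType) : cst (0 : T) = 0.
Proof. by apply: pserP => n /=; case: eqP. Qed.

Definition cstv x : vec S := (cst (vx x), cst (vy x), cst (vz x)).

Lemma pc_vfield_cst x F k : pc (vfield DS (cstv x) F) k = vfield DR x (pc F k).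
Proof. by rewrite /vfield /dot !pcD !gradE !pc_cstM. Qed.

Lemma vpc_lieb_cst x (B : vec S) k : vpc (lieb DS (cstv x) B) k = lieb DR x (vpc B k).
Proof.
rewrite vpc_lieb big_ord_recl subn0 big1 ?addr0 => [|i _].
  by congr (lieb _ _ _); apply: vecE.
rewrite (_ : vpc (cstv x) _ = 0) ?lieb0l //.
Qed.

(** The flow exp(t x) f as a series in t, the outer variable. The extra time allows identities to be
    proved by uniqueness for a differential equation before setting t = 1. *)
Definition tflow x f : S := Pser (fun k => cst (fi k) * iter k (vfield DR x) f).
Definition tflowB x B : vec S :=
  vpser (fun k => smul (cst (fi k)) (iter k (lieb DR x) B)).

Lemma dd_cst_fi i k : dd DR i (cst (fi k)) = 0.
Proof. by rewrite dd_cst dd_fi cst0. Qed.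

Lemma cst_fiS k : k.+1%:R * cst (fi k.+1) = cst (fi k).
Proof. by apply: pserP => n; rewrite pc_natM /=; case: eqP => _; rewrite ?fiS ?mulr0. Qed.

Lemma tder_tflow x f : tder (tflow x f) = vfield DS (cstv x) (tflow x f).
Proof.
apply: pserP => k; rewrite pc_vfield_cst /= vfieldM (@vfield_const _ _ _ (cst (fi k))) ?mul0r ?add0r.
  by rewrite mulrA cst_fiS.
by move=> i; apply: dd_cst_fi.
Qed.

Definition vtder (v : vec S) : vec S := (tder (vx v), tder (vy v), tder (vz v)).

Lemma vtder_tflowB x B : vtder (tflowB x B) = lieb DS (cstv x) (tflowB x B).
Proof.
apply: vpc_inj => k; rewrite vpc_lieb_cst vpserK lieb_smul; last by move=> i; apply: dd_cst_fi.
apply: vecE; rewrite vpcE smulE -iterS -cst_fiS -mulrA; reflexivity.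
Qed.

(** The equation determines (k + 1) times the coefficient of t^(k+1) from that of t^k. *)
Lemma flow_unique x F G : tder F = vfield DS (cstv x) F -> tder G = vfield DS (cstv x) G ->
  pc F 0%N = pc G 0%N -> F = G.
Proof.
move=> hF hG h0; apply: pserP; elim=> [|k IH]; first exact: h0.
have eF := congr1 (fun H => pc H k) hF; have eG := congr1 (fun H => pc H k) hG.
rewrite !pc_vfield_cst IH in eF eG; rewrite -eG in eF.
apply: pserP => n; apply: (@natr_cancel k); rewrite -(pc_natM _ (pc F _)) -(pc_natM _ (pc G _)).
exact: (congr1 (fun h => pc h n) eF).
Qed.

Lemma tder_dd i F : tder (dd DS i F) = dd DS i (tder F).
Proof. by apply: pserP => n; rewrite pc_dd /= !(ddM, ddD) dd_natr mul0r add0r. Qed.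

Lemma tderN F : tder (- F) = - tder F.
Proof. by apply: pserP => n; rewrite pcN /= mulrN. Qed.

Lemma cst_fi0 : cst (fi 0%N) = 1.
Proof. by apply: pserP => n; rewrite fi0 pc1 /=; case: eqP. Qed.

(* Both sides solve dF/dt = x.F with the same value at t = 0. *)
Lemma tflowM x f g : tflow x (f * g) = tflow x f * tflow x g.
Proof.
apply: (@flow_unique x); first exact: tder_tflow.
  by rewrite tderM !tder_tflow vfieldM.
by rewrite pcM0 /= cst_fi0 !mul1r.
Qed.

Lemma tder_bivec (B : vec S) F G : tder (bivec DS B F G) =
  bivec DS (vtder B) F G + bivec DS B (tder F) G + bivec DS B F (tder G).
Proof.
exact: (deriv_bivec (@tderD _) tderN (@tderM _) tder_dd B F G).
Qed.

(** Both sides solve the same flow equation; on the right, the time derivatives of the three factors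
    add up by [bivec_lieb]. *)
Lemma tflow_bivec x B f g :
  tflow x (bivec DR B f g) = bivec DS (tflowB x B) (tflow x f) (tflow x g).
Proof.
apply: (@flow_unique x); first exact: tder_tflow.
  rewrite tder_bivec.
  by rewrite vtder_tflowB !tder_tflow bivec_lieb; ring.
have eB : vpc (tflowB x B) 0%N = B by rewrite vpserK cst_fi0; apply: vecE; rewrite smulE mul1r.
have ef h : pc (tflow x h) 0%N = h by rewrite /= cst_fi0 mul1r.
rewrite ef /bivec /dot !gcE !(pcD, pcN, pcM0) !pc_dd !ef -!vpcE eB.
by [].
Qed.

Definition evv (B : vec S) : vec R := (ev (vx B), ev (vy B), ev (vz B)).
Definition expf x f := ev (tflow x f).
Definition expB x B := evv (tflowB x B).

Lemma ev_dd i F : ev (dd DS i F) = dd DR i (ev F).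
Proof. by apply: pserP => n; rewrite pc_dd /= dd_sum. Qed.

Lemma rees_dd i F : rees F -> rees (dd DS i F).
Proof. by move=> h k n hn; rewrite !pc_dd h ?dd0. Qed.

Lemma vanish_vfield m n x f : vvanish m x -> vanish n f -> vanish (m + n) (vfield DR x f).
Proof.
move=> /vvanishE [hx hy hz] hf; have hd i : vanish n (dd DR i f).
  by move=> k hk; rewrite pc_dd hf ?dd0.
by rewrite /vfield /dot !gradE; do 2?[apply: vanishD]; apply: vanishM.
Qed.

Lemma vvanish_lieb m n x B : vvanish m x -> vvanish n B -> vvanish (m + n) (lieb DR x B).
Proof.
move=> hx hB k hk; rewrite vpc_lieb big1 // => i _; case: (ltnP i m) => h.
  by rewrite hx ?lieb0l.
by rewrite [vpc B _]hB ?lieb0r //; have := ltn_ord i; lia.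
Qed.

Lemma vanish_iter x k f : vvanish 1 x -> vanish k (iter k (vfield DR x) f).
Proof. by move=> hx; elim: k => // k IH; rewrite iterS -add1n; apply: vanish_vfield. Qed.

Lemma vvanish_iter x k B : vvanish 1 x -> vvanish k (iter k (lieb DR x) B).
Proof. by move=> hx; elim: k => // k IH; rewrite iterS -add1n; apply: vvanish_lieb. Qed.

Lemma rees_tflow x f : vvanish 1 x -> rees (tflow x f).
Proof.
by move=> hx k; rewrite /tflow /= mulrC; apply: vanishMl; apply: vanish_iter.
Qed.

Lemma rees_tflowB x B : vvanish 1 x ->
  [/\ rees (vx (tflowB x B)), rees (vy (tflowB x B)) & rees (vz (tflowB x B))].
Proof.
by move=> hx; split=> k; have /vvanishE [h1 h2 h3] := @vvanish_iter x k B hx;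
  rewrite -vpcE vpserK smulE mulrC;
  apply: vanishMl.
Qed.

Lemma expfM x f g : vvanish 1 x -> expf x (f * g) = expf x f * expf x g.
Proof. by move=> hx; rewrite /expf tflowM evM //; apply: rees_tflow. Qed.

Lemma expf_bivec x B f g : vvanish 1 x ->
  bivec DR (expB x B) (expf x f) (expf x g) = expf x (bivec DR B f g).
Proof.
move=> hx; rewrite /expf tflow_bivec; have [h1 h2 h3] := rees_tflowB B hx.
have hd h i : rees (dd DS i (tflow x h)) by apply: rees_dd; apply: rees_tflow.
rewrite /bivec /dot !gcE !evD !evM ?evD ?evN ?evM ?ev_dd //;
  by repeat first [apply: reesM => // | apply: reesD | apply: reesN].
Qed.

Lemma pc_expf x f n : pc (expf x f) n = \sum_(k < n.+1) fi k * pc (iter k (vfield DR x) f) n.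
Proof. by apply: eq_bigr => k _; apply: pc_cstM. Qed.

Lemma vpc_expB x B n : vpc (expB x B) n =
  \sum_(k < n.+1) smul (fi k) (vpc (iter k (lieb DR x) B) n).
Proof.
by apply: vecE; rewrite vpcE vec_sumE; apply: eq_bigr => k _;
  rewrite -(vpcE (tflowB x B)) vpserK !smulE vpcE pc_cstM.
Qed.

Lemma iter_vfieldD x k f g :
  iter k (vfield DR x) (f + g) = iter k (vfield DR x) f + iter k (vfield DR x) g.
Proof. by elim: k => //= k ->; rewrite vfieldD. Qed.

Lemma expfD x f g : expf x (f + g) = expf x f + expf x g.
Proof.
apply: pserP => n; rewrite pcD !pc_expf -big_split; apply: eq_bigr => k _.
by rewrite iter_vfieldD pcD mulrDr.
Qed.

Lemma expf_const x c : (forall i, dd DR i c = 0) -> expf x c = c.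
Proof.
move=> h; have Z k : iter k.+1 (vfield DR x) c = 0.
  elim: k => [|k IH]; first exact: vfield_const.
  by rewrite iterS IH vfield_const // => j; rewrite dd0.
apply: pserP => n; rewrite pc_expf big_ord_recl fi0 mul1r big1 ?addr0 // => i _.
by rewrite -[iter _ _ _]/(iter i.+1 (vfield DR x) c) Z mulr0.
Qed.

Lemma expf_id x f : vanish 1 (expf x f - f).
Proof.
case=> // _; rewrite pcB pc_expf big_ord_recl big_ord0 fi0 mul1r addr0 /=.
by rewrite subrr.
Qed.

Lemma vvanishD n (v w : vec R) : vvanish n v -> vvanish n w -> vvanish n (v + w).
Proof. by move=> h h' k hk; rewrite vpcD h ?h' ?addr0. Qed.

(** With [d k] the difference of the k-th iterates, [d 0] is 0, [d 1] is linear in [y - x], and the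
    later ones start beyond order [n]. *)
Lemma pc_expf_perturb n x y f : vvanish 1 x -> vvanish 1 y -> vvanish n (y - x) ->
  (forall j, (j < n)%N -> pc (expf y f) j = pc (expf x f) j) /\
  ((0 < n)%N -> pc (expf y f) n = pc (expf x f) n + vfield D (vpc (y - x) n) (pc f 0%N)).
Proof.
move=> hx hy hxy.
have H k : vanish (n + k) (iter k.+1 (vfield DR y) f - iter k.+1 (vfield DR x) f).
  apply: (iter_perturb (vanX := @vvanish A) (van := @vanish A) _ _ _ _ _ _ hx hy hxy k).2 => //.
  - by move=> *; rewrite vfieldDl vfieldNl.
  - by move=> *; rewrite vfieldD vfieldN.
  - by move=> *; apply: vanishD.
  - by move=> *; apply: vanish_vfield.
pose d k := iter k (vfield DR y) f - iter k (vfield DR x) f.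
have dE j : pc (expf y f) j - pc (expf x f) j = \sum_(k < j.+1) fi k * pc (d k) j.
  rewrite (pc_expf y f) (pc_expf x f); apply: etrans (esym (sumrB _ _ _ _)) _.
  by apply: eq_bigr => k _; rewrite -mulrBr.
have d0 j : pc (d 0%N) j = 0 by rewrite /d /= subrr.
split=> [j hj|hn]; apply/eqP; rewrite -subr_eq0.
  rewrite dE big1 // => -[[|k] hk] _; first by rewrite [pc (d _) _]d0 mulr0.
  by rewrite [pc _ _]H ?mulr0 //; lia.
rewrite opprD addrA dE; case: n hn hxy H => // n _ hxy H.
rewrite big_ord_recl [pc (d _) _]d0 mulr0 add0r big_ord_recl big1 ?addr0 => [|i _]; last first.
  by rewrite [pc _ _]H ?mulr0 //= /bump /=; lia.
have -> : fi 1%N = 1 by have := fiS 0; rewrite mul1r fi0.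
have d1 : d 1%N = vfield DR (y - x) f by rewrite vfieldDl vfieldNl.
by rewrite mul1r -[d _]/(d 1%N) d1 pc_vfield_vanish // subrr.
Qed.

(** The same argument for bivectors; it allows the n-th coefficient of the field to be chosen after
    the earlier ones. *)
Lemma vpc_expB_perturb n x y B : vvanish 1 x -> vvanish 1 y -> vvanish n (y - x) ->
  (forall j, (j < n)%N -> vpc (expB y B) j = vpc (expB x B) j) /\
  ((0 < n)%N -> vpc (expB y B) n = vpc (expB x B) n + lieb D (vpc (y - x) n) (vpc B 0%N)).
Proof.
move=> hx hy hxy.
have H k : vvanish (n + k) (iter k.+1 (lieb DR y) B - iter k.+1 (lieb DR x) B).
  apply: (iter_perturb (vanX := @vvanish A) (van := @vvanish A) _ _ _ _ _ _ hx hy hxy k).2 => //.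
  - by move=> *; rewrite liebDl liebNl.
  - by move=> *; rewrite liebDr liebNr.
  - by move=> *; apply: vvanishD.
  - by move=> *; apply: vvanish_lieb.
have sB a (v v' : vec A) : smul a v - smul a v' = smul a (v - v').
  by apply: vecE; rewrite !vcE; ring.
have s0 a : smul a (0 : vec A) = 0 by apply: vecE; rewrite !vcE mulr0.
pose d k := iter k (lieb DR y) B - iter k (lieb DR x) B.
have dE j : vpc (expB y B) j - vpc (expB x B) j = \sum_(k < j.+1) smul (fi k) (vpc (d k) j).
  apply: etrans (congr2 (fun a b => a - b) (vpc_expB y B j) (vpc_expB x B j)) _.
  apply: etrans (esym (sumrB _ _ _ _)) _.
  by apply: eq_bigr => k _; exact: sB.
have d0 j : vpc (d 0%N) j = 0 by rewrite /d /= subrr.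
split=> [j hj|hn]; apply/eqP; rewrite -subr_eq0.
  rewrite dE big1 // => -[[|k] hk] _; first by rewrite [vpc (d _) _]d0 s0.
  by rewrite [vpc _ _]H ?s0 //; lia.
rewrite opprD addrA dE; case: n hn hxy H => // n _ hxy H.
rewrite big_ord_recl [vpc (d _) _]d0 s0 add0r big_ord_recl big1 ?addr0 => [|i _]; last first.
  by rewrite [vpc _ _]H ?s0 //= /bump /=; lia.
have -> : fi 1%N = 1 by have := fiS 0; rewrite mul1r fi0.
have d1 : d 1%N = lieb DR (y - x) B by rewrite liebDl liebNl.
have e1 : vpc (d 1%N) n.+1 = lieb D (vpc (y - x) n.+1) (vpc B 0%N).
  rewrite d1 vpc_lieb big_ord_recr /= subnn big1 ?add0r // => i _.
  by rewrite hxy // lieb0l.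
by rewrite -[d _]/(d 1%N) e1 subr_eq0; apply/eqP; apply: vecE; rewrite smulE mul1r.
Qed.

End Exponential.

(** * Gauge equivalence through automorphisms of A[[nu]] *)

(** Successive approximation: [P n] only looks at the terms up to n, and a partial sequence is
    padded with [t0], so that the new term can be compared with a zero one. *)
Lemma sequence_build (T : Type) (t0 : T) (P : nat -> (nat -> T) -> Prop) :
  (forall n s s', (forall i, (i <= n)%N -> s i = s' i) -> P n s -> P n s') ->
  (forall n s, (forall i, (n <= i)%N -> s i = t0) -> (forall i, (i < n)%N -> P i s) ->
     exists t, P n (fun i => if i == n then t else s i)) ->
  exists s, forall n, P n s.
Proof.
move=> compat step.
(* The conditions go under the existential so that the choice is total; where they fail, any term
   will do. *)
have /boolp.choice [F hF] : forall ns : nat * (nat -> T), exists t,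
    (forall i, (ns.1 <= i)%N -> ns.2 i = t0) -> (forall i, (i < ns.1)%N -> P i ns.2) ->
    P ns.1 (fun i => if i == ns.1 then t else ns.2 i).
  move=> [n s] /=; have [h|h] := boolp.EM ((forall i, (n <= i)%N -> s i = t0) /\
      (forall i, (i < n)%N -> P i s)).
    by have [t ht] := step n s h.1 h.2; exists t.
  by exists t0 => h1 h2; case: h.
pose fix S n : nat -> T := if n is m.+1 then
  (fun i => if i == m then F (m, S m) else S m i) else (fun=> t0).
have tail n i : (n <= i)%N -> S n i = t0.
  elim: n i => // n IH i hi /=; case: eqP => [e|_]; first by rewrite e ltnn in hi.
  by apply: IH; apply: ltnW.
have stable n m i : (i < n)%N -> (n <= m)%N -> S m i = S n i.
  move=> hi; elim: m => [|m IH]; first by rewrite leqn0 => /eqP ->.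
  rewrite leq_eqVlt => /orP [/eqP -> //|]; rewrite ltnS => le /=.
  by case: eqP => [e|_]; [move: hi le; rewrite e; lia | apply: IH].
have good n : forall i, (i < n)%N -> P i (S n).
  elim: n => // n IH i; rewrite ltnS leq_eqVlt => /orP [/eqP ->|hi].
    by apply: (hF (n, S n)) => //=; apply: tail.
  apply: compat (IH i hi) => j hj /=; case: eqP => // e.
  by move: hi hj; rewrite e; lia.
exists (fun n => S n.+1 n) => n; apply: compat (good n.+1 n _) => // i hi.
by apply: stable.
Qed.

Section Gauge.
Variables (K : fieldType) (charK : [pchar K] =i pred0).
Local Notation A := (poly3 K).
Local Notation D := (pder K).
Local Notation R := (pser A).
Local Notation DR := (lift3 D).

Definition invfact k : A := ((k`!)%:R^-1)%:MP.

Lemma invfactE k : invfact k * k`!%:R = 1.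
Proof.
rewrite -mpolyC_nat -mpolyCM mulVf ?mpolyC1 //.
by have := fact_gt0 k; case: (k`!) => // n _; apply: natr_neq0.
Qed.

Local Notation expf := (expf D invfact).
Local Notation expB := (expB D invfact).
Implicit Types (f g h : R) (x y : vec R) (B C : vec R) (n : nat).

(** Elements killed by all derivations form K[[nu]], so [autC] gives linearity over K[[nu]].
    Bijectivity follows from [aut1] and is proved in [aut_inv]. *)
Record automorphism (Phi : R -> R) : Prop := Automorphism {
  autD : forall f g, Phi (f + g) = Phi f + Phi g;
  autM : forall f g, Phi (f * g) = Phi f * Phi g;
  autC : forall c, (forall i, dd DR i c = 0) -> Phi c = c;
  aut1 : forall f, vanish 1 (Phi f - f) }.

Lemma aut_exp x : vvanish 1 x -> automorphism (expf x).
Proof.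
move=> hx; split=> [f g|f g|c|f].
- exact: expfD.
- exact: (@expfM _ D _ invfactE x f g hx).
- exact: (expf_const invfactE).
- exact: (expf_id _ invfactE).
Qed.

Lemma aut_id : automorphism id.
Proof. by split => // f; rewrite subrr. Qed.

Lemma aut_comp Phi Psi : automorphism Phi -> automorphism Psi -> automorphism (Phi \o Psi).
Proof.
move=> h h'; split=> [f g|f g|c hc|f] /=.
- by rewrite (autD h') (autD h).
- by rewrite (autM h') (autM h).
- by rewrite (autC h') ?(autC h).
- rewrite -[_ - f](subrKA (Psi f)); apply: vanishD; first exact: aut1.
  exact: aut1.
Qed.

Lemma dd_nu i : dd DR i (nu _) = 0.
Proof.
apply: pserP => n; rewrite pc_dd /=; case: eqP => _; first exact: dd1.
exact: dd0.
Qed.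

Lemma autB Phi f g : automorphism Phi -> Phi (f - g) = Phi f - Phi g.
Proof.
move=> h; have e k : Phi (- k) = - Phi k.
  apply: (addrI (Phi k)); rewrite -(autD h) !subrr; apply: (autC h) => i; exact: dd0.
by rewrite (autD h) e.
Qed.

Lemma pc_aut0 Phi f : automorphism Phi -> pc (Phi f) 0%N = pc f 0%N.
Proof. by move=> h; apply/eqP; rewrite -subr_eq0 -pcB (aut1 h). Qed.

Lemma aut_nuM Phi f : automorphism Phi -> Phi (nu _ * f) = nu _ * Phi f.
Proof. by move=> h; rewrite (autM h) (autC h) //; apply: dd_nu. Qed.

(** The difference with the field of the values on the variables is a derivation that kills
    constants and variables, hence all monomials. *)
Lemma derivation_vfield (t : A -> A) : (forall p q, t (p + q) = t p + t q) ->
  (forall p q, t (p * q) = t p * q + p * t q) -> (forall c, t c%:MP = 0) ->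
  exists v, forall p, t p = vfield D v p.
Proof.
move=> tD tM tC; pose v : vec A := (t 'X_ix, t 'X_iy, t 'X_iz); exists v.
pose s p := t p - vfield D v p.
have sD p q : s (p + q) = s p + s q by rewrite /s tD vfieldD; ring.
have sM p q : s (p * q) = s p * q + p * s q by rewrite /s tM vfieldM; ring.
have sC c : s c%:MP = 0.
  by rewrite /s tC vfield_const ?subrr // => i; rewrite ddpE mderivC.
have sX i : s 'X_i = 0.
  by rewrite /s /vfield /dot !gradE !ddX; case: (ord3P i) => -> /=; rewrite /v !vpE; ring.
suff s0 p : s p = 0 by move=> p; apply/eqP; rewrite -subr_eq0; apply/eqP/s0.
have sXn i k : s ('X_i ^+ k) = 0.
  by elim: k => [|k IH]; rewrite ?expr0 -?mpolyC1 ?sC // exprS sM sX IH; ring.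
rewrite [p]mpolyE; apply: (big_ind (fun q => s q = 0)) => [|p1 p2 h1 h2|m _].
- by rewrite -mpolyC0 sC.
- by rewrite sD h1 h2 addr0.
- rewrite -mul_mpolyC sM sC mul0r add0r mpolyXE_id.
  suff -> : s (\prod_(i < 3) 'X_i ^+ m i) = 0 by rewrite mulr0.
  apply: (big_ind (fun q => s q = 0)) => [|p1 p2 h1 h2|i _]; last exact: sXn.
    by rewrite -mpolyC1 sC.
  by rewrite sM h1 h2; ring.
Qed.

(** In the difference on a product, the factors not differenced may be reduced to order 0, which
    leaves the Leibniz rule. Only the constant term of f counts, since linearity over nu pushes the
    rest beyond order n. *)
Lemma aut_difference Phi Psi n : automorphism Phi -> automorphism Psi ->
  (forall f, vanish n (Phi f - Psi f)) ->
  exists v, forall f, pc (Phi f - Psi f) n = vfield D v (pc f 0%N).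
Proof.
move=> hP hQ hn.
have [|||v hv] := @derivation_vfield (fun p => pc (Phi (cst p) - Psi (cst p)) n).
- by move=> p q; rewrite cstD (autD hP) (autD hQ) !pcB !pcD; ring.
- move=> p q; rewrite cstM (autM hP) (autM hQ).
  have -> : Phi (cst p) * Phi (cst q) - Psi (cst p) * Psi (cst q) =
     (Phi (cst p) - Psi (cst p)) * Phi (cst q) + (Phi (cst q) - Psi (cst q)) * Psi (cst p).
    by ring.
  rewrite [LHS]pcD (pcM_vanish _ (hn (cst p))) (pcM_vanish _ (hn (cst q))) (pc_aut0 _ hP) (pc_aut0 _ hQ).
  by congr (_ + _); rewrite mulrC.
- move=> c; have hc i : dd DR i (cst c%:MP) = 0.
    by rewrite dd_cst ddpE mderivC cst0.
  by rewrite (autC hP) // (autC hQ) // subrr.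
exists v => f; pose c := cst (pc f 0%N); pose f' := Pser (fun n => pc f n.+1).
have e Theta : automorphism Theta -> Theta f = Theta c + nu _ * Theta f'.
  by move=> h; rewrite {1}[f]pser_cst_nu (autD h) aut_nuM.
have -> : Phi f - Psi f = Phi c - Psi c + nu _ * (Phi f' - Psi f').
  by rewrite !e //; ring.
rewrite [LHS]pcD hv -[RHS]addr0; congr (_ + _).
by case: n hn {hv} => [|n] hn; rewrite ?pcM0 ?mul0r // pc_nuM hn.
Qed.

(** With two automorphisms the same construction yields logarithms ([Phi] the identity) and left
    inverses ([Theta] the identity). *)
Lemma aut_log Phi Theta : automorphism Phi -> automorphism Theta ->
  exists x, vvanish 1 x /\ forall f, expf x (Phi f) = Theta f.
Proof.
move=> hP hT.
pose Q n (s : nat -> vec A) := s 0%N = 0 /\ forall f, pc (expf (vpser s) (Phi f)) n = pc (Theta f) n.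
have van (s : nat -> vec A) : s 0%N = 0 -> vvanish 1 (vpser s) by move=> s0 [|//] _; rewrite vpserK.
have [|n s hs hQ|s hs] := @sequence_build _ (0 : vec A) Q.
- move=> n s s' h [s0 H]; have s0' : s' 0%N = 0 by rewrite -h.
  split; first exact: s0'.
  move=> f; rewrite -H.
  have dv : vvanish n.+1 (vpser s' - vpser s).
    by move=> k hk; rewrite vpcD vpcN !vpserK h ?subrr.
  exact: (pc_expf_perturb D invfactE (Phi f) (van _ s0) (van _ s0') dv).1.
- case: n hs hQ => [|n] hs hQ.
    exists 0; split; first by [].
    move=> f; have e0 : vvanish 1 (vpser (fun i => if i == 0%N then 0 else s i : vec A)).
      exact: van.
    by rewrite (pc_aut0 _ (aut_exp e0)) !pc_aut0.
  have s0 : s 0%N = 0 by case: (hQ 0%N).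
  have hX := aut_exp (van _ s0).
  (* Both sides agree through order n, so they differ by a field at order n + 1; this field becomes
     the next coefficient of the exponent. *)
  have [|v hv] := @aut_difference Theta (expf (vpser s) \o Phi) n.+1 hT (aut_comp hX hP).
    by move=> f k hk; rewrite pcB -[(_ \o _) f]/(expf (vpser s) (Phi f)) (hQ k hk).2 subrr.
  exists v; split; first exact: s0.
  move=> f; set s' := fun i => _.
  have dv : vvanish n.+1 (vpser s' - vpser s).
    move=> k hk; rewrite vpcD vpcN !vpserK /s'.
    by case: eqP hk => [->|_ _]; rewrite ?ltnn ?subrr.
  rewrite ((pc_expf_perturb D invfactE (Phi f) (van _ s0) (van s' s0) dv).2 isT).
  rewrite vpcD vpcN !vpserK /s' eqxx hs // subr0 (pc_aut0 _ hP) -hv pcB.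
  by rewrite addrC subrK.
exists (vpser s); split; first exact: van (hs 0%N).1.
by move=> f; apply: pserP => n; apply: (hs n).2.
Qed.

Lemma aut_inv Phi : automorphism Phi ->
  exists Psi, [/\ automorphism Psi, cancel Phi Psi & cancel Psi Phi].
Proof.
move=> hP; have [x [hx e]] := aut_log hP aut_id; have hX := aut_exp hx.
exists (expf x); split; [exact: hX | exact: e | move=> f].
(* The left inverse is also a right inverse: it kills [Phi (expf x f) - f], and it preserves leading
   coefficients, hence is injective. *)
apply/eqP; rewrite -subr_eq0; apply/eqP.
set g := Phi _ - f; apply: vanishP => n hn; rewrite -(pc0 _ n).
have [h [eg <-]] := vanishE hn; have eX : expf x g = 0.
  by rewrite /g (autB _ _ hX) e subrr.
have ec : expf x (nu _ ^+ n * h) = nu _ ^+ n * expf x h.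
  elim: (n) => [|k IH]; first by rewrite expr0 !mul1r.
  by rewrite exprS -(mulrA (nu _)) (aut_nuM _ hX) IH mulrA.
rewrite eg ec in eX; have := congr1 (fun f => pc f n) eX.
rewrite pcM_vanish; last exact: vanish_exp.
by rewrite pc_nuX mul1r (pc_aut0 _ hX).
Qed.

Definition intertwines (Phi : R -> R) B C :=
  forall f g, bivec DR C (Phi f) (Phi g) = Phi (bivec DR B f g).

(** The components of a leading coefficient are its brackets on coordinates, and any lifts of the
    coordinates may be used. *)
Lemma vpc_eq0 n B (F G : 'I_3 -> R) : vvanish n B -> (forall i, pc (F i) 0%N = 'X_i) ->
  (forall i j, pc (bivec DR B (F i) (F j)) n = 0) -> vpc B n = 0.
Proof.
move=> hB hF H; have /vvanishE [h1 h2 h3] := hB.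
have E i j : 0 = bivec D (vpc B n) 'X_i 'X_j.
  rewrite -(H i j) /bivec /dot !gcE !pcD !pcM_vanish // !(pcN, pcD, pcM0) !pc_dd !hF.
  by rewrite !vpcE.
apply: vecE; [rewrite [RHS](E iy iz) | rewrite [RHS](E iz ix) | rewrite [RHS](E ix iy)];
  by rewrite /bivec /dot !gcE !ddX /=; ring.
Qed.

Lemma intertwines_unique Phi B C C' : automorphism Phi ->
  intertwines Phi B C -> intertwines Phi B C' -> C = C'.
Proof.
move=> hP h h'; apply/eqP; rewrite -subr_eq0; apply/eqP; apply: vpc_inj.
apply: ltn_ind => n IH; apply: (@vpc_eq0 _ _ (fun i => Phi (cst 'X_i)) (fun i => Phi (cst 'X_i))).
- by move=> k hk; rewrite IH.
- by move=> i; rewrite (pc_aut0 _ hP).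
move=> i j; have -> : bivec DR (C - C') (Phi (cst 'X_i)) (Phi (cst 'X_j)) =
    bivec DR C (Phi (cst 'X_i)) (Phi (cst 'X_j)) - bivec DR C' (Phi (cst 'X_i)) (Phi (cst 'X_j)).
  by rewrite /bivec /dot !vcE; ring.
by rewrite h h' subrr.
Qed.

Lemma expB_intertwines x B : vvanish 1 x -> intertwines (expf x) B (expB x B).
Proof. by move=> hx f g; exact: (@expf_bivec _ D _ invfactE x B f g hx). Qed.

(** Write [Phi] as an exponential; the transported bivector is unique because [Phi] lifts the
    coordinates. *)
Lemma intertwines_expB Phi B C : automorphism Phi -> intertwines Phi B C ->
  exists x, vvanish 1 x /\ C = expB x B.
Proof.
move=> hP h; have [x [hx e]] := aut_log aut_id hP; exists x; split=> //.
apply: (intertwines_unique hP h) => f g; rewrite -!e.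
exact: expB_intertwines.
Qed.

Lemma intertwines_comp Phi Psi B C C' :
  intertwines Phi B C -> intertwines Psi C C' -> intertwines (Psi \o Phi) B C'.
Proof. by move=> h h' f g /=; rewrite h' h. Qed.

Lemma intertwines_inv Phi Psi B C : cancel Phi Psi -> cancel Psi Phi ->
  intertwines Phi B C -> intertwines Psi C B.
Proof. by move=> c1 c2 h f g; apply: (can_inj c1); rewrite -h !c2. Qed.

(** The Jacobi identity is transported from B to C on the image of Phi. Images of the coordinates
    have determinant 1 at order 0, so the leading coefficient of [jacb DR C] vanishes. The
    cancellations with index 1 divide by 2. *)
Lemma intertwines_jacb Phi B C : automorphism Phi -> intertwines Phi B C ->
  jacb DR B = 0 -> jacb DR C = 0.
Proof.
move=> hP h jB; have J0 f g k : bivec DR B (bivec DR B f g) k +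
   bivec DR B (bivec DR B g k) f + bivec DR B (bivec DR B k f) g = 0.
  set s := LHS; have e := jacobiator DR B B f g k; rewrite -/s -/(jacb DR B) jB in e.
  apply: pserP => n; apply: (@natr_cancel _ _ invfactE 1); rewrite -(pc_natM _ s).
  by rewrite mulr_natl mulr2n e mulr0 addr0 mul0r.
have JC f g k : (jacb DR C + jacb DR C) *
    dot (grad DR (Phi f)) (cross (grad DR (Phi g)) (grad DR (Phi k))) = 0.
  rewrite -jacobiator !h -!(autD hP) J0 addr0 (autC hP) // => i.
  exact: dd0.
apply: vanishP => n hn; have := congr1 (fun f => pc f n) (JC (cst 'X_ix) (cst 'X_iy) (cst 'X_iz)).
rewrite pcM_vanish; last exact: vanishD.
rewrite /dot !gcE !(pcD, pcN, pcM0) !pc_dd !(pc_aut0 _ hP) /= !ddX /= => e.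
apply: (@natr_cancel _ _ invfactE 1); rewrite mulr0 -[RHS]e; ring.
Qed.

End Gauge.

(** * Multiderivations and the Schouten bracket in coordinates *)

Section Multiderivations.
Variables (K : fieldType) (charK : [pchar K] =i pred0).
Local Notation A := (poly3 K).
Local Notation D := (pder K).
Local Notation R := (pser A).
Local Notation DR := (lift3 D).
Implicit Types (p q : A) (v x B C : vec A).

Definition vf1 v : multimap K 1 := fun f => vfield D v (f ord0).
Definition bv B : multimap K 2 := fun f => bivec D B (f ord0) (f ord_max).

Lemma ord1P (i : 'I_1) : i = ord0. Proof. by case: i => -[|//] ?; apply: val_inj. Qed.
Lemma ord2P (i : 'I_2) : i = ord0 \/ i = ord_max.
Proof. by case: i => -[|[|//]] ?; [left | right]; apply: val_inj. Qed.

Lemma is_derivation_vfield v : is_derivation (vfield D v).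
Proof.
split=> [a p q|p q]; last exact: vfieldM.
by rewrite vfieldD -!mul_mpolyC vfieldM vfield_const ?mul0r ?add0r // => i; rewrite ddpE mderivC.
Qed.

Lemma is_derivationP (t : A -> A) : is_derivation t -> exists v, t =1 vfield D v.
Proof.
move=> [tL tM]; have t1 : t 1 = 0.
  by apply: (addrI (t 1)); rewrite addr0 -{3}[1]mulr1 tM mulr1 mul1r.
have t0 : t 0 = 0 by rewrite -[X in t X](mulr0 (0 : A)) tM mulr0 mul0r addr0.
apply: derivation_vfield => // [p q|c]; first by rewrite -[p]scale1r tL !scale1r.
by rewrite -alg_mpolyC -[_%:A]addr0 tL t1 t0 scaler0 addr0.
Qed.

Lemma multider1P (P : multimap K 1) : multider P -> exists v, P = vf1 v.
Proof.
move=> [hd _]; have [v hv] := is_derivationP (hd 0 ord0); exists v.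
apply: boolp.funext => f; rewrite /vf1 -hv; congr (P _).
by apply/ffunP => j; rewrite ffunE (ord1P j).
Qed.

Lemma multider_vf1 v : multider (vf1 v).
Proof.
split=> [f i|f s].
  have -> : (fun p => vf1 v [ffun j => if j == i then p else f j]) = vfield D v.
    by apply: boolp.funext => p; rewrite /vf1 ffunE (ord1P i) eqxx.
  exact: is_derivation_vfield.
have -> : s = 1%g by apply/permP => i; rewrite perm1 (ord1P (s i)) (ord1P i).
by rewrite odd_perm1 expr0 mul1r /vf1 ffunE perm1.
Qed.

Definition arg2 p q : {ffun 'I_2 -> A} := [ffun j => if j == ord0 then p else q].

Lemma arg2E (f : {ffun 'I_2 -> A}) : f = arg2 (f ord0) (f ord_max).
Proof. by apply/ffunP => j; rewrite ffunE; case: (ord2P j) => ->. Qed.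

Lemma bv_arg2 B p q : bv B (arg2 p q) = bivec D B p q.
Proof. by rewrite /bv !ffunE. Qed.

(** A derivation in each argument is determined by its values on pairs of variables; skew-symmetry
    leaves three of them, after division by 2 for the diagonal. *)
Lemma multider2P (P : multimap K 2) : multider P -> exists B, P = bv B.
Proof.
move=> [hd hs]; pose P2 p q := P (arg2 p q).
have [d1 d2] : (forall q, is_derivation (P2^~ q)) /\ (forall p, is_derivation (P2 p)).
  split=> [q|p].
    have := hd (arg2 0 q) ord0; congr is_derivation; apply: boolp.funext => p.
    by congr (P _); apply/ffunP => j; rewrite !ffunE; case: (j == ord0).
  have := hd (arg2 p 0) ord_max; congr is_derivation; apply: boolp.funext => q.
  by congr (P _); apply/ffunP => j; rewrite !ffunE; case: (ord2P j) => ->.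
have skew p q : P2 q p = - P2 p q.
  have := hs (arg2 p q) (tperm ord0 ord_max); rewrite odd_tperm /= expr1 mulN1r => <-.
  by congr (P _); apply/ffunP => j; rewrite !ffunE; case: (ord2P j) => ->; rewrite ?tpermL ?tpermR.
have Pii p : P2 p p = 0.
  apply: (@natr_cancel _ _ (invfactE charK) 1); rewrite mulr0 mulr_natl mulr2n.
  by rewrite {2}skew subrr.
have E1 p q : P2 p q = P2 'X_ix q * dd D ix p + P2 'X_iy q * dd D iy p + P2 'X_iz q * dd D iz p.
  have [v hv] := is_derivationP (d1 q).
  by rewrite !hv /vfield /dot !gradE !ddX /=; ring.
have E2 p q : P2 q p = P2 q 'X_ix * dd D ix p + P2 q 'X_iy * dd D iy p + P2 q 'X_iz * dd D iz p.
  by have [v hv] := is_derivationP (d2 q); rewrite !hv /vfield /dot !gradE !ddX /=; ring.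
exists (P2 'X_iy 'X_iz, P2 'X_iz 'X_ix, P2 'X_ix 'X_iy); apply: boolp.funext => f.
rewrite (arg2E f) bv_arg2; move: (f ord0) (f ord_max) => p q.
rewrite -/(P2 p q) E1 !(E2 q) !Pii (skew 'X_ix 'X_iy) (skew 'X_iy 'X_iz) (skew 'X_iz 'X_ix).
by rewrite /bivec /dot !gcE !vpE; ring.
Qed.

Lemma sumS2 (V : nmodType) (F : 'S_2 -> V) :
  \sum_s F s = F 1%g + F (tperm ord0 ord_max).
Proof.
transitivity (\sum_(s <- [:: 1%g; tperm ord0 ord_max]) F s); last first.
  by rewrite big_cons big_seq1.
have U : uniq [:: 1%g; tperm ord0 ord_max : 'S_2].
  rewrite /= inE andbT; apply/eqP => /(congr1 (fun s : 'S_2 => s ord0)).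
  by rewrite perm1 tpermL.
rewrite (big_uniq _ U).
apply: eq_bigl => s; rewrite !inE; apply/esym; have := ord2P (s ord0).
have inj := @perm_inj _ s; case=> e; apply/orP; [left | right]; apply/eqP/permP => i.
  case: (ord2P i) => ->; rewrite perm1 // ?e //.
  by case: (ord2P (s ord_max)) => // e'; have := inj ord0 ord_max (etrans e (esym e')).
case: (ord2P i) => ->; rewrite ?tpermL ?tpermR // ?e //.
by case: (ord2P (s ord_max)) => // e'; have := inj ord0 ord_max (etrans e (esym e')).
Qed.

Lemma multider_bv B : multider (bv B).
Proof.
split=> [f i|f s].
  case: (ord2P i) => ->.
    have -> : (fun p => bv B [ffun j => if j == ord0 then p else f j]) =
       vfield D (cross (grad D (f ord_max)) B).
      by apply: boolp.funext => p; rewrite /bv !ffunE bivecEl.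
    exact: is_derivation_vfield.
  have -> : (fun p => bv B [ffun j => if j == ord_max then p else f j]) =
       vfield D (- cross (grad D (f ord0)) B).
    by apply: boolp.funext => p; rewrite /bv !ffunE /= bivecC bivecEl vfieldNl.
  exact: is_derivation_vfield.
have /= := @sumS2 nat (fun t => (t == s) : nat); rewrite (bigD1 s) //= eqxx.
case: eqP => [<- _|_].
  by rewrite odd_perm1 expr0 mul1r /bv !ffunE !perm1.
case: eqP => [<- _|_]; last by [].
by rewrite odd_tperm /= expr1 mulN1r /bv !ffunE tpermL tpermR bivecC.
Qed.

Definition cyc3 : 'S_3 := (tperm ix iy * tperm ix iz)%g.

Lemma perm_argE n (f : {ffun 'I_n -> A}) s (i : 'I_n) : perm_arg f s i = f (s i).
Proof. by rewrite /perm_arg valK. Qed.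

Lemma perm3_val : [/\ tperm iy iz ix = ix, tperm iy iz iy = iz, tperm iy iz iz = iy &
  [/\ cyc3 ix = iy, cyc3 iy = iz & cyc3 iz = ix]].
Proof.
split; [by rewrite tpermD | by rewrite tpermL | by rewrite tpermR |].
rewrite /cyc3 !permM; split; first by rewrite tpermL tpermD.
  by rewrite tpermR tpermL.
by rewrite (@tpermD _ ix iy iz) // tpermR.
Qed.

(** A (2,1)-shuffle is determined by the image of the last index. *)
Lemma shuffleS3 (V : nmodType) (F : 'S_3 -> V) :
  \sum_(s | shuffle 2 s) F s = F 1%g + F (tperm iy iz) + F cyc3.
Proof.
have [t0 t1 t2 [c0 c1 c2]] := perm3_val.
transitivity (\sum_(s <- [:: 1%g; tperm iy iz; cyc3]) F s); last first.
  by rewrite !big_cons big_nil addr0 addrA.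
have U : uniq [:: 1%g; tperm iy iz; cyc3].
  rewrite /= !inE andbT negb_or -andbA; apply/and3P; split; apply/eqP.
  - by move=> /(congr1 (fun s : 'S_3 => s iz)); rewrite perm1 t2.
  - by move=> /(congr1 (fun s : 'S_3 => s iz)); rewrite perm1 c2.
  - by move=> /(congr1 (fun s : 'S_3 => s iz)); rewrite t2 c2.
rewrite (big_uniq _ U); have lt s : shuffle 2 s -> (s ix < s iy)%N.
  by move=> /forallP /(_ ix) /forallP /(_ iy) /implyP; apply.
have eqS (s t : 'S_3) : s ix = t ix -> s iy = t iy -> s iz = t iz -> s = t.
  by move=> e0 e1 e2; apply/permP => i; case: (ord3P i) => ->.
have inj (s : 'S_3) : [/\ s ix != s iy, s ix != s iz & s iy != s iz].
  by rewrite !(inj_eq perm_inj).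
apply: eq_bigl => s; rewrite !inE; apply/idP/idP => [/lt|].
  have := inj s; case: (ord3P (s ix)) => e0; case: (ord3P (s iy)) => e1; case: (ord3P (s iz)) => e2;
    rewrite e0 e1 e2 => -[] // _ _ _ // _; apply/or3P.
  - by apply: Or31; apply/eqP/eqS; rewrite perm1.
  - by apply: Or32; apply/eqP/eqS; rewrite ?t0 ?t1 ?t2.
  - by apply: Or33; apply/eqP/eqS; rewrite ?c0 ?c1 ?c2.
move=> h; apply/forallP => a; apply/forallP => b; apply/implyP; move: h.
by case/or3P => /eqP ->; case: (ord3P a) => ->; case: (ord3P b) => -> //=;
  rewrite ?perm1 ?t0 ?t1 ?t2 ?c0 ?c1 ?c2.
Qed.

Definition det3 (f : {ffun 'I_3 -> A}) :=
  dot (grad D (f ix)) (cross (grad D (f iy)) (grad D (f iz))).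

Lemma insertion_bv B C f : insertion (bv B) (bv C) f =
  bivec D B (bivec D C (f ix) (f iy)) (f iz) + bivec D B (bivec D C (f iy) (f iz)) (f ix) +
  bivec D B (bivec D C (f iz) (f ix)) (f iy) :> A.
Proof.
have [t0 t1 t2 [c0 c1 c2]] := perm3_val.
have E (s : 'S_3) : bv B [ffun i : 'I_2 => if i == 0%N :> nat then
      bv C [ffun j : 'I_2 => perm_arg f s j] else perm_arg f s (2 + i).-1] =
    bivec D B (bivec D C (f (s ix)) (f (s iy))) (f (s iz)).
  rewrite /bv !ffunE /= -!perm_argE; congr (bivec _ _ _ _).
rewrite /insertion shuffleS3 !E !perm1 t0 t1 t2 c0 c1 c2 odd_perm1 odd_tperm odd_permM !odd_tperm /=.
by rewrite expr0 expr1 !mul1r mulN1r (bivecC D C (f ix) (f iz)) bivecNl addrAC.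
Qed.

Lemma schouten_bv B C f : schouten (bv B) (bv C) f =
  (dot B (curl D C) + dot C (curl D B)) * det3 f.
Proof.
transitivity (insertion (bv B) (bv C) f + insertion (bv C) (bv B) f).
  by rewrite /schouten -[(-1) ^+ _]signr_odd expr1 mulN1r opprK.
by rewrite (insertion_bv B) (insertion_bv C) jacobiator.
Qed.

Lemma schouten_vf1_bv x B : schouten (vf1 x) (bv B) = bv (lieb D x B) :> multimap K 2.
Proof.
apply: boolp.funext => f; rewrite /bv bivec_lieb /schouten /=.
rewrite -[(-1) ^+ _]signr_odd /= expr0 mul1r -addrA; congr (_ + _).
  (* The field has no slot left after the insertion, so the only shuffle is the identity. *)
  rewrite /insertion (big_pred1 1%g) => [|s /=].
    rewrite odd_perm1 expr0 mul1r /vf1 /bv !ffunE /= ?ffunE.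
    by rewrite (perm_argE f 1%g ord0) (perm_argE f 1%g ord_max) !perm1.
  apply/idP/eqP => [|->]; last first.
    apply/forallP => a; apply/forallP => b; rewrite !perm1; apply/implyP.
    by move=> /orP [/andP [] //|/andP [_ //]].
  move=> /forallP /(_ ord0) /forallP /(_ ord_max) /= lt.
  apply/permP => i; rewrite perm1; move: lt.
  case: (ord2P (s ord0)) => e0; case: (ord2P (s ord_max)) => e1; rewrite e0 e1 // => _.
  by case: (ord2P i) => ->.
rewrite -opprD; congr (- _).
(* Every permutation of two indices is a (1,1)-shuffle. *)
rewrite /insertion (eq_bigl xpredT) => [|s]; last first.
  apply/forallP => a; apply/forallP => b; apply/implyP.
  by case: (ord2P a) => ->; case: (ord2P b) => ->.
rewrite sumS2 odd_perm1 odd_tperm /= expr0 expr1 mul1r mulN1r /bv /vf1 !ffunE /= ?ffunE.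
rewrite !(perm_argE f _ ord0) !(perm_argE f _ ord_max) !perm1 tpermL tpermR.
by rewrite [in X in _ + X]bivecC opprK.
Qed.

Lemma poisson_bv p : poisson p = bv (grad D p).
Proof.
by apply: boolp.funext => f; rewrite /poisson /wedge /bv /bivec /dot !gcE !ddpE; ring.
Qed.

End Multiderivations.

(** * The Maurer-Cartan equation and gauge equivalence in coordinates *)

Section Series.
Variables (K : fieldType) (charK : [pchar K] =i pred0).
Local Notation A := (poly3 K).
Local Notation D := (pder K).
Local Notation R := (pser A).
Local Notation DR := (lift3 D).
Local Notation expB := (expB D (@invfact K)).
Implicit Types (x B G : vec R) (phi : A).

Definition ser1 x : series K 1 := fun n => vf1 (vpc x n).
Definition ser2 B : series K 2 := fun n => bv (vpc B n).

Lemma bv_inj : injective (@bv K).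
Proof.
have E (B : vec A) (p q : A) : bivec D B p q = bv B (arg2 p q) by rewrite bv_arg2.
have X (B : vec A) : [/\ bivec D B 'X_iy 'X_iz = vx B, bivec D B 'X_iz 'X_ix = vy B &
    bivec D B 'X_ix 'X_iy = vz B].
  by rewrite /bivec /dot !gcE !ddX /=; split; ring.
move=> B C e; have [b1 b2 b3] := X B; have [c1 c2 c3] := X C.
by apply: vecE; [rewrite -b1 -c1 | rewrite -b2 -c2 | rewrite -b3 -c3]; rewrite !E e.
Qed.

Lemma bv0 : bv 0 = (fun=> 0) :> multimap K 2.
Proof. by apply: boolp.funext => f; rewrite /bv /bivec /dot !vcE; ring. Qed.

Lemma vf10 : vf1 0 = (fun=> 0) :> multimap K 1.
Proof. by apply: boolp.funext => f; rewrite /vf1 /vfield /dot !vcE; ring. Qed.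

Lemma ser2_inj : injective ser2.
Proof.
by move=> B C e; apply: vpc_inj => n; apply: bv_inj; exact: (congr1 (fun s => s n) e).
Qed.

Lemma nu_series1 x : vvanish 1 x -> nu_series (ser1 x).
Proof. by move=> h; split=> [|n]; [rewrite /ser1 h // vf10 | apply: multider_vf1]. Qed.

Lemma nu_series2 B : vvanish 1 B -> nu_series (ser2 B).
Proof. by move=> h; split=> [|n]; [rewrite /ser2 h // bv0 | apply: multider_bv]. Qed.

Lemma nu_series1P (s : series K 1) : nu_series s -> exists x, vvanish 1 x /\ s = ser1 x.
Proof.
move=> [s0 sd]; have /boolp.choice [v hv] := fun n => multider1P (sd n).
pose v' n := if n is 0%N then 0 else v n; exists (vpser v'); split.
  by case=> // _; rewrite vpserK.
apply: boolp.funext => n; rewrite /ser1 vpserK /v'; case: n => [|n]; last exact: hv.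
by rewrite s0 vf10.
Qed.

Lemma nu_series2P (s : series K 2) : nu_series s -> exists B, vvanish 1 B /\ s = ser2 B.
Proof.
move=> [s0 sd]; have /boolp.choice [v hv] := fun n => multider2P charK (sd n).
pose v' n := if n is 0%N then 0 else v n; exists (vpser v'); split.
  by case=> // _; rewrite vpserK.
apply: boolp.funext => n; rewrite /ser2 vpserK /v'; case: n => [|n]; last exact: hv.
by rewrite s0 bv0.
Qed.

Lemma bvD (B C : vec A) f : bv (B + C) f = bv B f + bv C f :> A.
Proof. by rewrite /bv /bivec /dot !vcE; ring. Qed.

Lemma bv_smul a (B : vec A) f : bv (smul a B) f = a * bv B f :> A.
Proof. by rewrite /bv /bivec /dot !vcE; ring. Qed.

Lemma bv_sum n (F : 'I_n -> vec A) f : bv (\sum_i F i) f = \sum_i bv (F i) f.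
Proof. by elim/big_rec2: _ => [|i a b _ <-]; rewrite ?bv0 ?bvD. Qed.

Lemma sbracket_ser x B : sbracket (ser1 x) (ser2 B) = ser2 (lieb DR x B) :> series K 2.
Proof.
apply: boolp.funext => n; apply: boolp.funext => f.
rewrite /ser2 vpc_lieb bv_sum; apply: eq_bigr => i _.
by rewrite schouten_vf1_bv.
Qed.

Lemma exp_ad_ser x B : exp_ad (ser1 x) (ser2 B) = ser2 (expB x B).
Proof.
have it k : iter k (fun Y : series K 2 => sbracket (ser1 x) Y : series K 2) (ser2 B) =
    ser2 (iter k (lieb DR x) B).
  by elim: k => [|k IH]; [| rewrite iterS IH sbracket_ser -iterS].
apply: boolp.funext => n; apply: boolp.funext => f.
rewrite /ser2 vpc_expB bv_sum; apply: eq_bigr => k _.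
by rewrite it bv_smul -mul_mpolyC.
Qed.

Definition gradc phi : vec R := grad DR (cst phi).

Lemma vpc_gradc phi n : vpc (gradc phi) n = if n is 0%N then grad D phi else 0.
Proof.
by rewrite /gradc vpc_grad; case: n => //= n; apply: vecE; rewrite gradE dd0.
Qed.

Lemma deformation_ser phi G : deformation phi (ser2 G) = ser2 (gradc phi + G).
Proof.
apply: boolp.funext => n; apply: boolp.funext => f; rewrite /deformation /ser2 vpcD bvD.
by rewrite vpc_gradc; case: n => [|n] /=; rewrite ?poisson_bv // bv0.
Qed.

Lemma pc_dot_curl B C n : pc (dot B (curl DR C)) n =
  \sum_(i < n.+1) dot (vpc B i) (curl D (vpc C (n - i))).
Proof. by rewrite /dot !pcD !pcM -!big_split. Qed.

Lemma pc_jacb_deformation phi G n : pc (jacb DR (gradc phi + G)) n =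
  dot (grad D phi) (curl D (vpc G n)) + dot (vpc G n) (curl D (grad D phi)) + pc (jacb DR G) n.
Proof.
have -> : jacb DR (gradc phi + G) = dot (gradc phi) (curl DR G) + jacb DR G.
  have jP : jacb DR (gradc phi) = 0.
    by rewrite /jacb /gradc curl_grad /dot !vcE; ring.
  have cP : dot G (curl DR (gradc phi)) = 0.
    by rewrite /gradc curl_grad /dot !vcE; ring.
  transitivity (jacb DR (gradc phi) + dot (gradc phi) (curl DR G) +
     dot G (curl DR (gradc phi)) + jacb DR G).
    by rewrite /jacb /dot !gcE !ddE; ring.
  by rewrite jP cP add0r addr0.
rewrite curl_grad (_ : dot (vpc G n) 0 = 0); last by rewrite /dot !vcE; ring.
rewrite addr0 pcD; congr (_ + _); rewrite pc_dot_curl big_ord_recl vpc_gradc subn0.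
by rewrite big1 ?addr0 // => i _; rewrite vpc_gradc /dot !vcE; ring.
Qed.

(** Because curl grad phi = 0, the Maurer-Cartan expression is [jacb] of the deformed bivector times
    the determinant of the gradients; on the coordinates this determinant is 1. *)
Lemma MC_ser phi G : vvanish 1 G ->
  MC phi (ser2 G) <-> jacb DR (gradc phi + G) = 0.
Proof.
move=> hG; have two : 2%:R^-1 != 0 :> K by rewrite invr_eq0 (natr_neq0 charK 1).
have E n f : dphi phi (ser2 G n) f + 2%:R^-1 *: sbracket (ser2 G) (ser2 G) n f =
    pc (jacb DR (gradc phi + G)) n * det3 f.
  rewrite pc_jacb_deformation mulrDl /dphi poisson_bv (schouten_bv (grad D phi)).
  congr (_ + _).
  have -> : sbracket (ser2 G) (ser2 G) n f = 2%:R *: (pc (jacb DR G) n * det3 f).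
    rewrite scaler_nat mulr2n -mulrDl /jacb pc_dot_curl.
    (* One of the two copies is summed backwards, which produces the symmetric expression of
       [schouten_bv]. *)
    rewrite {2}(reindex_inj rev_ord_inj) -big_split mulr_suml; apply: eq_bigr => i _ /=.
    rewrite schouten_bv; congr (_ * _); congr (_ + dot (vpc G _) (curl D (vpc G _))).
    by rewrite subSS subKn // -ltnS.
  by rewrite scalerA mulVf ?scale1r // (natr_neq0 charK 1).
split=> [[_ h]|h]; last first.
  by split; [apply: nu_series2 | move=> n f; rewrite E h mul0r].
have det1 : det3 [ffun i => 'X_i] = 1 :> A.
  by rewrite /det3 !ffunE /dot !gcE !ddX /=; ring.
by apply: pserP => n; have := h n [ffun i => 'X_i]; rewrite E det1 mulr1.
Qed.

Lemma gauge_ser phi G G' : gauge phi (ser2 G) (ser2 G') <->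
  exists Phi, automorphism Phi /\ intertwines Phi (gradc phi + G) (gradc phi + G').
Proof.
split=> [[s [/nu_series1P [x [hx ->]]]]|[Phi [hP /(intertwines_expB charK hP) [x [hx e]]]]].
  rewrite !deformation_ser exp_ad_ser => /ser2_inj ->.
  exists (expf D (@invfact K) x); split; first exact: aut_exp.
  exact: expB_intertwines.
exists (ser1 x); split; first exact: nu_series1.
by rewrite !deformation_ser exp_ad_ser e.
Qed.

End Series.

(** * Normal forms *)

Section NormalForms.
Variables (K : fieldType) (charK : [pchar K] =i pred0) (phi : poly3 K).
Variables (w : 'I_3 -> nat) (d : nat) (mu : nat) (u : 'I_mu -> poly3 K).
Hypothesis w_gt0 : forall i, (0 < w i)%N.
Hypothesis hphi : whomog w d phi.
Hypothesis mu_gt0 : (0 < mu)%N.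
Hypothesis u0 : forall i : 'I_mu, i = 0%N :> nat -> u i = 1.
Hypothesis hu : forall i : 'I_mu, exists e : nat, whomog w e (u i).
Hypothesis hbasis : basis_Asing phi u.
Local Notation A := (poly3 K).
Local Notation D := (pder K).
Local Notation R := (pser A).
Local Notation DR := (lift3 D).
Local Notation expB := (expB D (@invfact K)).
Local Notation expf := (expf D (@invfact K)).
Local Notation W := (total_weight w).
Local Notation P := (gradc phi).
Implicit Types (F X : R) (p q : A) (B C G Y : vec R) (n : nat).

(* With F = sum c phi^l u_i and X = sum cb u_s, this is the bivector
   {.,.}_phi + gamma^(c, cb): the normal forms factor. *)
Definition nform F X : vec R := smul (1 + F) (grad DR (cst phi + X)).

Definition Fspan p := exists N c, (forall l i, ~~ Ephi w d i -> c l i = 0) /\ p = phisum phi u N c.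
Definition Xspan p := exists cb : 'I_mu -> K, p = \sum_(s < mu | (0 < s)%N) cb s *: u s.

Lemma jacb_nform F X : jacb DR (nform F X) = 0.
Proof. exact: jacb_smul_grad. Qed.

Lemma vpc_smul_vanish n (a : R) B : vanish n a -> vpc (smul a B) n = smul (pc a n) (vpc B 0%N).
Proof. by move=> ha; apply: vecE; rewrite vpcE !smulE pcM_vanish. Qed.

Lemma vpc_smul_vvanish n (a : R) B : vvanish n B -> vpc (smul a B) n = smul (pc a 0%N) (vpc B n).
Proof.
move=> /vvanishE [h1 h2 h3].
by apply: vecE; rewrite vpcE !smulE mulrC pcM_vanish // mulrC.
Qed.

Lemma vvanish_smul n (a : R) B : vanish n a -> vvanish n (smul a B).
Proof. by move=> h; apply/vvanishE; rewrite !smulE; split; apply: vanishMl. Qed.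

Lemma vvanish_smulr n (a : R) B : vvanish n B -> vvanish n (smul a B).
Proof.
by move=> /vvanishE [? ? ?]; apply/vvanishE; rewrite !smulE ![a * _]mulrC; split; apply: vanishMl.
Qed.

Lemma vvanish_grad n F : vanish n F -> vvanish n (grad DR F).
Proof. by move=> h k hk; rewrite vpc_grad h //; apply: vecE; rewrite gradE dd0. Qed.

Lemma vpc_nform0 F X : vanish 1 F -> vanish 1 X -> vpc (nform F X) 0%N = grad D phi.
Proof.
move=> hF hX; rewrite /nform vpc_smul_vanish // vpc_grad !pcD pc1 hF // hX //.
by apply: vecE; rewrite smulE !addr0 mul1r.
Qed.

(** The linearisation of the normal form at grad phi, which is the shape of the representatives in
    [cocycle_class]. *)
Lemma nform_perturb n F X F' X' : vanish 1 F -> vanish 1 X -> vanish n (F' - F) ->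
  vanish n (X' - X) ->
  (forall j, (j < n)%N -> vpc (nform F' X') j = vpc (nform F X) j) /\
  ((0 < n)%N -> vpc (nform F' X') n =
    vpc (nform F X) n + (smul (pc F' n - pc F n) (grad D phi) + grad D (pc X' n - pc X n))).
Proof.
move=> hF hX dF dX.
have e : nform F' X' = nform F X + (smul (F' - F) (grad DR (cst phi + X')) +
    smul (1 + F) (grad DR (X' - X))).
  by rewrite /nform !gradD gradN; apply: vecE; rewrite !vcE; ring.
have v1 := @vvanish_smul n _ (grad DR (cst phi + X')) dF.
have v2 := @vvanish_smulr n (1 + F) _ (vvanish_grad dX).
rewrite e; split=> [j hj|n_gt0]; first by rewrite !vpcD v1 // v2 // !addr0.
rewrite !vpcD vpc_smul_vanish // vpc_smul_vvanish; last exact: vvanish_grad.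
congr (_ + (_ + _)).
  rewrite vpc_grad !pcD; have X0 : pc X' 0%N = 0.
    by have := dX 0%N n_gt0; rewrite pcB hX // subr0.
  by rewrite X0 addr0.
by rewrite vpc_grad !pcD hF // addr0 pc1; apply: vecE; rewrite smulE mul1r.
Qed.

Lemma pc_expB0 x B : vpc (expB x B) 0%N = vpc B 0%N.
Proof.
rewrite vpc_expB big_ord_recl big_ord0 addr0 (fi0 (invfactE charK)).
by apply: vecE; rewrite smulE mul1r.
Qed.

Lemma Fspan0 : Fspan 0.
Proof. by exists 0%N, (fun _ _ => 0); split=> //; rewrite /phisum big_ord0. Qed.

Lemma Xspan0 : Xspan 0.
Proof. by exists (fun=> 0); rewrite big1 // => i _; rewrite scale0r. Qed.

(** The difference of the two Jacobi conditions is B . curl Y + Y . curl B + Y . curl Y. At order n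
    + 1 the last term is too small and the middle one vanishes, since curl grad phi = 0. *)
Lemma cocycle_leading n B Y : jacb DR B = 0 -> jacb DR (B + Y) = 0 -> vvanish n.+1 Y ->
  vpc B 0%N = grad D phi -> dot (grad D phi) (curl D (vpc Y n.+1)) = 0.
Proof.
move=> jB jY hY B0.
have e : dot B (curl DR Y) + dot Y (curl DR B) + dot Y (curl DR Y) = 0.
  transitivity (jacb DR (B + Y) - jacb DR B); last by rewrite jY jB subrr.
  by rewrite /jacb /dot !gcE !ddE; ring.
have c0 : curl D 0 = 0 by apply: vecE; rewrite !gcE !dd0; ring.
have dot0 v : dot 0 v = 0 :> A by rewrite /dot !vcE; ring.
have dot0r v : dot v 0 = 0 :> A by rewrite /dot !vcE; ring.
have E (a b c : R) (sa sb sc : A) : a + b + c = 0 -> pc a n.+1 = sa -> pc b n.+1 = sb ->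
    pc c n.+1 = sc -> sa + sb + sc = 0.
  by move=> h <- <- <-; exact: (congr1 (fun f => pc f n.+1) h).
have := E _ _ _ _ _ _ e (pc_dot_curl _ _ _) (pc_dot_curl _ _ _) (pc_dot_curl _ _ _).
rewrite big_ord_recl B0 subn0 big1 ?addr0 => [|i _]; last first.
  by rewrite [vpc Y _]hY ?c0 ?dot0r //= /bump /=; lia.
rewrite big1 ?addr0 => [|i _]; last first.
  case: (ltnP i n.+1) => h; first by rewrite hY ?dot0.
  have -> : (n.+1 - i = 0)%N by lia.
  by rewrite B0 curl_grad dot0r.
rewrite big1 ?addr0 // => i _; case: (ltnP i n.+1) => h; first by rewrite hY ?dot0.
by rewrite [vpc Y (_ - _)]hY ?c0 ?dot0r //; lia.
Qed.

Lemma normal_form_exists G : vvanish 1 G -> jacb DR (P + G) = 0 ->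
  exists x F X, [/\ vvanish 1 x, vanish 1 F /\ vanish 1 X,
    forall n, Fspan (pc F n) /\ Xspan (pc X n) & expB x (P + G) = nform F X].
Proof.
move=> hG jG; set B := P + G.
have B0 : vpc B 0%N = grad D phi by rewrite vpcD vpc_gradc hG // addr0.
(* One sequence of triples carries the coefficients of the field and of both series, chosen together
   at each order. *)
pose T := (vec A * A * A)%type; pose t0 : T := (0, 0, 0).
pose xs (s : nat -> T) := vpser (fun n => (s n).1.1).
pose fs (s : nat -> T) := Pser (fun n => (s n).1.2).
pose hs (s : nat -> T) := Pser (fun n => (s n).2).
pose Q n (s : nat -> T) := [/\ s 0%N = t0, Fspan (s n).1.2, Xspan (s n).2 &
  vpc (expB (xs s) B) n = vpc (nform (fs s) (hs s)) n].
have vx0' s : s 0%N = t0 -> vvanish 1 (xs s) by move=> e [|//] _; rewrite vpserK e.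
have vf0 s : s 0%N = t0 -> vanish 1 (fs s) by move=> e [|//] _; rewrite /= e.
have vh0 s : s 0%N = t0 -> vanish 1 (hs s) by move=> e [|//] _; rewrite /= e.
have agree n s s' : (forall i, (i < n)%N -> s i = s' i) ->
    [/\ vvanish n (xs s' - xs s), vanish n (fs s' - fs s) & vanish n (hs s' - hs s)].
  by move=> h; split=> k hk; rewrite ?vpcD ?vpcN ?vpserK ?pcB /= h // subrr.
have [|n s tail good|s hs'] := @sequence_build _ t0 Q.
- move=> n s s' h [s0 hF hX E]; have s0' : s' 0%N = t0 by rewrite -h.
  have [a1 a2 a3] := agree n.+1 s s' h; split; [by [] | by rewrite -h | by rewrite -h |].
  rewrite ((vpc_expB_perturb D (invfactE charK) B (vx0' s s0) (vx0' s' s0') a1).1 n) //.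
  by rewrite ((nform_perturb (vf0 s s0) (vh0 s s0) a2 a3).1 n).
- case: n tail good => [|n] tail good.
    exists t0; set s' := fun i => _; have s0' : s' 0%N = t0 by [].
    split; [exact: s0' | exact: Fspan0 | exact: Xspan0 |].
    by rewrite pc_expB0 B0 (vpc_nform0 (vf0 s' s0') (vh0 s' s0')).
  have s0 : s 0%N = t0 by case: (good 0%N).
  set E := expB (xs s) B; set N := nform (fs s) (hs s).
  have vY : vvanish n.+1 (E - N).
    by move=> k hk; have [_ _ _ e] := good k hk; rewrite vpcD vpcN [vpc E k]e subrr.
  have jE : jacb DR E = 0.
    exact: (intertwines_jacb charK (aut_exp charK (vx0' s s0))
      (expB_intertwines charK B (vx0' s s0)) jG).
  have jE' : jacb DR (N + (E - N)) = 0 by rewrite addrC subrK.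
  have := cocycle_leading (jacb_nform _ _) jE' vY (vpc_nform0 (vf0 s s0) (vh0 s s0)).
  move=> /(cocycle_class charK w_gt0 hphi mu_gt0 u0 hu hbasis) [x [M [c [cb [hc e]]]]].
  (* The discrepancy of [E] and [N] is a coboundary plus a normal part: the field cancels the first
     and the normal form absorbs the second. *)
  exists (- x, phisum phi u M c, \sum_(s < mu | (0 < s)%N) cb s *: u s).
  set t := (- x, _, _); set s' := fun i => _.
  have s0' : s' 0%N = t0 by [].
  have [|a1 a2 a3] := agree n.+1 s s'.
    by move=> i hi; rewrite /s'; case: eqP hi => // ->; rewrite ltnn.
  have sn : s' n.+1 = t by rewrite /s' eqxx.
  split; [exact: s0' | by rewrite sn; exists M, c | by rewrite sn; exists cb |].
  rewrite ((vpc_expB_perturb D (invfactE charK) B (vx0' s s0) (vx0' s' s0') a1).2 isT).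
  rewrite ((nform_perturb (vf0 s s0) (vh0 s s0) a2 a3).2 isT) -/E -/N.
  have -> : vpc E n.+1 = vpc N n.+1 + vpc (E - N) n.+1.
    by rewrite vpcD vpcN addrC subrK.
  have ex : vpc (xs s' - xs s) n.+1 = - x by rewrite vpcD vpcN !vpserK sn tail // subr0.
  have ef : pc (fs s') n.+1 - pc (fs s) n.+1 = phisum phi u M c.
    by rewrite /fs /= sn tail // subr0.
  have eh : pc (hs s') n.+1 - pc (hs s) n.+1 = \sum_(s < mu | (0 < s)%N) cb s *: u s.
    by rewrite /hs /= sn tail // subr0.
  have Z (a b c' e' : vec A) : a + (b + c' + e') - b = a + (c' + e').
    by rewrite -[b + c' + e']addrA [b + _]addrC addrA addrK.
  by rewrite ex ef eh e B0 liebNl; apply: Z.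
have s0 : s 0%N = t0 by case: (hs' 0%N).
exists (xs s), (fs s), (hs s); split.
- exact: vx0'.
- by split; [apply: vf0 | apply: vh0].
- by move=> n; have [_ ? ? _] := hs' n.
- by apply: vpc_inj => n; have [_ _ _ ->] := hs' n.
Qed.

Lemma Fspan_sub p q : Fspan p -> Fspan q -> Fspan (p - q).
Proof.
move=> [N [c [hc ->]]] [N' [c' [hc' ->]]].
rewrite (phisum_widen phi u c (leq_addr N' N)) (phisum_widen phi u c' (leq_addl N N')).
rewrite -scaleN1r phisumZ phisumD; eexists; eexists; split; last by reflexivity.
by move=> l i h /=; rewrite hc // hc' // !if_same mulr0 addr0.
Qed.

Lemma Xspan_sub p q : Xspan p -> Xspan q -> Xspan (p - q).
Proof.
move=> [c ->] [c' ->]; exists (fun s => c s - c' s); rewrite -sumrB.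
by apply: eq_bigr => s _; rewrite scalerBl.
Qed.

Lemma vfield_vanish_r n (v : vec R) F : vanish n F ->
  pc (vfield DR v F) n = vfield D (vpc v 0%N) (pc F n).
Proof.
move=> hF; rewrite pc_vfield big_ord_recl subn0 big1 ?addr0 // => i _.
rewrite [pc F _]hF; last by have := ltn_ord i; rewrite /= /bump /=; lia.
by apply: vfield_const => j; rewrite dd0.
Qed.

Lemma pc_bivec_l n B (F H : R) : vanish n F ->
  pc (bivec DR B F H) n = bivec D (vpc B 0%N) (pc F n) (pc H 0%N).
Proof.
move=> hF; rewrite (bivecEl DR) (bivecEl D) vfield_vanish_r //; congr (vfield _ _ _).
by apply: vecE; rewrite vpcE !crossE !gradE !(pcD, pcN, pcM0).
Qed.

Lemma pc_bivec_r n B (F H : R) : vanish n H ->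
  pc (bivec DR B F H) n = bivec D (vpc B 0%N) (pc F 0%N) (pc H n).
Proof. by move=> hH; rewrite (bivecC DR B H) pcN pc_bivec_l // -(bivecC D). Qed.

Lemma pc_bivec_vanish n B (F H : R) : vvanish n B ->
  pc (bivec DR B F H) n = bivec D (vpc B n) (pc F 0%N) (pc H 0%N).
Proof.
move=> /vvanishE [h1 h2 h3]; rewrite /bivec.
have E (v c : vec R) : vanish n (vx v) -> vanish n (vy v) -> vanish n (vz v) ->
    pc (dot v c) n = dot (vpc v n) (vpc c 0%N).
  by move=> *; rewrite /dot !pcD !pcM_vanish.
rewrite E //; congr (dot _ _).
by apply: vecE; rewrite vpcE !crossE !gradE !(pcD, pcN, pcM0).
Qed.

Lemma bivec_sub (T : comNzRingType) (E : diff3 T) (B C : vec T) (f g f' g' : T) :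
  bivec E C f' g' - bivec E B f g =
  bivec E (C - B) f g + bivec E C (f' - f) g' + bivec E C f (g' - g).
Proof. by rewrite /bivec /dot !gcE !ddE; ring. Qed.

(** Compare the coefficients of nu^n in the intertwining relation on constant series: v applied to
    the bracket equals the bracket of [C - B] plus the two Leibniz terms, and [bivec_lieb] solves
    for [C - B]. *)
Lemma leading_cocycle n Phi v B C : automorphism Phi -> intertwines Phi B C ->
  (forall f, vanish n (Phi f - f)) -> (forall f, pc (Phi f - f) n = vfield D v (pc f 0%N)) ->
  vvanish n (C - B) -> (0 < n)%N -> vpc (C - B) n = lieb D v (vpc B 0%N).
Proof.
move=> hP h hn hv hCB n_gt0.
have C0 : vpc C 0%N = vpc B 0%N.
  by apply/eqP; rewrite -subr_eq0; apply/eqP; have := hCB 0%N n_gt0; rewrite vpcD vpcN.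
suff E p q : bivec D (vpc (C - B) n) p q = bivec D (lieb D v (vpc B 0%N)) p q.
  by apply: bv_inj; apply: boolp.funext => f; apply: E.
rewrite bivec_lieb.
have e : bivec DR C (Phi (cst p)) (Phi (cst q)) - bivec DR B (cst p) (cst q) =
    bivec DR (C - B) (cst p) (cst q) + bivec DR C (Phi (cst p) - cst p) (Phi (cst q)) +
    bivec DR C (cst p) (Phi (cst q) - cst q).
  exact: bivec_sub.
have e2 : pc (bivec DR C (Phi (cst p)) (Phi (cst q)) - bivec DR B (cst p) (cst q)) n =
    vfield D v (bivec D (vpc B 0%N) p q).
  rewrite h hv; congr (vfield _ _ _); rewrite pc_bivec_l //.
have E3 (a b c : R) s sa sb sc : pc (a + b + c) n = s -> pc a n = sa -> pc b n = sb ->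
    pc c n = sc -> sa = s - sb - sc.
  by move=> <- <- <- <-; rewrite !pcD; ring.
rewrite e in e2.
have := E3 _ _ _ _ _ _ _ e2 (pc_bivec_vanish _ _ hCB) (pc_bivec_l _ _ (hn _))
  (pc_bivec_r _ _ (hn _)).
by rewrite !hv C0 (pc_aut0 _ hP).
Qed.

Lemma vpc_cross_vvanish n B Y : vvanish n Y ->
  vpc (cross B Y) n = cross (vpc B 0%N) (vpc Y n).
Proof.
move=> /vvanishE [g1 g2 g3].
have M (a b : R) : vanish n b -> pc (a * b) n = pc a 0%N * pc b n.
  by move=> hb; rewrite mulrC pcM_vanish // mulrC.
by apply: vecE; rewrite vpcE !crossE !vpcE [LHS]pcD pcN !M.
Qed.

Lemma expB_stabilizer x B : vvanish 1 x -> lieb DR x B = 0 -> expB x B = B.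
Proof.
move=> hx h; apply: vpc_inj => n; rewrite vpc_expB big_ord_recl (fi0 (invfactE charK)).
rewrite big1 ?addr0 => [|i _]; first by apply: vecE; rewrite smulE mul1r.
have Z k : iter k.+1 (lieb DR x) B = 0.
  by elim: k => [|k IH]; [exact: h | rewrite iterS IH lieb0r].
by rewrite [iter _ _ _](Z i); apply: vecE; rewrite smulE vpcE mulr0.
Qed.

Lemma expf0 f : expf 0 f = f.
Proof.
apply: pserP => n; rewrite pc_expf big_ord_recl (fi0 (invfactE charK)) mul1r.
rewrite big1 ?addr0 // => i _.
have Z k : iter k.+1 (vfield DR 0) f = 0.
  by rewrite iterS /vfield /dot !vcE; ring.
by rewrite [iter _ _ _](Z i) mulr0.
Qed.

(** At each stage [cocycle_free] makes the series agree one order further, and shows that the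
    leading field of the automorphism is hamiltonian. *)
Lemma normal_form_unique F X F' X' Phi : d <> W ->
  vanish 1 F -> vanish 1 X -> vanish 1 F' -> vanish 1 X' ->
  (forall n, Fspan (pc F n) /\ Xspan (pc X n)) ->
  (forall n, Fspan (pc F' n) /\ Xspan (pc X' n)) ->
  automorphism Phi -> intertwines Phi (nform F X) (nform F' X') -> F' = F /\ X' = X.
Proof.
move=> dW hF hX hF' hX' sF sF' hP hI.
set B := nform F X in hI *; set C := nform F' X' in hI *.
have B0 : vpc B 0%N = grad D phi by apply: vpc_nform0.
have H n : [/\ vanish n.+1 (F' - F), vanish n.+1 (X' - X) &
   exists Phi, [/\ automorphism Phi, intertwines Phi B C & forall f, vanish n.+1 (Phi f - f)]].
  elim: n => [|n [dF dX [Psi [hQ hJ hn]]]].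
    split; last by exists Phi; split=> // f; apply: aut1.
      by move=> k hk; rewrite pcB hF // hF' // subrr.
    by move=> k hk; rewrite pcB hX // hX' // subrr.
  have [lt eqn] := nform_perturb hF hX dF dX.
  have [v hv] := aut_difference hQ (aut_id K) hn.
  have hCB : vvanish n.+1 (C - B) by move=> k hk; rewrite vpcD vpcN lt // subrr.
  have E := leading_cocycle hQ hJ hn hv hCB isT.
  have {}eqn : vpc (C - B) n.+1 =
      smul (pc F' n.+1 - pc F n.+1) (grad D phi) + grad D (pc X' n.+1 - pc X n.+1).
    by rewrite vpcD vpcN [vpc C _]eqn // addrC addKr.
  have [N [c [hc eF]]] := Fspan_sub (sF' n.+1).1 (sF n.+1).1.
  have [cb eX] := Xspan_sub (sF' n.+1).2 (sF n.+1).2.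
  rewrite eqn B0 eF eX in E.
  have [F0 X0 [h eh]] := cocycle_free charK w_gt0 hphi mu_gt0 u0 hu hbasis dW hc (esym E).
  (* Hamiltonian for the whole of [B], not only for grad phi, so that its exponential fixes [B]
     exactly; its leading coefficient is [- v], which cancels that of [Psi]. *)
  pose y := cross B (grad DR (nu _ ^+ n.+1 * cst (- h))).
  have vh : vanish n.+1 (nu _ ^+ n.+1 * cst (- h)) by apply: vanishMl; apply: vanish_exp.
  have vg := vvanish_grad vh.
  have vy' : vvanish n.+1 y.
    have /vvanishE [g1 g2 g3] := vg; apply/vvanishE; rewrite !crossE.
    by split; apply: vanishD; try apply: vanishN; rewrite mulrC; apply: vanishMl.
  have vy1 : vvanish 1 y by move=> k hk; apply: vy'; apply: leq_trans hk _.
  have yn : vpc y n.+1 = - v.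
    rewrite vpc_cross_vvanish // B0 vpc_grad.
    rewrite pcM_vanish; last exact: vanish_exp.
    by rewrite pc_nuX mul1r gradN eh; apply: vecE; rewrite !vcE; ring.
  have hY := aut_exp charK vy1.
  split.
  - by move=> k; rewrite ltnS leq_eqVlt => /orP [/eqP ->|/dF //]; rewrite pcB eF.
  - by move=> k; rewrite ltnS leq_eqVlt => /orP [/eqP ->|/dX //]; rewrite pcB eX.
  exists (Psi \o expf y); split; first exact: aut_comp.
    apply: (intertwines_comp _ hJ).
    have e : expB y B = B.
      apply: expB_stabilizer => //; rewrite lieb_hamiltonian jacb_nform.
      by apply: vecE; rewrite smulE oppr0 mul0r.
    by have := expB_intertwines charK B vy1; rewrite e.
  move=> f k hk.
  have z0 : vvanish 1 (0 : vec R) by [].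
  have vyz : vvanish n.+1 (y - 0) by move=> j hj; rewrite subr0 vy'.
  have [p1 p2] := pc_expf_perturb D (invfactE charK) f z0 vy1 vyz.
  have -> : (Psi \o expf y) f - f = (Psi (expf y f) - expf y f) + (expf y f - f).
    by rewrite subrKA.
  rewrite [LHS]pcD.
  move: hk; rewrite ltnS leq_eqVlt => /orP [/eqP ->|hk].
    rewrite hv pcB p2 // expf0 subr0 yn (pc_aut0 _ hY) vfieldNl.
    by rewrite [pc f n.+1 + _]addrC addrK subrr.
  by rewrite hn // pcB p1 // expf0 subrr addr0.
split; apply/eqP; rewrite -subr_eq0; apply/eqP; apply: pserP => n.
  by have [-> //] := H n.
by have [_ -> //] := H n.
Qed.

End NormalForms.

(** * Finitely supported families of constants as finite double sums *)

Section FiniteSupport.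
Variables (K : fieldType) (phi : poly3 K) (mu : nat) (u : 'I_mu -> poly3 K).
Variable E : pred 'I_mu.
Implicit Types (c : {fsfun nat * 'I_mu -> K with 0}) (N : nat).

Definition fssum c : poly3 K :=
  \sum_(li <- finsupp c | E li.2) c li *: (phi ^+ li.1 * u li.2).

Lemma fssum_phisum c N : (forall li, li \in finsupp c -> (li.1 < N)%N) ->
  fssum c = phisum phi u N (fun l i => if E i then c (l, i) else 0).
Proof.
move=> hN; pose G li := if E li.2 then c li *: (phi ^+ li.1 * u li.2) else 0.
pose s := [seq (l, i) | l <- iota 0 N, i <- enum 'I_mu].
have us : uniq s.
  by apply: allpairs_uniq; rewrite ?iota_uniq ?enum_uniq // => -[a b] [a' b'] _ _ [-> ->].
have ps : perm_eq (finsupp c) [seq li <- s | li \in finsupp c].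
  apply: uniq_perm; rewrite ?fset_uniq ?filter_uniq // => -[l i]; rewrite mem_filter.
  case: (boolP ((l, i) \in finsupp c)) => //= h; apply/esym/allpairsP; exists (l, i).
  by rewrite mem_iota mem_enum (hN _ h).
rewrite /fssum big_mkcond (perm_big _ ps) big_filter big_mkcond /=.
transitivity (\sum_(li <- s) G li).
  apply: eq_bigr => li _; rewrite /G; case: ifP => // /negbT /fsfun_dflt ->.
  by rewrite scale0r if_same.
rewrite big_allpairs /phisum.
rewrite -(big_mkord xpredT (fun l => \sum_i (if E i then c (l, i) else 0) *: (phi ^+ l * u i))).
rewrite /index_iota subn0; apply: eq_bigr => l _; rewrite big_enum; apply: eq_bigr => i _.
by rewrite /G /=; case: ifP; rewrite ?scale0r.
Qed.

Lemma finsupp_bound c : exists N, forall li, li \in finsupp c -> (li.1 < N)%N.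
Proof.
exists (\max_(li <- finsupp c) li.1).+1 => li h; rewrite ltnS.
by rewrite (big_rem li) //= leq_maxl.
Qed.

Lemma phisum_fssum N (a : nat -> 'I_mu -> K) : (forall l i, ~~ E i -> a l i = 0) ->
  exists c, phisum phi u N a = fssum c.
Proof.
move=> ha; pose S := [fset li in [seq (l, i) | l <- iota 0 N, i <- enum 'I_mu]]%fset.
pose c : {fsfun nat * 'I_mu -> K with 0} := [fsfun li in S => a li.1 li.2].
exists c; rewrite (@fssum_phisum c N) => [|li].
  apply: eq_bigr => l _; apply: eq_bigr => i _; congr (_ *: _).
  case: (boolP (E i)) => [_|/ha //]; rewrite fsfunE ifT //.
  rewrite inE /=; apply/allpairsP; exists (nat_of_ord l, i).
  by rewrite mem_iota mem_enum /= ltn_ord.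
rewrite mem_finsupp fsfunE; case: ifP => [|_]; last by rewrite eqxx.
by rewrite inE /= => /allpairsP [[l i] [/=]]; rewrite mem_iota => h _ -> _.
Qed.

End FiniteSupport.

(** * Normal forms as representatives of gauge classes *)

Section MainTheorem.
Variables (K : fieldType) (charK : [pchar K] =i pred0) (phi : poly3 K).
Variables (w : 'I_3 -> nat) (d : nat) (mu : nat) (u : 'I_mu -> poly3 K).
Hypothesis w_gt0 : forall i, (0 < w i)%N.
Hypothesis hphi : whomog w d phi.
Hypothesis mu_gt0 : (0 < mu)%N.
Hypothesis u0 : forall i : 'I_mu, i = 0%N :> nat -> u i = 1.
Hypothesis hu : forall i : 'I_mu, exists e : nat, whomog w e (u i).
Hypothesis hbasis : basis_Asing phi u.
Local Notation A := (poly3 K).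
Local Notation D := (pder K).
Local Notation R := (pser A).
Local Notation DR := (lift3 D).
Local Notation W := (total_weight w).
Local Notation P := (gradc phi).
Implicit Types (c : nat -> {fsfun nat * 'I_mu -> K with 0}) (cb : nat -> 'I_mu -> K).
Implicit Types (s t : series K 2).

Definition fser c : R := Pser (fun n => if n == 0%N then 0 else fssum phi u (@Ephi w d mu) (c n)).
Definition xser cb : R := Pser (fun n => if n == 0%N then 0 else
  \sum_(s < mu | (0 < s)%N) cb n s *: u s).

Lemma bv_grad_sum (a : 'I_mu -> K) (f : {ffun 'I_2 -> A}) :
  bv (grad D (\sum_(s < mu | (0 < s)%N) a s *: u s)) f =
  \sum_(s < mu | (0 < s)%N) a s *: poisson (u s) f.
Proof.
elim/big_rec2: _ => [|s p q _ <-].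
  by rewrite (_ : grad D 0 = 0) ?bv0 //; apply: vecE; rewrite gradE dd0.
rewrite gradD bvD poisson_bv; congr (_ + _).
rewrite -!mul_mpolyC -bv_smul; congr (bv _ f).
by apply: vecE; rewrite smulE !gradE ddM [dd D _ _%:MP]mderivC mul0r add0r.
Qed.

(** Expanding the product leaves F grad X + F grad phi + grad X, whose terms are the three sums of
    [gamma]. *)
Lemma gamma_ser c cb : gamma w d phi u c cb = ser2 (nform phi (fser c) (xser cb) - P).
Proof.
have e : nform phi (fser c) (xser cb) - P =
    smul (fser c) (grad DR (xser cb)) + smul (fser c) P + grad DR (xser cb).
  by rewrite /nform /gradc gradD; apply: vecE; rewrite !vcE; ring.
have pcs (a : R) (V : vec R) n : vpc (smul a V) n =
    \sum_(i < n.+1) smul (pc a i) (vpc V (n - i)).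
  by apply: vecE; rewrite vpcE vec_sumE smulE pcM; apply: eq_bigr => i _; rewrite smulE.
have fsE n (B : vec A) f : bv (smul (fssum phi u (@Ephi w d mu) (c n)) B) f =
    \sum_(li <- finsupp (c n) | Ephi w d li.2)
       c n li *: (phi ^+ li.1 * u li.2 * bv B f).
  rewrite bv_smul /fssum mulr_suml; apply: eq_bigr => li _.
  by rewrite -scalerAl.
apply: boolp.funext => n; apply: boolp.funext => f; rewrite /ser2 e !vpcD !bvD /gamma.
rewrite vpc_grad /=; case: n => [|n] /=.
  rewrite !pcs !big_ord_recl !big_ord0 !addr0 /= !bv_smul !mul0r !add0r.
  by rewrite (_ : grad D 0 = 0) ?bv0 //; apply: vecE; rewrite gradE dd0.
congr (_ + _ + _); last by rewrite bv_grad_sum.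
- rewrite pcs bv_sum -(big_mkord xpredT (fun i => bv (smul (pc (fser c) i)
     (vpc (grad DR (xser cb)) (n.+1 - i))) f)).
  (* The extreme indices of the convolution drop out, as both series have constant term 0. *)
  rewrite [RHS]big_nat_recr //= subnn [X in _ = X + _]big_ltn // subn0 !bv_smul mul0r add0r.
  rewrite vpc_grad /= (_ : grad D 0 = 0); last by apply: vecE; rewrite gradE dd0.
  rewrite bv0 mulr0 addr0 [LHS]big_nat [RHS]big_nat; apply: eq_bigr => a /andP [a1 a2].
  rewrite vpc_grad /= -[a == 0%N]negbK -lt0n a1 /= subn_eq0 leqNgt a2 /= fsE.
  apply: eq_bigr => li _; rewrite bv_grad_sum mulr_sumr scaler_sumr.
  by apply: eq_bigr => r _; rewrite -scalerAr scalerA.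
- have -> : vpc (smul (fser c) P) n.+1 = smul (pc (fser c) n.+1) (grad D phi).
    by apply: vecE; rewrite vpcE !smulE !gradE dd_cst mulrC pc_cstM mulrC.
  by rewrite fsE -poisson_bv.
Qed.

Lemma fser_vanish c : vanish 1 (fser c). Proof. by case. Qed.
Lemma xser_vanish cb : vanish 1 (xser cb). Proof. by case. Qed.

Lemma nform_vanish (F X : R) : vanish 1 F -> vanish 1 X -> vvanish 1 (nform phi F X - P).
Proof.
by move=> hF hX [|//] _; rewrite vpcD vpcN vpc_nform0 // vpc_gradc subrr.
Qed.

Lemma fser_span c n : Fspan phi w d u (pc (fser c) n).
Proof.
rewrite /=; case: eqP => _; first exact: Fspan0.
have [N hN] := finsupp_bound (c n); rewrite (fssum_phisum _ _ _ hN).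
by eexists; eexists; split; last reflexivity; move=> l i /= /negbTE ->.
Qed.

Lemma xser_span cb n : Xspan u (pc (xser cb) n).
Proof. by rewrite /=; case: eqP => _; [apply: Xspan0 | exists (cb n)]. Qed.

Lemma span_series (F X : R) : vanish 1 F -> vanish 1 X ->
  (forall n, Fspan phi w d u (pc F n) /\ Xspan u (pc X n)) ->
  exists c cb, F = fser c /\ X = xser cb.
Proof.
move=> hF hX h.
have /boolp.choice [c hc] : forall n, exists c : {fsfun nat * 'I_mu -> K with 0},
    pc F n = fssum phi u (@Ephi w d mu) c.
  by move=> n; have [[N [a [ha ->]]] _] := h n; apply: phisum_fssum => l i; apply: ha.
have /boolp.choice [cb hcb] := fun n => (h n).2.
exists c, cb; split; apply: pserP => n /=; case: eqP => [->|_] //; [exact: hF | exact: hX].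
Qed.

Lemma normal_form_ser s : normal_form w d phi u s <->
  exists c cb, s = ser2 (nform phi (fser c) (xser cb) - P).
Proof.
by split=> -[c [cb ->]]; exists c, cb; rewrite gamma_ser.
Qed.

Lemma normal_form_MC s : normal_form w d phi u s -> MC phi s.
Proof.
move=> /normal_form_ser [c [cb ->]]; apply/MC_ser => //.
  by apply: nform_vanish; [apply: fser_vanish | apply: xser_vanish].
by rewrite addrC subrK jacb_nform.
Qed.

Lemma MC_normal_form s : MC phi s -> exists2 t, normal_form w d phi u t & gauge phi s t.
Proof.
move=> hMC; have [G [hG es]] := nu_series2P charK hMC.1; move: hMC; rewrite es.
move=> /(MC_ser charK phi hG) jG.
have [x [F [X [hx [hF hX] hFX e]]]] :=
  normal_form_exists charK w_gt0 hphi mu_gt0 u0 hu hbasis hG jG.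
have [c [cb [eF eX]]] := span_series hF hX hFX.
exists (ser2 (nform phi F X - P)); first by apply/normal_form_ser; exists c, cb; rewrite eF eX.
apply/gauge_ser => //; exists (expf D (@invfact K) x); split; first exact: aut_exp.
by rewrite [P + (_ - P)]addrC subrK -e; apply: expB_intertwines.
Qed.

(** A single exponential is not visibly stable under inversion or composition, but automorphisms
    are; hence the detour through [gauge_ser] here and for transitivity. *)
Lemma gauge_sym s t : MC phi s -> MC phi t -> gauge phi s t -> gauge phi t s.
Proof.
move=> [/(nu_series2P charK) [G [_ ->]] _] [/(nu_series2P charK) [G' [_ ->]] _].
move=> /(gauge_ser charK) [Phi [hP hI]]; have [Psi [hQ c1 c2]] := aut_inv charK hP.
by apply/(gauge_ser charK); exists Psi; split=> //; apply: intertwines_inv hI.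
Qed.

Lemma gauge_trans s t r : MC phi s -> MC phi t -> MC phi r ->
  gauge phi s t -> gauge phi t r -> gauge phi s r.
Proof.
move=> [/(nu_series2P charK) [G [_ ->]] _] [/(nu_series2P charK) [G' [_ ->]] _].
move=> [/(nu_series2P charK) [G'' [_ ->]] _].
move=> /(gauge_ser charK) [Phi [hP hI]] /(gauge_ser charK) [Psi [hQ hJ]].
apply/(gauge_ser charK); exists (Psi \o Phi); split; first exact: aut_comp.
exact: intertwines_comp hI hJ.
Qed.

Lemma gauge_refl s : MC phi s -> gauge phi s s.
Proof.
move=> [/(nu_series2P charK) [G [_ ->]] _]; apply/(gauge_ser charK).
by exists id; split; first exact: aut_id.
Qed.

Lemma gauge_class_eq s t : MC phi s -> MC phi t -> gauge phi s t ->
  gauge_class phi s = gauge_class phi t.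
Proof.
move=> hs ht h; apply: boolp.funext => r; apply: boolp.propext.
split=> -[hr h']; split=> //; last exact: gauge_trans h h'.
exact: gauge_trans (gauge_sym hs ht h) h'.
Qed.

Lemma normal_form_gauge_eq s t : d <> W -> normal_form w d phi u s ->
  normal_form w d phi u t -> gauge phi s t -> s = t.
Proof.
move=> dW /normal_form_ser [c [cb ->]] /normal_form_ser [c' [cb' ->]].
move=> /(gauge_ser charK) [Phi [hP]].
rewrite ![P + (_ - P)]addrC !subrK => hI.
have [||||||-> -> //] :=
  @normal_form_unique _ charK phi w d mu u w_gt0 hphi mu_gt0 u0 hu hbasis
    (fser c) (xser cb) (fser c') (xser cb') Phi dW _ _ _ _ _ _ hP hI;
  by [apply: fser_vanish | apply: xser_vanish | move=> n; split; [apply: fser_span | apply: xser_span]].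
Qed.

End MainTheorem.

Theorem theorem4p5 (K : fieldType) (charK : [pchar K] =i pred0)
    (phi : {mpoly K[3]}) (w : 'I_3 -> nat) (d : nat)
    (hw : weight_system w) (hphi : whomog w d phi)
    (hsing : isolated_singularity phi)
    (mu : nat) (u : 'I_mu -> {mpoly K[3]}) (mu_gt0 : (0 < mu)%N)
    (u0 : forall i : 'I_mu, i = 0%N :> nat -> u i = 1)
    (hu : forall i : 'I_mu, exists e : nat, whomog w e (u i))
    (hbasis : basis_Asing phi u) :
  [/\ forall g : series K 2, normal_form w d phi u g -> MC phi g,
      forall g : series K 2, MC phi g ->
        exists2 g' : series K 2, normal_form w d phi u g' & gauge phi g g'
    & forall C : series K 2 -> Prop,
        Def_nu phi C <->
        exists2 g : series K 2, normal_form w d phi u g & C = gauge_class phi g]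
  /\
  (d <> total_weight w ->
     (forall g : series K 2, normal_form w d phi u g -> Def_nu phi (gauge_class phi g)) /\
     (forall C : series K 2 -> Prop, Def_nu phi C ->
        exists! g : series K 2, normal_form w d phi u g /\ gauge_class phi g = C)).
Proof.
have w_gt0 := hw.1.
have nMC g : normal_form w d phi u g -> MC phi g by apply: normal_form_MC.
have ex g : MC phi g -> exists2 g', normal_form w d phi u g' & gauge phi g g'.
  exact: MC_normal_form.
have classes C : Def_nu phi C <-> exists2 g, normal_form w d phi u g & C = gauge_class phi g.
  split=> [[g hg ->]|[g /nMC hg ->]]; last by exists g.
  have [g' n' h] := ex g hg; exists g' => //.
  by apply: gauge_class_eq => //; apply: nMC.
split; first by split.
move=> dW; split=> [g /nMC hg|C /classes [g ng eC]]; first by exists g.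
exists g; split=> // g' [ng' eC'].
apply: (normal_form_gauge_eq charK w_gt0 hphi mu_gt0 u0 hu hbasis dW ng ng').
(* By reflexivity [g'] lies in its own class, hence in that of [g]. *)
have : gauge_class phi g' g' by split; [apply: nMC | apply: gauge_refl => //; apply: nMC].
by rewrite eC' eC => -[].
Qed.
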